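(* The ring $f(\mathcal{P})\otimes\mathbb{Q}$ is a free (commutative) polynomial algebra over $\mathbb Q$.
   Context: A combinatorial polytope is a combinatorial equivalence class of convex polytopes. The ring of polytopes $\mathcal{P}$ is, as an abelian group, free on all (non-empty) combinatorial polytopes, with multiplication induced by the direct product and unit the point. For a composition $\omega=(j_1,\dots,j_k)$, $j_i\ge 1$, $M_\omega=\sum_{l_1<\dots<l_k}t_{l_1}^{j_1}\cdots t_{l_k}^{j_k}$; $\mathrm{Qsym}[t_1,t_2,\dots]$ is the ring of finite integer combinations of the $M_\omega$ (and constants). The generalized $f$-polynomial is the ring homomorphism $f:\mathcal{P}\to\mathrm{Qsym}[t_1,t_2,\dots][\alpha]$ given on an $n$-dimensional polytope by $$f(\alpha,t_1,t_2,\dots)(P^n)=\alpha^n+\sum_{k=1}^{n}\ \sum_{0\leqslant a_1<\dots<a_k\leqslant n-1}f_{a_1,\dots,a_k}\,\alpha^{a_1}M_{(n-a_k,\,a_k-a_{k-1},\dots,\,a_2-a_1)},$$ where $f_{a_1,\dots,a_k}$ is the number of chains of faces $F^{a_1}\subset\dots\subset F^{a_k}$ of $P^n$ with $\dim F^{a_i}=a_i$. $f(\mathcal{P})$ denotes the image of $f$. *)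

(* Defs.v *)
From HB Require Import structures.
From mathcomp Require Import all_boot all_order all_algebra finmap generic_quotient.
From mathcomp Require Import boolp classical_sets functions cardinality fsbigop.
From mathcomp Require Import reals monalg lra.

Set Implicit Arguments.
Unset Strict Implicit.
Unset Printing Implicit Defensive.

Import Order.TTheory GRing.Theory Num.Theory.

Local Open Scope classical_set_scope.
Local Open Scope quotient_scope.
Local Open Scope ring_scope.

Local Notation "1" := (@mone _) : monom_scope.
Local Notation "x * y" := (mmul x y) : monom_scope.

(* Formal power series in t_0, t_1, t_2, ... over K; {poly tseries K} is the
   ring of polynomials in alpha over them. *)
Record tseries (K : Type) := TSeries { tcoef : {cmonom nat} -> K }.

HB.instance Definition _ (K : Type) := gen_eqMixin (tseries K).
HB.instance Definition _ (K : Type) := gen_choiceMixin (tseries K).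

Lemma tseriesP (K : Type) (f g : tseries K) : tcoef f =1 tcoef g -> f = g.
Proof. by case: f g => [f] [g] /= fg; congr TSeries; apply/funext. Qed.

Definition factorizations (m : {cmonom nat}) : set ({cmonom nat} * {cmonom nat}) :=
  [set p | (p.1 * p.2)%M = m].

Lemma finite_factorizations m : finite_set (factorizations m).
Proof.
pose D := [set d : {cmonom nat} | exists e, (d * e)%M = m].
suff fD : finite_set D.
  apply: sub_finite_set (finite_setX fD fD) => -[d e] /= de; split => /=.
    by exists e.
  by exists d; rewrite mulmC.
pose h (u : {ffun finsupp m -> 'I_(mdeg m).+1}) : {cmonom nat} :=
  mkcmonom [fsfun i : finsupp m => nat_of_ord (u i) | 0%N].
apply: sub_finite_set (finite_image h (@finite_finset _ setT)) => d [e de].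
have le_dm i : (d i <= m i)%N by rewrite -de cmM leq_addr.
have le_mdeg i : (m i <= mdeg m)%N.
  have [im|/fsfun_dflt->//] := boolP (i \in finsupp m).
  by rewrite mdegE (big_fsetD1 i im) /= leq_addr.
exists [ffun i => inord (d (val i))] => //.
apply/eqP/cmP => i; rewrite /h cmE.
rewrite fsfun_ffun; case: insubP => [u _ <-|im] /=.
  by rewrite ffunE inordK // ltnS (leq_trans (le_dm _)).
by apply/esym/eqP; rewrite -leqn0 (leq_trans (le_dm i)) // fsfun_dflt.
Qed.

Section Series.
Variable K : comNzRingType.
Implicit Types f g h : tseries K.

Definition tsC (c : K) := TSeries (fun m => if m == 1%M then c else 0).
Definition ts_opp f := TSeries (fun m => - tcoef f m).
Definition ts_add f g := TSeries (fun m => tcoef f m + tcoef g m).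
Definition ts_mul f g := TSeries (fun m =>
  \sum_(p \in factorizations m) tcoef f p.1 * tcoef g p.2).

Fact ts_addA : associative ts_add.
Proof. by move=> f g h; apply/tseriesP => m /=; rewrite addrA. Qed.
Fact ts_addC : commutative ts_add.
Proof. by move=> f g; apply/tseriesP => m /=; rewrite addrC. Qed.
Fact ts_add0 : left_id (tsC 0) ts_add.
Proof. by move=> f; apply/tseriesP => m /=; rewrite if_same add0r. Qed.
Fact ts_addN : left_inverse (tsC 0) ts_opp ts_add.
Proof. by move=> f; apply/tseriesP => m /=; rewrite if_same addNr. Qed.
HB.instance Definition _ := GRing.isZmodule.Build (tseries K)
  ts_addA ts_addC ts_add0 ts_addN.

(* F and f agree on the divisors of m; the ring axioms for series are derived
   from those of the finitely supported ones. *)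
Definition ts_approx (m : {cmonom nat}) (F : {malg K[{cmonom nat}]}) f :=
  forall d e, (d * e)%M = m -> F@_d = tcoef f d.

Lemma mcoeffM_factorizations (F G : {malg K[{cmonom nat}]}) m :
  (F * G)@_m = \sum_(p \in factorizations m) F@_p.1 * G@_p.2.
Proof.
rewrite fsbig_finite; last exact: finite_factorizations.
set S := fset_set _.
have S1 p : (p \in S) = ((p.1 * p.2)%M == m).
  rewrite in_fset_set; last exact: finite_factorizations.
  by apply/idP/eqP; rewrite inE.
pose d1 := (msupp F `|` [fset p.1 | p in S])%fset.
pose d2 := (msupp G `|` [fset p.2 | p in S])%fset.
have -> : F * G = fgmul F G by [].
rewrite (@fgmullw _ _ d1 d2); try exact: fsubsetUl.
rewrite raddf_sum /=.
under eq_bigr do rewrite raddf_sum /=.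
under eq_bigr do under eq_bigr do rewrite mcoeffU.
transitivity (\sum_(p <- [seq (i, j) | i <- d1, j <- d2] | (p.1 * p.2)%M == m)
   F@_p.1 * G@_p.2).
  rewrite [RHS]big_mkcond big_allpairs /=.
  do 2!apply: eq_bigr => ? _.
  by case: eqP; rewrite ?mulr1n ?mulr0n.
rewrite -[LHS]big_filter; apply: perm_big.
apply: uniq_perm.
- by apply/filter_uniq/allpairs_uniq => //; case=> ? ? [? ?] _ _ /= [-> ->].
- exact: fset_uniq.
move=> -[i j]; rewrite mem_filter S1 /=; case: eqP => //= ijm.
apply/allpairsP; exists (i, j); split => //=.
  apply/fsetUP; right; apply/imfsetP; exists (i, j) => //=.
  by rewrite S1 /= ijm.
apply/fsetUP; right; apply/imfsetP; exists (i, j) => //=.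
by rewrite S1 /= ijm.
Qed.

Lemma mcoeff_sumU (T : choiceType) (D : {fset T}) (c : T -> K) d : d \in D ->
  (\sum_(x <- D) << c x *g x >>)@_d = c d.
Proof.
move=> dD; rewrite raddf_sum (big_fsetD1 d) //= mcoeffUU big1_fset ?addr0 // => k.
by rewrite in_fsetD1 mcoeffU; case: eqP.
Qed.

Lemma ts_approxP m f : exists F, ts_approx m F f.
Proof.
pose S := fset_set (factorizations m).
pose D := [fset p.1 | p in S]%fset.
exists (\sum_(d <- D) << tcoef f d *g d >>) => d e de.
have dD : d \in D.
  apply/imfsetP; exists (d, e) => //=.
  rewrite in_fset_set; last exact: finite_factorizations.
  by rewrite inE.
exact: mcoeff_sumU.
Qed.

Lemma ts_approxM m F G f g :
  ts_approx m F f -> ts_approx m G g -> ts_approx m (F * G) (ts_mul f g).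
Proof.
move=> Ff Gg d e de; rewrite mcoeffM_factorizations /=.
apply: eq_fsbigr => -[x y]; rewrite inE => /= xyd.
by rewrite (Ff _ (y * e)%M) ?(Gg _ (x * e)%M) // mulmA ?xyd // (mulmC y) xyd.
Qed.

Lemma ts_approxD m F G f g :
  ts_approx m F f -> ts_approx m G g -> ts_approx m (F + G) (ts_add f g).
Proof. by move=> Ff Gg d e de; rewrite mcoeffD (Ff d e) // (Gg d e). Qed.

Lemma ts_approx1 m : ts_approx m 1 (tsC 1).
Proof.
by move=> d e _; rewrite /= mcoeffU eq_sym; case: eqP.
Qed.

Lemma ts_approx_eq f g :
  (forall m, exists F, ts_approx m F f /\ ts_approx m F g) -> f = g.
Proof.
move=> fg; apply/tseriesP => m; have [F [Ff Fg]] := fg m.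
by rewrite -(Ff m 1%M) ?mulm1 // -(Fg m 1%M) ?mulm1.
Qed.

Fact ts_mulA : associative ts_mul.
Proof.
move=> f g h; apply: ts_approx_eq => m.
have [F Ff] := ts_approxP m f; have [G Gg] := ts_approxP m g.
have [H Hh] := ts_approxP m h.
exists (F * (G * H)); split; first by do 2!apply: ts_approxM => //.
by rewrite mulrA; do 2!apply: ts_approxM => //.
Qed.
Fact ts_mulC : commutative ts_mul.
Proof.
move=> f g; apply: ts_approx_eq => m.
have [F Ff] := ts_approxP m f; have [G Gg] := ts_approxP m g.
by exists (F * G); split; [|rewrite mulrC]; apply: ts_approxM.
Qed.
Fact ts_mul1 : left_id (tsC 1) ts_mul.
Proof.
move=> f; apply: ts_approx_eq => m; have [F Ff] := ts_approxP m f.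
by exists F; split => //; rewrite -[F]mul1r; apply: ts_approxM => //; exact: ts_approx1.
Qed.
Fact ts_mulD : left_distributive ts_mul ts_add.
Proof.
move=> f g h; apply: ts_approx_eq => m.
have [F Ff] := ts_approxP m f; have [G Gg] := ts_approxP m g.
have [H Hh] := ts_approxP m h.
exists ((F + G) * H); split; first by apply: ts_approxM => //; apply: ts_approxD.
by rewrite mulrDl; apply: ts_approxD; apply: ts_approxM.
Qed.
Fact ts_one_neq0 : tsC 1 != 0.
Proof.
apply/eqP => /(congr1 (fun f => tcoef f 1%M)) /=.
by rewrite eqxx => /eqP; rewrite oner_eq0.
Qed.
HB.instance Definition _ := GRing.Zmodule_isComNzRing.Build (tseries K)
  ts_mulA ts_mulC ts_mul1 ts_mulD ts_one_neq0.

End Series.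

Section Polytopes.
Variable R : realType.

Definition hull d (I : finType) (v : I -> 'rV[R]_d) : set 'rV[R]_d :=
  [set x | exists a : I -> R,
    [/\ forall i, 0 <= a i, \sum_i a i = 1 & x = \sum_i a i *: v i]].

Record polytope := Polytope {
  ambient : nat;
  carrier :> set 'rV[R]_ambient;
  polytopeP : carrier !=set0 /\
    exists m (v : 'I_m -> 'rV[R]_ambient), carrier = hull v }.

HB.instance Definition _ := gen_eqMixin polytope.
HB.instance Definition _ := gen_choiceMixin polytope.

(* Nonempty faces; A itself is the case c = 0, b = 0. *)
Definition face d (A F : set 'rV[R]_d) :=
  F !=set0 /\ exists (c : 'cV[R]_d) (b : R),
    (forall x, A x -> (x *m c) 0 0 <= b) /\ F = [set x | A x /\ (x *m c) 0 0 = b].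

(* The dimension of the affine span of A, for A nonempty: the maximal k such that
   A contains k + 1 affinely independent points x, x + M_1, ..., x + M_k. *)
Definition affdim d (A : set 'rV[R]_d) : nat :=
  \max_(k < d.+1 | `[< exists x (M : 'M[R]_(k, d)),
    [/\ A x, forall i, A (x + row i M) & row_free M] >]) k.

Definition face_of (P : polytope) := {F : set 'rV[R]_(ambient P) | face P F}.
Definition face_le P (F G : face_of P) := sval F `<=` sval G.

End Polytopes.

Arguments carrier {R} P _ : rename.

Definition order_iso (A B : Type) (rA : A -> A -> Prop) (rB : B -> B -> Prop) :=
  exists2 f : A -> B, bijective f & forall x y, rB (f x) (f y) <-> rA x y.

Definition prod_le (A B : Type) (rA : A -> A -> Prop) (rB : B -> B -> Prop) :=
  fun x y : A * B => rA x.1 y.1 /\ rB x.2 y.2.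

Section OrderIso.
Variables (A B C D : Type).
Variables (rA : A -> A -> Prop) (rB : B -> B -> Prop).
Variables (rC : C -> C -> Prop) (rD : D -> D -> Prop).

Lemma order_iso_refl : order_iso rA rA.
Proof. by exists id => //; exists id. Qed.

Lemma order_iso_sym : order_iso rA rB -> order_iso rB rA.
Proof.
by case=> f [g fK gK] fr; exists g; [exists f | move=> x y; rewrite -fr !gK].
Qed.

Lemma order_iso_trans : order_iso rA rB -> order_iso rB rC -> order_iso rA rC.
Proof.
case=> f bf fr [g bg gr]; exists (g \o f); first exact: bij_comp.
by move=> x y; rewrite /= gr fr.
Qed.

Lemma order_iso_prod : order_iso rA rB -> order_iso rC rD ->
  order_iso (prod_le rA rC) (prod_le rB rD).
Proof.
case=> f [f' fK f'K] fr [g [g' gK g'K] gr].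
exists (fun x => (f x.1, g x.2)); last by move=> x y; rewrite /prod_le /= fr gr.
by exists (fun x => (f' x.1, g' x.2)) => -[x y] /=; rewrite ?fK ?gK ?f'K ?g'K.
Qed.

Lemma order_iso_prodA :
  order_iso (prod_le rA (prod_le rB rC)) (prod_le (prod_le rA rB) rC).
Proof.
exists (fun x => ((x.1, x.2.1), x.2.2)); last first.
  by move=> x y; rewrite /prod_le /=; tauto.
by exists (fun x => (x.1.1, (x.1.2, x.2))) => [[? []]|[[]]].
Qed.

Lemma order_iso_prodC : order_iso (prod_le rA rB) (prod_le rB rA).
Proof.
exists (fun x => (x.2, x.1)); last by move=> x y; rewrite /prod_le /=; tauto.
by exists (fun x => (x.2, x.1)) => -[].
Qed.

Lemma order_iso_prod1 : order_iso (prod_le (fun _ _ : unit => True) rA) rA.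
Proof.
exists snd; last by move=> x y; rewrite /prod_le /=; tauto.
by exists (pair tt) => // -[[]].
Qed.
End OrderIso.

Section CombinatorialPolytopes.
Variable R : realType.
Implicit Types P Q S : polytope R.

(* Isomorphism of the posets of nonempty faces, or equivalently of the face
   lattices. *)
Definition comb_equiv P Q := order_iso (@face_le R P) (@face_le R Q).

Lemma hull_ord d (I : finType) (v : I -> 'rV[R]_d) :
  hull v = hull (fun i : 'I_#|I| => v (enum_val i)).
Proof.
have bij : {on [pred i : I | true], bijective (@enum_val I I)}.
  by apply: onW_bij; exact: enum_val_bij.
apply/seteqP; split=> x [a [a0 a1 ->]].
  exists (fun i => a (enum_val i)); split=> //; last exact: reindex.
  by rewrite -a1; apply/esym/reindex.
exists (fun i => a (enum_rank i)); split=> //.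
  by rewrite -a1 (reindex _ bij); apply: eq_bigr => i _; rewrite enum_valK.
by rewrite [RHS](reindex _ bij); apply: eq_bigr => i _; rewrite enum_valK.
Qed.

Definition point_set : set 'rV[R]_0 := setT.
Lemma point_setP : point_set !=set0 /\
  exists m (v : 'I_m -> 'rV[R]_0), point_set = hull v.
Proof.
split; first by exists 0.
exists 1%N, (fun=> 0); apply/seteqP; split=> // x _.
by exists (fun=> 1); rewrite !big_ord1 !thinmx0.
Qed.
Definition point := Polytope point_setP.

Definition prod_set m n (A : set 'rV[R]_m) (B : set 'rV[R]_n) : set 'rV[R]_(m + n) :=
  [set x | A (lsubmx x) /\ B (rsubmx x)].

Section HullProduct.
Variables (m n : nat) (I J : finType).
Variables (v : I -> 'rV[R]_m) (w : J -> 'rV[R]_n) (c : I * J -> R).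

Lemma lsubmx_comb : lsubmx (\sum_p c p *: row_mx (v p.1) (w p.2)) =
  \sum_i (\sum_j c (i, j)) *: v i.
Proof.
under [RHS]eq_bigr do rewrite scaler_suml.
rewrite pair_bigA /= linear_sum; apply: eq_bigr => -[i j] _ /=.
by rewrite linearZ /= row_mxKl.
Qed.

Lemma rsubmx_comb : rsubmx (\sum_p c p *: row_mx (v p.1) (w p.2)) =
  \sum_j (\sum_i c (i, j)) *: w j.
Proof.
under [RHS]eq_bigr do rewrite scaler_suml.
rewrite exchange_big pair_bigA /= linear_sum; apply: eq_bigr => -[i j] _ /=.
by rewrite linearZ /= row_mxKr.
Qed.

End HullProduct.

Lemma prod_set_hull m n (I J : finType) (v : I -> 'rV[R]_m) (w : J -> 'rV[R]_n) :
  prod_set (hull v) (hull w) = hull (fun p : I * J => row_mx (v p.1) (w p.2)).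
Proof.
apply/seteqP; split=> x /=.
  move=> [[a [a0 a1 ax]] [b [b0 b1 bx]]].
  exists (fun p => a p.1 * b p.2); split.
  - by move=> p; apply: mulr_ge0.
  - rewrite -(pair_bigA _ (fun i j => a i * b j)) /=.
    by under eq_bigr do rewrite -mulr_sumr b1 mulr1.
  rewrite -[LHS]hsubmxK -[RHS]hsubmxK.
  pose c (p : I * J) := a p.1 * b p.2.
  rewrite (@lsubmx_comb _ _ _ _ v w c) (@rsubmx_comb _ _ _ _ v w c) ax bx.
  congr row_mx; apply: eq_bigr => i _ /=; congr (_ *: _).
    by rewrite /c /= -mulr_sumr b1 mulr1.
  by rewrite /c /= -mulr_suml a1 mul1r.
move=> [c [c0 c1 ->]].
rewrite /prod_set /= (@lsubmx_comb _ _ _ _ v w c) (@rsubmx_comb _ _ _ _ v w c); split.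
  exists (fun i => \sum_j c (i, j)); split => //.
    by move=> i; apply: sumr_ge0.
  by rewrite pair_bigA -c1; apply: eq_bigr => -[].
exists (fun j => \sum_i c (i, j)); split => //.
  by move=> i; apply: sumr_ge0.
by rewrite exchange_big pair_bigA -c1; apply: eq_bigr => -[].
Qed.

Lemma prod_setP P Q : prod_set P Q !=set0 /\
  exists m (v : 'I_m -> 'rV[R]_(ambient P + ambient Q)), prod_set P Q = hull v.
Proof.
have [[x Px] [m [v Pv]]] := polytopeP P; have [[y Qy] [n [w Qw]]] := polytopeP Q.
split; first by exists (row_mx x y); rewrite /prod_set /= row_mxKl row_mxKr.
by rewrite Pv Qw prod_set_hull hull_ord; eexists; eexists.
Qed.

Definition polytope_prod P Q := Polytope (prod_setP P Q).

Lemma prod_set_inj m n (A A' : set 'rV[R]_m) (B B' : set 'rV[R]_n) :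
  A !=set0 -> B !=set0 -> prod_set A B `<=` prod_set A' B' ->
  A `<=` A' /\ B `<=` B'.
Proof.
move=> [x Ax] [y By] AB.
split=> z Cz.
  have /AB[] : prod_set A B (row_mx z y) by rewrite /prod_set /= row_mxKl row_mxKr.
  by rewrite row_mxKl.
have /AB[] : prod_set A B (row_mx x z) by rewrite /prod_set /= row_mxKl row_mxKr.
by rewrite row_mxKr.
Qed.

Lemma mul_hsub m n (x : 'rV[R]_(m + n)) (c : 'cV[R]_(m + n)) :
  (x *m c) 0 0 = (lsubmx x *m usubmx c) 0 0 + (rsubmx x *m dsubmx c) 0 0.
Proof.
by rewrite -{1}[x]hsubmxK -{1}[c]vsubmxK mul_row_col mxE.
Qed.

Lemma face_prod P Q F G :
  face P F -> face Q G -> face (polytope_prod P Q) (prod_set F G).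
Proof.
move=> [[x Fx] [c [b [Pc Fc]]]] [[y Gy] [c' [b' [Qc Gc]]]]; split.
  by exists (row_mx x y); rewrite /prod_set /= row_mxKl row_mxKr.
exists (col_mx c c'), (b + b').
split=> [z [Pz Qz]|]; first by rewrite mul_hsub col_mxKu col_mxKd lerD ?Pc ?Qc.
rewrite Fc Gc; apply/seteqP.
split=> z /=; rewrite mul_hsub col_mxKu col_mxKd.
  by move=> [[Pz ->] [Qz ->]].
move=> [[Pz Qz] bz]; have := Pc _ Pz; have := Qc _ Qz => le1 le2.
by do !split=> //; apply/eqP; rewrite eq_le ?le1 ?le2 /=; lra.
Qed.

Lemma face_prod_inv P Q H : face (polytope_prod P Q) H ->
  exists F G, [/\ face P F, face Q G & H = prod_set F G].
Proof.
move=> [[z Hz] [c [b [PQc Hc]]]].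
move: (Hz); rewrite Hc /= mul_hsub => -[[Pz Qz] bz].
have Pc x : carrier P x -> (x *m usubmx c) 0 0 <= (lsubmx z *m usubmx c) 0 0.
  move=> Px; have := PQc (row_mx x (rsubmx z)).
  rewrite mul_hsub !(row_mxKl, row_mxKr) -bz lerD2r; apply.
  by split; rewrite !(row_mxKl, row_mxKr).
have Qc x : carrier Q x -> (x *m dsubmx c) 0 0 <= (rsubmx z *m dsubmx c) 0 0.
  move=> Qx; have := PQc (row_mx (lsubmx z) x).
  rewrite mul_hsub !(row_mxKl, row_mxKr) -bz lerD2l; apply.
  by split; rewrite !(row_mxKl, row_mxKr).
exists [set x | carrier P x /\ (x *m usubmx c) 0 0 = (lsubmx z *m usubmx c) 0 0].
exists [set x | carrier Q x /\ (x *m dsubmx c) 0 0 = (rsubmx z *m dsubmx c) 0 0].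
split.
- by split; [exists (lsubmx z) | exists (usubmx c), ((lsubmx z *m usubmx c) 0 0)].
- by split; [exists (rsubmx z) | exists (dsubmx c), ((rsubmx z *m dsubmx c) 0 0)].
apply/seteqP; split=> x; rewrite /= mul_hsub -bz; last first.
  by move=> [[Px ->] [Qx ->]].
move=> [[Px Qx] e]; have := Pc _ Px; have := Qc _ Qx => le1 le2.
by do !split=> //; apply/eqP; rewrite eq_le ?le1 ?le2 /=; lra.
Qed.

Lemma face_of_prod P Q : order_iso
  (prod_le (@face_le R P) (@face_le R Q)) (@face_le R (polytope_prod P Q)).
Proof.
pose f (x : face_of P * face_of Q) : face_of (polytope_prod P Q) :=
  exist _ _ (face_prod (proj2_sig x.1) (proj2_sig x.2)).
have fle x y : face_le (f x) (f y) <-> prod_le (@face_le R P) (@face_le R Q) x y.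
  split=> [|[xy1 xy2] z [? ?]]; last by split; [apply: xy1|apply: xy2].
  by apply: prod_set_inj; [case: (proj2_sig x.1) | case: (proj2_sig x.2)].
have le_anti S (F G : face_of S) : face_le F G -> face_le G F -> F = G.
  by case: F G => [F ?] [G ?] FG GF; apply: eq_exist; apply/seteqP.
exists f => //; rewrite -setTT_bijective; split=> //.
  move=> x y _ _ fxy.
  have [xy1 xy2] : prod_le (@face_le R P) (@face_le R Q) x y by apply/fle; rewrite fxy.
  have [yx1 yx2] : prod_le (@face_le R P) (@face_le R Q) y x by apply/fle; rewrite fxy.
  by case: x y {fxy} xy1 xy2 yx1 yx2 => [? ?] [? ?] /= *; congr pair; apply: le_anti.
move=> [H fH] _; have [F [G [fF fG HE]]] := face_prod_inv fH.
by exists (exist _ F fF, exist _ G fG) => //; apply: eq_exist.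
Qed.

Lemma face_of_point : order_iso (fun _ _ : unit => True) (@face_le R point).
Proof.
have faceT : face point_set setT.
  split; first by exists 0.
  exists 0, 0; split=> [x _|]; first by rewrite mulmx0 mxE.
  by apply/seteqP; split=> // x _; rewrite /= mulmx0 mxE.
have eqT (F : face_of point) : F = exist _ setT faceT.
  case: F => F [[y Fy] ?]; apply: eq_exist; apply/seteqP; split=> // x _.
  by rewrite (thinmx0 x) -(thinmx0 y).
exists (fun=> exist _ setT faceT) => //.
by exists (fun=> tt) => [[]//|F]; rewrite [RHS]eqT.
Qed.

Lemma comb_equiv_prod P P' Q Q' : comb_equiv P P' -> comb_equiv Q Q' ->
  comb_equiv (polytope_prod P Q) (polytope_prod P' Q').
Proof.
move=> PP' QQ'; apply: order_iso_trans (face_of_prod P' Q').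
by apply: order_iso_trans (order_iso_prod PP' QQ'); apply/order_iso_sym/face_of_prod.
Qed.

Lemma polytope_prodA P Q S : comb_equiv
  (polytope_prod P (polytope_prod Q S)) (polytope_prod (polytope_prod P Q) S).
Proof.
apply: order_iso_trans (face_of_prod _ _).
apply: order_iso_trans (order_iso_prod (face_of_prod _ _) (order_iso_refl _)).
apply: order_iso_trans (order_iso_prodA _ _ _).
apply: order_iso_sym; apply: order_iso_trans (face_of_prod _ _).
by apply: order_iso_prod (face_of_prod _ _); exact: order_iso_refl.
Qed.

Lemma polytope_prodC P Q : comb_equiv (polytope_prod P Q) (polytope_prod Q P).
Proof.
apply: order_iso_trans (face_of_prod _ _).
by apply: order_iso_trans (order_iso_prodC _ _); apply/order_iso_sym/face_of_prod.
Qed.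

Lemma polytope_prod1 P : comb_equiv (polytope_prod point P) P.
Proof.
apply: order_iso_trans (order_iso_prod1 _).
apply: order_iso_sym; apply: order_iso_trans (face_of_prod _ _).
by apply: order_iso_prod; [exact: face_of_point|exact: order_iso_refl].
Qed.

Lemma face_self P : face P P.
Proof.
split; first by case: (polytopeP P).
exists 0, 0; split=> [x _|]; first by rewrite mulmx0 mxE.
by apply/seteqP; split=> x; [split=> //; rewrite mulmx0 mxE|case].
Qed.

Lemma polytope_prod_eq1 P Q :
  comb_equiv (polytope_prod P Q) point -> comb_equiv P point.
Proof.
move=> PQ; apply: order_iso_trans face_of_point.
have : order_iso (prod_le (@face_le R P) (@face_le R Q)) (fun _ _ : unit => True).
  apply: order_iso_trans (face_of_prod P Q) _; apply: order_iso_trans PQ _.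
  exact/order_iso_sym/face_of_point.
case=> f /bij_inj f_inj f_le.
pose G : face_of Q := exist _ _ (face_self Q).
have all_eq (F F' : face_of P) : F = F'.
  by have [//] : (F, G) = (F', G) by apply: f_inj; case: (f _); case: (f _).
pose F : face_of P := exist _ _ (face_self P).
exists (fun=> tt); first by exists (fun=> F) => [x|[]].
by move=> x y; split=> // _; rewrite (all_eq x y).
Qed.

Definition comb_equivb P Q := `[< comb_equiv P Q >].

Lemma comb_equivb_refl : reflexive comb_equivb.
Proof. by move=> P; apply/asboolP/order_iso_refl. Qed.

Lemma comb_equivb_sym : symmetric comb_equivb.
Proof. by move=> P Q; apply/asboolP/asboolP; exact: order_iso_sym. Qed.

Lemma comb_equivb_trans : transitive comb_equivb.
Proof.
by move=> Q P S /asboolP PQ /asboolP QS; apply/asboolP; exact: order_iso_trans QS.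
Qed.

Canonical comb_equiv_rel :=
  EquivRel comb_equivb comb_equivb_refl comb_equivb_sym comb_equivb_trans.

Definition comb_polytope := {eq_quot comb_equiv_rel}%qT.
HB.instance Definition _ := Choice.on comb_polytope.

Definition comb_class P : comb_polytope := \pi_comb_polytope P.

Lemma comb_classP P Q : comb_class P = comb_class Q <-> comb_equiv P Q.
Proof.
split=> [/eqmodP/asboolP//|PQ]; exact/eqmodP/asboolP.
Qed.

Lemma repr_comb_class P : comb_equiv (repr (comb_class P)) P.
Proof. by apply/comb_classP; rewrite /comb_class reprK. Qed.

Definition comb_prod (a b : comb_polytope) : comb_polytope :=
  comb_class (polytope_prod (repr a) (repr b)).

Lemma comb_prod_class P Q :
  comb_prod (comb_class P) (comb_class Q) = comb_class (polytope_prod P Q).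
Proof. by apply/comb_classP/comb_equiv_prod; exact: repr_comb_class. Qed.

Lemma comb_classW (T : comb_polytope -> Prop) :
  (forall P, T (comb_class P)) -> forall a, T a.
Proof. by move=> TP a; rewrite -[a]reprK; exact: TP. Qed.

Fact comb_prodA : associative comb_prod.
Proof.
elim/comb_classW=> P; elim/comb_classW=> Q; elim/comb_classW=> S.
by rewrite !comb_prod_class; apply/comb_classP/polytope_prodA.
Qed.

Fact comb_prodC : commutative comb_prod.
Proof.
elim/comb_classW=> P; elim/comb_classW=> Q.
by rewrite !comb_prod_class; apply/comb_classP/polytope_prodC.
Qed.

Fact comb_prod1 : left_id (comb_class point) comb_prod.
Proof.
by elim/comb_classW=> P; rewrite comb_prod_class; apply/comb_classP/polytope_prod1.
Qed.

Fact comb_prod1r : right_id (comb_class point) comb_prod.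
Proof. by move=> a; rewrite comb_prodC comb_prod1. Qed.

Fact comb_prod_eq1 a b : comb_prod a b = comb_class point ->
  a = comb_class point /\ b = comb_class point.
Proof.
have eq1 c d : comb_prod c d = comb_class point -> c = comb_class point.
  elim/comb_classW: c => P; elim/comb_classW: d => Q.
  by rewrite comb_prod_class => /comb_classP/polytope_prod_eq1/comb_classP.
by move=> ab; split; [exact: eq1 ab | apply: (@eq1 b a); rewrite comb_prodC].
Qed.

HB.instance Definition _ := Choice_isMonomialDef.Build comb_polytope
  comb_prodA comb_prod1 comb_prod1r comb_prod_eq1.
HB.instance Definition _ := MonomialDef_isConomialDef.Build comb_polytope comb_prodC.

End CombinatorialPolytopes.

(* The product of this monoid algebra extends the direct product of polytopes,
   and its unit is the class of the point. *)
Definition polytope_ring (R : realType) : comNzRingType :=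
  {malg int[comb_polytope R]}.

Definition tmonomial (l w : seq nat) : {cmonom nat} :=
  \big[mmul/1%M]_(p <- zip l w) expcmn (ucm p.1) p.2.

(* When all the parts of w are positive, distinct increasing sequences l give
   distinct monomials, so the coefficients of M_w are 0 or 1. *)
Definition Mqsym (K : comNzRingType) (w : seq nat) : tseries K :=
  TSeries (fun m => if `[< exists l : seq nat,
    [/\ size l = size w, sorted ltn l & m = tmonomial l w] >] then 1 else 0).

Section FPolynomial.
Variable R : realType.

Definition flags (P : polytope R) (a : seq nat) :
    set (seq (set 'rV[R]_(ambient P))) :=
  [set s | [/\ forall F, F \in s -> face P F, map (@affdim R _) s = a &
    sorted (fun F G => `[< F `<=` G >]) s]].

Definition flag_number (P : polytope R) (a : seq nat) : nat :=
  #|` fset_set (@flags P a)|.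

(* For a = (a_1, ..., a_k): (n - a_k, a_k - a_{k-1}, ..., a_2 - a_1). *)
Definition flag_composition (n : nat) (a : seq nat) : seq nat :=
  rev (pairmap (fun x y => y - x)%N (head 0%N a) (rcons (behead a) n)).

Definition f_polynomial (P : polytope R) : {poly tseries int} :=
  let n := affdim P in
  'X^n + \sum_(1 <= k < n.+1) \sum_(a : k.-tuple 'I_n | sorted ltn (map val a))
    let s := map val a in
    ((flag_number P s)%:R * Mqsym int (flag_composition n s)) *: 'X^(head 0%N s).

(* f_polynomial P depends only on the combinatorial class of P (the dimension
   of a face is its rank in the face poset), so the choice of representatives
   made by repr is immaterial. *)
Definition f_map : polytope_ring R -> {poly tseries int} :=
  mmap intr (fun c : comb_polytope R => f_polynomial (repr c)).

Definition f_image : set {poly tseries int} := range f_map.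

End FPolynomial.

Definition tseries_rat (f : tseries int) : tseries rat :=
  TSeries (fun m => (tcoef f m)%:~R).

(* The Q-span of A inside {poly tseries rat}. For an additive subgroup A this is
   A (x) Q: Q is flat over Z, so A (x) Q embeds into {poly tseries int} (x) Q,
   which in turn embeds into {poly tseries rat} because {poly tseries int} is
   torsion-free; the class of x (x) c is sent to c times the image of x. *)
Definition tensor_rat (A : set {poly tseries int}) : set {poly tseries rat} :=
  [set y | exists n (c : 'I_n -> rat) (x : 'I_n -> {poly tseries int}),
    (forall i, A (x i)) /\ y = \sum_i tsC (c i) *: map_poly tseries_rat (x i)].

(* {malg rat[{cmonom I}]} is the polynomial ring Q[X_i, i in I] for an arbitrary,
   possibly infinite, I. Ring morphisms between Q-algebras are Q-linear, so phi
   is an isomorphism of Q-algebras onto A. *)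
Definition free_polynomial_algebra (B : comNzRingType) (A : set B) :=
  exists (I : choiceType) (phi : {rmorphism {malg rat[{cmonom I}]} -> B}),
    injective phi /\ range phi = A.

(* Main.v *)
Require Import Defs.
From HB Require Import structures.
From mathcomp Require Import all_boot all_order all_algebra finmap lra zify.
From mathcomp Require Import boolp classical_sets functions cardinality fsbigop reals.
From mathcomp Require topology normedtype derive monalg.

(* Write f(P) as the sum over j and words w of g(j, w) alpha^j M_w, where g(j, w)
   counts the flags which start at P, descend by the codimensions w and end in
   dimension j. Euler's formula for the faces of P and of the intervals of its face
   lattice gives the linear relations of Bayer and Billera on g; conversely, by
   means of cones and prisms, every homogeneous solution over Q is a combination of
   f-polynomials. Thus A = f(P) (x) Q is the graded algebra of all solutions, and it
   inherits two properties from the relations. It is stable under taking the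
   coefficient of t_0^k and renaming the other variables, and the kernel of the
   restriction alpha = 0 on A is alpha^2 A.

   Let D be spanned by the products of elements of positive degree and by alpha^2 A.
   The free generators are alpha^2 and a homogeneous basis x of a complement of D in
   positive degrees. Applying a dual functional phi of x to the successive
   coefficients of an element of A gives a derivation delta : A -> Q[[t]] along the
   restriction alpha = 0, which kills alpha^2 A and takes each basis element of
   degree at most that of phi to a constant. If q is a polynomial in the x's whose
   value vanishes at alpha = 0, then so do the values of its partial derivatives
   with respect to the variables of largest degree, so q = 0 by induction; division
   by alpha^2 takes care of general polynomials. *)


Set Implicit Arguments.
Unset Strict Implicit.
Unset Printing Implicit Defensive.
Import Order.TTheory GRing.Theory Num.Theory.
Local Open Scope ring_scope.

(** * Flag numbers of graded posets *)

(** The generator is alpha^2 and not alpha because the relations force g(1, u) to be half of g(0,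
    u1): an element with no term in alpha^0 has none in alpha^1 either, and a shift by two keeps the
    signs of the relations. Multiplication by alpha^2 is realized by polytopes as 4 (P x triangle) -
    3 (P x square). The two descriptions of A complement each other. Stability under products is
    clear for f-polynomials but not for the relations; divisibility by alpha^2 is clear for the
    relations but not for f-polynomials. Their equality gives both. Rational coefficients enter
    twice: in the combination cone - prism/2, and in the final argument, where a partial derivative
    multiplies a coefficient by a positive exponent, which must not become zero. No count of the
    generators is made: a complement of D in each degree is chosen by linear algebra. Euler's
    formula is reduced to the fact that the relative interiors of the faces partition a polytope, so
    that it becomes a relation between indicator functions. *)

Record rposet := RPoset {
  rcar :> finType;
  rle : rel rcar;
  rrk : rcar -> nat;
  rtop : rcar;
  rle_refl : reflexive rle;
  rle_trans : transitive rle;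
  rle_top : forall x, rle x rtop;
  rrk_lt : forall x y, rle x y -> x != y -> (rrk x < rrk y)%N;
  rrk_pred : forall x, (0 < rrk x)%N -> exists y, rle y x && ((rrk y).+1 == rrk x) }.

Section Codim.
Variable X : rposet.
Implicit Types (x y z : X) (F : X -> rat) (k : nat).

Lemma rrk_le x y : rle x y -> (rrk x <= rrk y)%N.
Proof. by move=> xy; have [->//|/(rrk_lt xy)/ltnW] := eqVneq x y. Qed.

Definition csum k x F := \sum_(y | rle y x && (rrk y + k == rrk x)%N) F y.

Lemma csum0 x F : csum 0 x F = F x.
Proof.
rewrite /csum (big_pred1 x) // => y /=; rewrite addn0.
apply/andP/eqP => [[yx /eqP e]|->]; last by rewrite rle_refl.
by apply/eqP/negPn/negP => /(rrk_lt yx); rewrite e ltnn.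
Qed.

Lemma eq_csum k x F G : (forall y, rle y x -> F y = G y) -> csum k x F = csum k x G.
Proof. by move=> FG; apply: eq_bigr => y /andP[/FG]. Qed.

Lemma csumZ k x c F : csum k x (fun y => c * F y) = c * csum k x F.
Proof. by rewrite /csum mulr_sumr. Qed.

Lemma csum_sum k x (I : finType) (P : pred I) (F : I -> X -> rat) :
  csum k x (fun y => \sum_(i | P i) F i y) = \sum_(i | P i) csum k x (F i).
Proof. exact: exchange_big. Qed.

(* [fl w j x] counts the chains of faces below [x], starting at [x], whose
   successive codimensions are the letters of [w] and whose last face has
   dimension [j]; a letter [0] repeats a face. *)
Fixpoint fl (w : seq nat) (j : nat) x : rat :=
  if w is k :: w' then csum k x (fl w' j) else (rrk x == j)%:R.

Lemma fl_cat0 u v j x : fl (u ++ 0%N :: v) j x = fl (u ++ v) j x.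
Proof.
elim: u x => [|k u IH] x /=; first exact: csum0.
by apply: eq_csum => y _.
Qed.

Lemma fl_deg w j x : (j + sumn w != rrk x)%N -> fl w j x = 0.
Proof.
elim: w x => [|k w IH] x /=; first by rewrite addn0 eq_sym => /negPf->.
move=> ne; apply: big1 => y /andP[_ /eqP e]; apply: IH.
by apply: contraNneq ne; lia.
Qed.

(** The first clause concerns the intervals that start at the empty face. That face is absent from
    the poset; moved to the other side, its sign gives the 1. *)
Definition eulerian :=
  (forall x, \sum_(y | rle y x) (-1) ^+ rrk y = 1 :> rat) /\
  (forall y x, rle y x -> y != x ->
     \sum_(z | rle y z && rle z x) (-1) ^+ rrk z = 0 :> rat).

Hypothesis EX : eulerian.

(** Below the last face of each flag, of dimension [j], one more face of dimension [i] is inserted.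
    By Euler's formula for the last face these refinements, counted with sign, sum to 1. *)
Lemma fl_euler u j x :
  fl u j x = \sum_(i < j.+1) (-1) ^+ i * fl (rcons u (j - i)%N) i x.
Proof.
elim: u x => [|k u IH] x /=.
  under eq_bigr do rewrite /csum mulr_sumr.
  rewrite (exchange_big_dep (fun y => rle y x)) /=; last by move=> ? ? _ /andP[].
  transitivity (\sum_(y | rle y x) (rrk x == j)%:R * (-1) ^+ rrk y : rat).
    by rewrite -mulr_sumr EX.1 mulr1.
  apply: eq_bigr => y yx; have le_yx := rrk_le yx.
  have [xj|xj] := eqVneq (rrk x) j; last first.
    rewrite mul0r big1 // => i /andP[_ /eqP e]; case: eqP => [yi|_]; last exact: mulr0.
    by case/negP: xj; apply/eqP; have := ltn_ord i; lia.
  have yj : (rrk y < j.+1)%N by lia.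
  rewrite (bigD1 (Ordinal yj)) /=; last by apply/andP; split=> //; lia.
  rewrite eqxx mulr1 mul1r big1 ?addr0 // => i /andP[_ /eqP ne].
  case: eqP => [e|]; last by rewrite mulr0.
  by case: ne; apply: val_inj.
transitivity (csum k x (fun y => \sum_(i < j.+1) (-1) ^+ i * fl (rcons u (j - i)%N) i y)).
  by apply: eq_csum => y _.
by rewrite csum_sum; apply: eq_bigr => i _; rewrite csumZ.
Qed.

(** A face [y] is inserted between two consecutive faces of codimension [n]. The extreme values of
    [i] let [y] be one of these two faces, so [y] runs over the whole closed interval and the signed
    sum vanishes. *)
Lemma fl_interval u v j n x : (0 < n)%N ->
  \sum_(i < n.+1) (-1) ^+ i * fl (u ++ [:: (i : nat), (n - i)%N & v]) j x = 0.
Proof.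
move=> n0; elim: u x => [|k u IH] x /=; last first.
  transitivity (csum k x (fun y => \sum_(i < n.+1)
    (-1) ^+ i * fl (u ++ [:: (i : nat), (n - i)%N & v]) j y)).
    by rewrite csum_sum; apply: eq_bigr => i _; rewrite csumZ.
  by rewrite /csum big1.
pose P z := rle z x && (rrk z + n == rrk x)%N.
(* The factor with [rrk x] turns the sign of the codimension of [y] into the sign of its rank. *)
transitivity (\sum_(z | P z) \sum_(y | rle z y && rle y x)
    (-1) ^+ rrk x * (-1) ^+ rrk y * fl v j z); last first.
  apply: big1 => z /andP[zx /eqP e].
  rewrite -mulr_suml -mulr_sumr EX.2 ?mulr0 ?mul0r //.
  by apply/eqP => zx'; move: e; rewrite zx'; lia.
rewrite (exchange_big_dep (fun y => rle y x)) /=; last by move=> ? ? _ /andP[].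
under eq_bigr do rewrite /csum mulr_sumr.
rewrite (exchange_big_dep (fun y => rle y x)) /=; last by move=> ? ? _ /andP[].
apply: eq_bigr => y yx; have le_yx := rrk_le yx.
under eq_bigr do rewrite mulr_sumr.
rewrite (exchange_big_dep (fun z => P z && rle z y)) /=; last first.
  move=> i z /andP[_ /eqP e] /andP[zy /eqP e']; rewrite /P zy (rle_trans zy yx) /=.
  by rewrite andbT; apply/eqP; have := ltn_ord i; lia.
apply: eq_big => [z|z /andP[/andP[zx /eqP e] zy]].
  by rewrite yx andbT.
have le_zy := rrk_le zy.
have yn : (rrk x - rrk y < n.+1)%N by lia.
rewrite (big_pred1 (Ordinal yn)) /= => [|i].
  congr (_ * _).
  have -> : (-1) ^+ rrk x = (-1) ^+ (rrk x - rrk y) * (-1) ^+ rrk y :> rat.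
    by rewrite -exprD subnK.
  by rewrite -mulrA -exprMn mulrNN mulr1 expr1n mulr1.
have := ltn_ord i => lti.
rewrite zy yx /=; apply/andP/eqP => [[/eqP e1 /eqP e2]|->].
  by apply/val_inj => /=; lia.
by rewrite /=; split; apply/eqP; lia.
Qed.

End Codim.

Arguments fl : clear implicits.
Arguments fl {X} w j x.

Section Embedding.
Variables (X Y : rposet) (f : X -> Y) (g : Y -> option X).
Hypothesis fK : pcancel f g.
Hypothesis fle : forall x x', rle (f x) (f x') = rle x x'.
Hypothesis frk : forall x, rrk (f x) = rrk x.
Hypothesis fdown : forall x y, rle y (f x) -> omap f (g y) = Some y.

Lemma csum_emb k x F : csum k (f x) F = csum k x (F \o f).
Proof.
rewrite /csum (reindex_omap f g) => [|y /andP[/fdown]//].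
by apply: eq_bigl => x'; rewrite fK eqxx andbT fle !frk.
Qed.

(** Flags only descend, so an embedding onto a down-set preserves their numbers. This identifies
    faces of cones and products with smaller posets. *)
Lemma fl_emb w j x : fl w j (f x) = fl w j x.
Proof.
elim: w x => [|k w IH] x /=; first by rewrite frk.
by rewrite csum_emb; apply: eq_csum => y _ /=.
Qed.
End Embedding.

Lemma rrk_le_top (X : rposet) (x : X) : (rrk x <= rrk (rtop X))%N.
Proof. exact/rrk_le/rle_top. Qed.

(** An order embedding cannot lower ranks: descend one rank at a time by [rrk_pred] and apply
    [rrk_lt] in the target. The argument is used for [f] and for its inverse. *)
Lemma rrk_unique (X Y : rposet) (f : X -> Y) : bijective f ->
  (forall x x', rle (f x) (f x') = rle x x') -> forall x, rrk (f x) = rrk x.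
Proof.
move=> [g fK gK] fle.
have gle y y' : rle (g y) (g y') = rle y y' by rewrite -fle !gK.
have le1 (A B : rposet) (h : A -> B) : injective h ->
    (forall x x', rle (h x) (h x') = rle x x') -> forall n x, rrk x = n -> (n <= rrk (h x))%N.
  move=> h_inj hle; elim=> [//|n IH] x xn.
  have [|y /andP[yx /eqP yn]] := @rrk_pred A x; first by rewrite xn.
  have /(@rrk_lt B) : rle (h y) (h x) by rewrite hle.
  move=> /(_ _); have hn : h y != h x.
    by apply/eqP => /h_inj e; move: yn; rewrite e; lia.
  by move=> /(_ hn); apply: leq_ltn_trans; apply: IH; lia.
move=> x; apply/eqP; rewrite eqn_leq; apply/andP; split.
  rewrite -{2}(fK x); exact: (le1 _ _ _ (can_inj gK) gle _ _ erefl).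
exact: (le1 _ _ _ (can_inj fK) fle _ _ erefl).
Qed.

(** * Products, cones and prisms of posets *)

Section Product.
Variables X Y : rposet.

Definition rprod_le (p q : X * Y) := rle p.1 q.1 && rle p.2 q.2.
Definition rprod_rk (p : X * Y) := (rrk p.1 + rrk p.2)%N.

Fact rprod_le_refl : reflexive rprod_le.
Proof. by move=> p; rewrite /rprod_le !rle_refl. Qed.
Fact rprod_le_trans : transitive rprod_le.
Proof.
move=> q p r /andP[pq1 pq2] /andP[qr1 qr2]; apply/andP; split.
  exact: rle_trans qr1.
exact: rle_trans qr2.
Qed.
Fact rprod_le_top p : rprod_le p (rtop X, rtop Y).
Proof. by rewrite /rprod_le !rle_top. Qed.
Fact rprod_rk_lt p q : rprod_le p q -> p != q -> (rprod_rk p < rprod_rk q)%N.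
Proof.
case: p q => [x y] [x' y'] /andP[/= xx' yy'] ne; rewrite /rprod_rk /=.
have := rrk_le xx'; have := rrk_le yy'.
have [ex|nx] := eqVneq x x'; last by have := rrk_lt xx' nx; lia.
have [ey|ny] := eqVneq y y'; last by have := rrk_lt yy' ny; lia.
by rewrite ex ey eqxx in ne.
Qed.
Fact rprod_rk_pred p : (0 < rprod_rk p)%N ->
  exists q, rprod_le q p && ((rprod_rk q).+1 == rprod_rk p).
Proof.
case: p => x y; rewrite /rprod_rk /= => n0.
have [x0|x0] := posnP (rrk x).
  have [|z /andP[zy /eqP e]] := @rrk_pred Y y; first by lia.
  by exists (x, z); rewrite /rprod_le /= rle_refl zy /=; lia.
have [z /andP[zx /eqP e]] := rrk_pred x0.
by exists (z, y); rewrite /rprod_le /= rle_refl zx /=; lia.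
Qed.

Definition rprod := RPoset rprod_le_refl rprod_le_trans rprod_le_top
  rprod_rk_lt rprod_rk_pred.

(** Faces of a product are products of faces, so the codimension is distributed over the factors in
    all ways, as in a Cauchy product. *)
Lemma csum_prod k (x : X) (y : Y) F :
  @csum rprod k (x, y) F =
  \sum_(i < k.+1) csum i x (fun x' => csum (k - i) y (fun y' => F (x', y'))).
Proof.
transitivity (\sum_(x' | rle x' x) \sum_(y' | rle y' y &&
    (rrk x' + rrk y' + k == rrk x + rrk y)%N) F (x', y')).
  rewrite pair_big_dep /=; apply: eq_big => [[a b]|[a b] _] //=.
  by rewrite /rprod_le /rprod_rk /= andbA.
rewrite /csum (exchange_big_dep (fun x' => rle x' x)) /=; last by move=> ? ? _ /andP[].
apply: eq_bigr => x' xx; have le_x := rrk_le xx; rewrite xx /=.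
rewrite (exchange_big_dep (fun y' => rle y' y)) /=; last by move=> ? ? _ /andP[].
rewrite big_mkcondr /=.
apply: eq_bigr => y' yy; have le_y := rrk_le yy.
case: ifP => [/eqP e|/eqP ne].
  have lti : (rrk x - rrk x' < k.+1)%N by lia.
  rewrite (big_pred1 (Ordinal lti)) // => i.
  rewrite yy /=; apply/andP/eqP => [[/eqP e1 /eqP e2]|->].
    by apply/val_inj => /=; lia.
  by rewrite /=; split; apply/eqP; lia.
rewrite big_pred0 // => i; rewrite yy /=; apply/negP => /andP[/eqP e1 /eqP e2].
by apply: ne; have := ltn_ord i; lia.
Qed.

End Product.

Section ProductSlice.
Variables X Y : rposet.

(** For the segment and the triangle the sum over [y] becomes an explicit sum over their few
    faces. *)
Lemma csum_prod_slice k (x : X) (F : rprod X Y -> rat) :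
  @csum (rprod X Y) k (x, rtop Y) F = \sum_(y : Y | (rrk (rtop Y) <= rrk y + k)%N)
    csum (k - (rrk (rtop Y) - rrk y)) x (fun x' => F (x', y)).
Proof.
rewrite csum_prod.
transitivity (\sum_(i < k.+1) \sum_(y : Y | (rrk y + (k - i) == rrk (rtop Y))%N)
   csum i x (fun x' => F (x', y))).
  apply: eq_bigr => i _.
  rewrite -[RHS]csum_sum; apply: eq_csum => x' _.
  by apply: eq_bigl => y; rewrite rle_top.
rewrite (exchange_big_dep (fun y : Y => rrk (rtop Y) <= rrk y + k)%N) /=; last first.
  by move=> i y _ /eqP <-; lia.
apply: eq_bigr => y le_y; have le_top := rrk_le_top y.
have lti : (k - (rrk (rtop Y) - rrk y) < k.+1)%N by lia.
rewrite (big_pred1 (Ordinal lti)) // => i /=; have lt_i := ltn_ord i.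
by apply/eqP/eqP => [e|->]; [apply/val_inj => /=; lia|rewrite /=; lia].
Qed.

End ProductSlice.

Section Point.
Let le (_ _ : unit) := true.
Let rk (_ : unit) := 0%N.
Fact rpt_refl : reflexive le. Proof. by []. Qed.
Fact rpt_trans : transitive le. Proof. by []. Qed.
Fact rpt_top x : le x tt. Proof. by []. Qed.
Fact rpt_lt x y : le x y -> x != y -> (rk x < rk y)%N. Proof. by case: x y => [] []. Qed.
Fact rpt_pred x : (0 < rk x)%N -> exists y, le y x && ((rk y).+1 == rk x).
Proof. by []. Qed.
Definition rpt := RPoset rpt_refl rpt_trans rpt_top rpt_lt rpt_pred.
End Point.

(* [None] is the apex, [Some (x, false)] a face of the base and [Some (x, true)]
   the cone over the face [x]. *)
Section Cone.
Variable X : rposet.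

Definition cone_le (p q : option (X * bool)) :=
  match p, q with
  | None, None => true
  | None, Some (_, b) => b
  | Some _, None => false
  | Some (x, b), Some (y, c) => rle x y && (b ==> c)
  end.
Definition cone_rk (p : option (X * bool)) := if p is Some (x, b) then (rrk x + b)%N else 0%N.

Fact cone_le_refl : reflexive cone_le.
Proof. by case=> [[x []]|] //=; rewrite rle_refl. Qed.
Fact cone_le_trans : transitive cone_le.
Proof.
case=> [[y c]|] [[x b]|] [[z d]|] //=.
- by case/andP=> xy bc /andP[yz cd]; rewrite (rle_trans xy yz) /=; case: b c bc cd => [] [].
- by move=> -> /andP[].
Qed.
Fact cone_le_top p : cone_le p (Some (rtop X, true)).
Proof. by case: p => [[x []]|] //=; rewrite rle_top. Qed.
Fact cone_rk_lt p q : cone_le p q -> p != q -> (cone_rk p < cone_rk q)%N.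
Proof.
case: p q => [[x b]|] [[y []]|] //=; try lia.
- move=> /andP[xy _] ne; have := rrk_le xy.
  have [exy|nxy] := eqVneq x y; last by have := rrk_lt xy nxy; case: (b); lia.
  by case: b ne => [|_]; [rewrite exy eqxx | lia].
- case: b => //=; rewrite ?andbF // andbT => xy ne.
  rewrite !addn0; apply: rrk_lt => //.
  by apply: contraNneq ne => ->.
Qed.
Fact cone_rk_pred p : (0 < cone_rk p)%N ->
  exists q, cone_le q p && ((cone_rk q).+1 == cone_rk p).
Proof.
case: p => [[x []]|] //= x0.
  by exists (Some (x, false)); rewrite /= rle_refl /=; lia.
have [|y /andP[yx /eqP e]] := @rrk_pred X x; first by lia.
by exists (Some (y, false)); rewrite /= yx /=; lia.
Qed.

Definition rcone := RPoset cone_le_refl cone_le_trans cone_le_top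
  cone_rk_lt cone_rk_pred.

Lemma big_cone (P : pred rcone) (F : rcone -> rat) : \sum_(p | P p) F p =
  \sum_(x : X | P (Some (x, true))) F (Some (x, true)) +
  \sum_(x : X | P (Some (x, false))) F (Some (x, false)) +
  (if P None then F None else 0).
Proof.
rewrite big_mkcond /= (bigD1 None) //= addrC; congr (_ + _).
rewrite (reindex_omap Some id) /=; last by case.
rewrite (eq_bigl xpredT) => [|p]; last by rewrite eqxx.
transitivity (\sum_(x : X) \sum_(b : bool)
    if P (Some (x, b)) then F (Some (x, b)) else 0).
  by rewrite pair_bigA /=; apply: eq_bigr => -[].
rewrite exchange_big big_bool /=; congr (_ + _); exact: esym (big_mkcond _ _).
Qed.

Lemma fl_base w j (x : X) : fl w j (Some (x, false) : rcone) = fl w j x.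
Proof.
apply: (@fl_emb X rcone (fun x => Some (x, false))
  (fun p => if p is Some (y, false) then Some y else None)) => //=.
- by move=> a b; rewrite andbT.
- by move=> a; rewrite addn0.
- by move=> a [[b []]|] //=; rewrite andbF.
Qed.

(** The base [x] is a facet of the cone over it, hence the index [k] in the second term; the apex
    has dimension 0 and thus codimension [rrk x + 1]. *)
Lemma csum_cone k (x : X) F : csum k.+1 (Some (x, true) : rcone) F =
  csum k.+1 x (fun y => F (Some (y, true))) + csum k x (fun y => F (Some (y, false)))
  + (if rrk x == k then F None else 0).
Proof.
rewrite /csum big_cone /=; congr (_ + _ + _).
- by apply: eq_bigl => y; rewrite andbT; congr (_ && _); lia.
- by apply: eq_bigl => y; rewrite andbT; congr (_ && _); lia.
- by congr (if _ then _ else _); lia.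
Qed.

End Cone.

Lemma fl_rpt w j : fl w j (rtop rpt) = ((sumn w == 0) && (j == 0))%N%:R.
Proof.
elim: w => [|k w IH] /=; first by rewrite eq_sym.
rewrite /csum; have [->|k0] := posnP k; last first.
  rewrite big_pred0 => [|[] /=]; last by lia.
  by rewrite addn_eq0 eqn0Ngt k0.
by rewrite (big_pred1 tt) => [|[]//]; rewrite IH.
Qed.

Section PrismTriangle.
Variable X : rposet.
Let seg := rcone rpt.
Let tri := rcone seg.
Implicit Type x : X.

Definition vtx : seg := None.
Definition ivtx : seg := Some (tt, false).

Lemma big_rpt (P : pred rpt) (F : rpt -> rat) :
  \sum_(p | P p) F p = if P tt then F tt else 0.
Proof. by rewrite big_mkcond (big_pred1 tt) // => -[]. Qed.

Lemma csum_seg k x F : @csum (rprod X seg) k (x, rtop seg) F =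
  csum k x (fun x' => F (x', rtop seg)) +
  (if (0 < k)%N then csum k.-1 x (fun x' => F (x', vtx)) +
                     csum k.-1 x (fun x' => F (x', ivtx)) else 0).
Proof.
rewrite csum_prod_slice big_cone !big_rpt /=.
case: k => [|k] /=; first by rewrite !addr0.
by rewrite !subSS !subn0 -addrA; congr (_ + _); rewrite addrC.
Qed.

Lemma fl_slice (Y : rposet) (y : Y) (w : seq nat) j x :
  (forall z, rle z y -> z = y) -> fl w j ((x, y) : rprod X Y) = fl w j x.
Proof.
move=> ymin.
have y0 : rrk y = 0%N.
  have [//|/rrk_pred[z /andP[/ymin -> ]]] := posnP (rrk y); lia.
apply: (@fl_emb X (rprod X Y) (fun x => (x, y))
  (fun p => if p.2 == y then Some p.1 else None)) => /=.
- by move=> a; rewrite eqxx.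
- by move=> a b; rewrite /rprod_le /= rle_refl andbT.
- by move=> a; rewrite /rprod_rk /= y0 addn0.
- by move=> a [b z] /andP[/= _ /ymin ->]; rewrite eqxx.
Qed.

(** A face of a prism is a prism over a face, or lies in one of the two ends, which themselves have
    codimension 1. *)
Lemma fl_prism_cons k w j x : fl (k :: w) j ((x, rtop seg) : rprod X seg) =
  csum k x (fun x' => fl w j ((x', rtop seg) : rprod X seg)) +
  2 * (if (0 < k)%N then fl (k.-1 :: w) j x else 0).
Proof.
rewrite [LHS]/= csum_seg; congr (_ + _); case: k => [|k] /=; first by rewrite mulr0.
rewrite mulr_natl mulr2n; congr (_ + _); apply: eq_csum => y _; apply: fl_slice.
  by case=> [[[] []]|].
by case=> [[[] []]|].
Qed.

Lemma csum_tri k x F : @csum (rprod X tri) k (x, rtop tri) F =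
  csum k x (fun x' => F (x', rtop tri)) +
  (if (0 < k)%N then
     csum k.-1 x (fun x' => F (x', Some (ivtx, true))) +
     csum k.-1 x (fun x' => F (x', Some (vtx, true))) +
     csum k.-1 x (fun x' => F (x', Some (rtop seg, false))) else 0) +
  (if (1 < k)%N then
     csum k.-2 x (fun x' => F (x', Some (ivtx, false))) +
     csum k.-2 x (fun x' => F (x', Some (vtx, false))) +
     csum k.-2 x (fun x' => F (x', None)) else 0).
Proof.
rewrite csum_prod_slice !big_cone !big_rpt /=.
case: k => [|[|k]] /=; rewrite ?subnn ?subn0 ?subSS ?subn0 /=.
- by rewrite !addr0.
- by rewrite !addr0 !addrA.
by rewrite !addrA; do ?[congr (_ + _)]; lra.
Qed.

End PrismTriangle.

Section ConeAndTriangle.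
Variable X : rposet.
Implicit Type x : X.
Notation seg := (rcone rpt).
Notation tri := (rcone seg).

Lemma fl_apex w j : fl w j (None : rcone X) = ((sumn w == 0) && (j == 0))%N%:R.
Proof.
elim: w => [|k w IH] /=; first by rewrite eq_sym.
rewrite /csum big_cone /= !big_pred0 // !add0r IH add0n addn_eq0.
by case: eqP.
Qed.

(** A prism has two copies of the base where a cone has one. The factor 1/2 cancels all faces of the
    base and leaves only the apex as an extra term in [flK_cons]. *)
Definition flK w j x : rat := fl w j (Some (x, true) : rcone X)
  - 1 / 2 * fl w j ((x, rtop seg) : rprod X seg).

Lemma flK_cons k w j x : flK (k.+1 :: w) j x =
  csum k.+1 x (flK w j) + (if rrk x == k then fl w j (None : rcone X) else 0).
Proof.
rewrite /flK fl_prism_cons [X in X - _]/= csum_cone /=.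
have -> : csum k x (fun y => fl w j (Some (y, false) : rcone X)) = csum k x (fl w j).
  by apply: eq_csum => y _; rewrite fl_base.
have -> : csum k.+1 x (flK w j) =
    csum k.+1 x (fun y => fl w j (Some (y, true) : rcone X)) -
    1 / 2 * csum k.+1 x (fun y => fl w j ((y, rtop seg) : rprod X seg)).
  by rewrite /csum mulr_sumr -sumrB.
by set d := (if _ then _ else _); lra.
Qed.

Lemma flK_succ w j x : all (ltn 0) w -> flK w j.+1 x = 1 / 2 * fl w j x.
Proof.
elim: w x => [|[//|k] w IH] x /= => [_|w0].
  rewrite /flK /= /rprod_rk /= add0n !addn1 eqSS; case: eqP => _ /=; lra.
rewrite flK_cons fl_apex andbF if_same addr0 -csumZ.
by apply: eq_csum => y _; apply: IH.
Qed.

Lemma flK0 x : flK [::] 0 x = 0.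
Proof. by rewrite /flK /= /rprod_rk /= add0n !addn1 mulr0 subr0. Qed.

(** Only flags that end in the apex survive, and the last step drops from the cone over a face of
    dimension [k]. Thus [flK] undoes the removal of the last letter at alpha = 0. *)
Lemma flK_rcons w k x : all (ltn 0) w -> flK (rcons w k.+1) 0 x = fl w k x.
Proof.
elim: w x => [|[//|l] w IH] x /= => [_|w0].
  rewrite flK_cons fl_apex /= /csum big1 ?add0r => [|y _]; last exact: flK0.
  by case: eqP.
rewrite flK_cons fl_apex sumn_rcons addnS /= if_same addr0.
by apply: eq_csum => y _; apply: IH.
Qed.

Lemma fl_prodr (Y Z : rposet) (f : Y -> Z) (g : Z -> option Y) : pcancel f g ->
  (forall y y', rle (f y) (f y') = rle y y') -> (forall y, rrk (f y) = rrk y) ->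
  (forall y z, rle z (f y) -> omap f (g z) = Some z) ->
  forall w j x y, fl w j ((x, f y) : rprod X Z) = fl w j ((x, y) : rprod X Y).
Proof.
move=> fK fle frk fdown w j x y.
apply: (@fl_emb (rprod X Y) (rprod X Z) (fun p => (p.1, f p.2))
  (fun p => omap (pair p.1) (g p.2)) _ _ _ _ w j (x, y)).
- by move=> [a b] /=; rewrite fK.
- by move=> [a b] [c d]; rewrite /= /rprod_le /= fle.
- by move=> [a b]; rewrite /= /rprod_rk /= frk.
- by move=> [a b] [c d] /andP[_ /fdown] /=; case: (g d) => [e|] //= -[->].
Qed.

(** The triangle has 3 edges and 3 vertices, the square 4 and 4. The weights 4 and -3 cancel the
    edges and the vertices and sum to 1, so that the result represents multiplication by alpha^2. *)
Definition flQ w j x : rat := 4 * fl w j ((x, rtop tri) : rprod X tri)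
  - 3 * fl w j ((x, rtop seg, rtop seg) : rprod (rprod X seg) seg).

Lemma fl_edge w j x (v : seg) : rrk v = 0%N -> (forall z, rle z v -> z = v) ->
  fl w j ((x, Some (v, true)) : rprod X tri) = fl w j ((x, rtop seg) : rprod X seg).
Proof.
move=> v0 vmin.
pose f (y : seg) : tri := if y is Some (_, b) then Some (v, b) else None.
pose g (z : tri) : option seg := if z is Some (u, b) then
  (if u == v then Some (Some (tt, b)) else None) else Some None.
rewrite -[LHS]/(fl w j ((x, f (rtop seg)) : rprod X tri)); apply: (@fl_prodr _ _ f g).
- by move=> [[[] b]|] //=; rewrite eqxx.
- by move=> [[[] b]|] [[[] c]|] //=; rewrite cone_le_refl.
- by move=> [[[] b]|] //=; exact: (congr1 (fun n => n + b)%N v0).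
- move=> [[[] b]|] [[u c]|] //=.
  by case/andP=> /vmin -> _; rewrite eqxx.
Qed.

Lemma fl_base_edge w j x : fl w j ((x, Some (rtop seg, false)) : rprod X tri) =
  fl w j ((x, rtop seg) : rprod X seg).
Proof.
apply: (@fl_prodr seg tri (fun y => Some (y, false))
  (fun p => if p is Some (y, false) then Some y else None)) => //=.
- by move=> a b; rewrite andbT.
- by move=> a; rewrite addn0.
- by move=> a [[b []]|] //=; rewrite andbF.
Qed.

Lemma vtx_min (z : seg) : rle z vtx -> z = vtx.
Proof. by case: z => [[[] []]|]. Qed.

Lemma ivtx_min (z : seg) : rle z ivtx -> z = ivtx.
Proof. by case: z => [[[] []]|]. Qed.

Lemma flQ_cons k w j x : flQ (k :: w) j x = csum k x (flQ w j).
Proof.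
pose E (y : X) := fl w j ((y, rtop seg) : rprod X seg).
have tri_vtx (z : seg) : (forall u, rle u z -> u = z) ->
    forall y : X, fl w j ((y, Some (z, false)) : rprod X tri) = fl w j y.
  by move=> zmin y; apply: fl_slice => -[[u []]|] //= /andP[/zmin ->].
have tri_apex (y : X) : fl w j ((y, None) : rprod X tri) = fl w j y.
  by apply: fl_slice => -[[u []]|].
have three : 3 = 1 + 1 + 1 :> rat by [].
have T : fl (k :: w) j ((x, rtop tri) : rprod X tri) =
    csum k x (fun y => fl w j ((y, rtop tri) : rprod X tri)) +
    3 * (if (0 < k)%N then csum k.-1 x E else 0) +
    3 * (if (1 < k)%N then csum k.-2 x (fl w j) else 0).
  rewrite [LHS]/= csum_tri.
  case: k => [|[|k]] /=; rewrite ?mulr0 ?addr0 //.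
    congr (_ + _); rewrite three !mulrDl !mul1r.
    by congr (_ + _ + _); apply: eq_csum => y _;
      rewrite ?fl_edge ?fl_base_edge //; [exact: ivtx_min|exact: vtx_min].
  rewrite three !mulrDl !mul1r; congr (_ + (_ + _ + _) + (_ + _ + _));
    apply: eq_csum => y _; rewrite ?fl_edge ?fl_base_edge ?tri_apex ?tri_vtx //.
  - exact: ivtx_min.
  - exact: vtx_min.
  - exact: ivtx_min.
  - exact: vtx_min.
(* The square is a prism over a prism: each direction gives two edges, and the two ends of the two
   ends are the four vertices. *)
have S : fl (k :: w) j ((x, rtop seg, rtop seg) : rprod (rprod X seg) seg) =
    csum k x (fun y => fl w j ((y, rtop seg, rtop seg) : rprod (rprod X seg) seg)) +
    4 * (if (0 < k)%N then csum k.-1 x E else 0) +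
    4 * (if (1 < k)%N then csum k.-2 x (fl w j) else 0).
  rewrite fl_prism_cons csum_seg.
  case: k {T} => [|k] /=; first by rewrite !mulr0.
  rewrite -/(csum k _ _) (csum_seg k x (fl w j)).
  have e1 : csum k x (fun y => fl w j ((y, vtx, rtop seg) : rprod (rprod X seg) seg)) = csum k x E.
    apply: eq_csum => y _.
    apply: (@fl_emb (rprod X seg) (rprod (rprod X seg) seg) (fun p => (p.1, vtx, p.2))
      (fun p => if p.1.2 == vtx then Some (p.1.1, p.2) else None) _ _ _ _ w j (y, rtop seg)).
    - by move=> [a b] /=.
    - by move=> [a b] [c d]; rewrite /= /rprod_le /= /rprod_le /= andbT.
    - by move=> [a b]; rewrite /= /rprod_rk /= /rprod_rk /= !addn0.
    - by move=> [a b] [[c d] e] /andP[/= /andP[/= _ /vtx_min ->] _]; rewrite eqxx.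
  have e2 : csum k x (fun y => fl w j ((y, ivtx, rtop seg) : rprod (rprod X seg) seg)) = csum k x E.
    apply: eq_csum => y _.
    apply: (@fl_emb (rprod X seg) (rprod (rprod X seg) seg) (fun p => (p.1, ivtx, p.2))
      (fun p => if p.1.2 == ivtx then Some (p.1.1, p.2) else None) _ _ _ _ w j (y, rtop seg)).
    - by move=> [a b] /=.
    - by move=> [a b] [c d]; rewrite /= /rprod_le /= /rprod_le /= andbT.
    - by move=> [a b]; rewrite /= /rprod_rk /= /rprod_rk /= !addn0.
    - by move=> [a b] [[c d] e] /andP[/= /andP[/= _ /ivtx_min ->] _]; rewrite eqxx.
  rewrite e1 e2 -/E; case: k {e1 e2} => [|k] /=; first by lra.
  have -> : csum k x (fun y => fl w j ((y, vtx) : rprod X seg)) = csum k x (fl w j).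
    by apply: eq_csum => y _; apply: fl_slice; exact: vtx_min.
  have -> : csum k x (fun y => fl w j ((y, ivtx) : rprod X seg)) = csum k x (fl w j).
    by apply: eq_csum => y _; apply: fl_slice; exact: ivtx_min.
  by rewrite -/E; lra.
have -> : csum k x (flQ w j) =
    4 * csum k x (fun y => fl w j ((y, rtop tri) : rprod X tri)) -
    3 * csum k x (fun y => fl w j ((y, rtop seg, rtop seg) : rprod (rprod X seg) seg)).
  by rewrite /csum !mulr_sumr -sumrB.
by rewrite /flQ T S; lra.
Qed.

Lemma flQ_succ2 w j x : flQ w j.+2 x = fl w j x.
Proof.
elim: w x => [|k w IH] x; last by rewrite flQ_cons; apply: eq_csum.
rewrite /flQ /= /rprod_rk /= /rprod_rk /=.
have [-> ->] : (rrk x + (0 + 1 + 1) == j.+2)%N = (rrk x == j) /\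
    (rrk x + (0 + 1) + (0 + 1) == j.+2)%N = (rrk x == j) by lia.
by lra.
Qed.

Lemma flQ_lt2 w j x : (j < 2)%N -> flQ w j x = 0.
Proof.
move=> j2; elim: w x => [|k w IH] x; last by rewrite flQ_cons /csum big1.
rewrite /flQ /= /rprod_rk /= /rprod_rk /=.
have [-> ->] : (rrk x + (0 + 1 + 1) == j)%N = false /\ (rrk x + (0 + 1) + (0 + 1) == j)%N = false.
  by lia.
by rewrite !mulr0 subr0.
Qed.

End ConeAndTriangle.

(** * The Dehn-Sommerville relations *)

(* The generalized Dehn-Sommerville relations of Bayer and Billera for a function
   [g] of degree [n], where [g j w] is the coefficient of [alpha ^ j * M_w]. *)
Record dehn_sommerville (n : nat) (g : nat -> seq nat -> rat) : Prop := DehnSommerville {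
  ds_deg : forall j w, (j + sumn w != n)%N -> g j w = 0;
  ds_cat0 : forall j u v, g j (u ++ 0%N :: v) = g j (u ++ v);
  ds_euler : forall j u, g j u = \sum_(i < j.+1) (-1) ^+ i * g i (rcons u (j - i)%N);
  ds_interval : forall j u v m, (0 < m)%N ->
    \sum_(i < m.+1) (-1) ^+ i * g j (u ++ [:: (i : nat), (m - i)%N & v]) = 0 }.

Lemma ds_filter n g j w : dehn_sommerville n g -> g j w = g j (filter (ltn 0) w).
Proof.
move=> dsg; suff cat u : g j (u ++ w) = g j (u ++ filter (ltn 0) w) by exact: (cat [::]).
elim: w u => [|[|k] w IH] u //=; first by rewrite (ds_cat0 dsg).
by rewrite -!cat_rcons.
Qed.

Lemma ds_fl (X : rposet) : eulerian X ->
  dehn_sommerville (rrk (rtop X)) (fun j w => fl w j (rtop X)).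
Proof.
move=> EX; split=> [j w|j u v|j u|j u v m].
- exact: fl_deg.
- exact: fl_cat0.
- exact: fl_euler.
- exact: fl_interval.
Qed.

Lemma ds_lin n c g h : dehn_sommerville n g -> dehn_sommerville n h ->
  dehn_sommerville n (fun j w => c * g j w + h j w).
Proof.
move=> dsg dsh; split=> [j w ne|j u v|j u|j u v m m0].
- by rewrite (ds_deg dsg) // (ds_deg dsh) // mulr0 addr0.
- by rewrite (ds_cat0 dsg) (ds_cat0 dsh).
- rewrite (ds_euler dsg) (ds_euler dsh) mulr_sumr -big_split.
  by apply: eq_bigr => i _ /=; lra.
- transitivity (c * (\sum_(i < m.+1) (-1) ^+ i * g j (u ++ [:: (i : nat), (m - i)%N & v])) +
    \sum_(i < m.+1) (-1) ^+ i * h j (u ++ [:: (i : nat), (m - i)%N & v])).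
    by rewrite mulr_sumr -big_split; apply: eq_bigr => i _ /=; lra.
  by rewrite (ds_interval dsg) // (ds_interval dsh) // mulr0 addr0.
Qed.

(** The relations hold behind an arbitrary prefix [u], so a common first letter can be removed. This
    yields the stability under coefficients of t_0^k. *)
Lemma ds_cons n k g : (k <= n)%N -> dehn_sommerville n g ->
  dehn_sommerville (n - k) (fun j w => g j (k :: w)).
Proof.
move=> kn dsg; split=> [j w ne|j u v|j u|j u v l l0].
- by apply: (ds_deg dsg) => /=; lia.
- exact: (ds_cat0 dsg j (k :: u) v).
- exact: (ds_euler dsg j (k :: u)).
- exact: (ds_interval dsg j (k :: u) v l0).
Qed.

Lemma ds_divisible n g : dehn_sommerville n g -> (forall w, g 0%N w = 0) ->
  (forall w, g 1%N w = 0) /\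
  ((1 < n)%N -> dehn_sommerville (n - 2) (fun j w => g j.+2 w)).
Proof.
move=> dsg g0.
have g1 w : g 1%N w = 0.
  have := ds_euler dsg 1%N w; rewrite !big_ord_recl big_ord0 /= g0 mulr0 add0r.
  by rewrite subnn -cats1 (ds_cat0 dsg) cats0 addr0 /bump /= expr1; lra.
split=> // n1; split=> [j w ne|j u v|j u|j u v m m0].
- by apply: (ds_deg dsg); lia.
- exact: ds_cat0 dsg _ _ _.
- rewrite (ds_euler dsg) 2!big_ord_recl /= g0 g1 !mulr0 !add0r.
  apply: eq_bigr => i _; rewrite /bump /= !add1n !exprS mulrA mulN1r opprK mul1r.
  by rewrite !subSS.
- exact: ds_interval dsg _ _ _ _ m0.
Qed.

(** * The span of the flag functions of polytopes *)

Section Span.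
Variable C : rposet -> Prop.
Hypothesis C_euler : forall X, C X -> eulerian X.
Hypothesis C_pt : C rpt.
Hypothesis C_prod : forall X Y, C X -> C Y -> C (rprod X Y).
Hypothesis C_cone : forall X, C X -> C (rcone X).

Inductive flspan (n : nat) : (nat -> seq nat -> rat) -> Prop :=
| FlSpan0 g : (forall j w, g j w = 0) -> flspan n g
| FlSpanD X c h g : C X -> rrk (rtop X) = n -> flspan n h ->
    (forall j w, g j w = c * fl w j (rtop X) + h j w) -> flspan n g.

Lemma flspan_ds n g : flspan n g -> dehn_sommerville n g.
Proof.
elim=> {g} [g g0|X c h g CX <- _ dsh gE].
  split=> [*|*|*|*]; rewrite ?g0 //; first by rewrite big1 // => i _; rewrite g0 mulr0.
  by rewrite big1 // => i _; rewrite g0 mulr0.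
have dsc := ds_lin c (ds_fl (C_euler CX)) dsh.
split=> [j w ne|j u v|j u|j u v m m0].
- by rewrite gE (ds_deg dsc).
- by rewrite !gE (ds_cat0 dsc).
- by rewrite gE (ds_euler dsc); apply: eq_bigr => i _; rewrite gE.
- by rewrite -[RHS](ds_interval dsc j u v m0); apply: eq_bigr => i _; rewrite gE.
Qed.

Lemma flspan_ext n g h : (forall j w, g j w = h j w) -> flspan n h -> flspan n g.
Proof.
move=> gh sh; case: sh gh => {h} [h h0|X c k h CX rX sk hE] gh.
  by apply: FlSpan0 => j w; rewrite gh.
by apply: (FlSpanD CX rX sk) => j w; rewrite gh.
Qed.

Lemma flspan_lin n c g h :
  flspan n g -> flspan n h -> flspan n (fun j w => c * g j w + h j w).
Proof.
move=> sg sh; elim: sg => {g} [g g0|X d k g CX rX _ IH gE].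
  by apply: flspan_ext sh => j w; rewrite g0 mulr0 add0r.
by apply: (FlSpanD (c := c * d) CX rX IH) => j w; rewrite gE; lra.
Qed.

Lemma flspan0 n : flspan n (fun _ _ => 0). Proof. exact: FlSpan0. Qed.

Lemma flspan_fl X : C X -> flspan (rrk (rtop X)) (fun j w => fl w j (rtop X)).
Proof.
by move=> CX; apply: (FlSpanD (c := 1) CX erefl (flspan0 _)) => j w; rewrite addr0 mul1r.
Qed.

(** The linear extension of [flK]: a one-sided inverse to splitting off the last letter. *)
Lemma flspan_integral n g : flspan n g -> exists2 h, flspan n.+1 h &
  [/\ h 0%N [::] = 0, forall j w, all (ltn 0) w -> h j.+1 w = 1 / 2 * g j w
    & forall k w, all (ltn 0) w -> h 0%N (rcons w k.+1) = g k w].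
Proof.
elim=> {g} [g g0|X c k g CX <- _ [h sh [h0 hS hr]] gE].
  exists (fun _ _ => 0); first exact: flspan0.
  by split=> [//|j w _|k w _]; rewrite g0 ?mulr0.
pose K j w := flK w j (rtop X).
have sK : flspan (rrk (rtop X)).+1 K.
  pose S := rprod X (rcone rpt).
  have rS : (rrk (rtop X)).+1 = rrk (rtop S) by rewrite /= /rprod_rk /=; lia.
  have rT : (rrk (rtop X)).+1 = rrk (rtop (rcone X)) by rewrite /=; lia.
  have sS : flspan (rrk (rtop X)).+1 (fun j w => fl w j (rtop S)).
    by rewrite rS; apply: flspan_fl; apply: C_prod => //; exact: C_cone.
  have sT : flspan (rrk (rtop X)).+1 (fun j w => fl w j (rtop (rcone X))).
    by rewrite rT; apply: flspan_fl; exact: C_cone.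
  apply: flspan_ext (flspan_lin (- (1 / 2)) sS sT) => j w.
  by rewrite /K /flK mulNr addrC.
exists (fun j w => c * K j w + h j w); first exact: flspan_lin.
split=> [|j w w0|l w w0].
- by rewrite h0 /K flK0 mulr0 addr0.
- by rewrite hS // /K flK_succ // gE; lra.
- by rewrite hr // /K flK_rcons // gE.
Qed.

Lemma flspan_alpha2 n g : flspan n g -> exists2 h, flspan n.+2 h &
  (forall j w, (j < 2)%N -> h j w = 0) /\ (forall j w, h j.+2 w = g j w).
Proof.
elim=> {g} [g g0|X c k g CX <- _ [h sh [h0 hS]] gE].
  exists (fun _ _ => 0); first exact: flspan0.
  by split=> [//|j w]; rewrite g0.
pose Q j w := flQ w j (rtop X).
have sQ : flspan (rrk (rtop X)).+2 Q.
  pose T := rprod X (rcone (rcone rpt)); pose S := rprod (rprod X (rcone rpt)) (rcone rpt).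
  have rT : (rrk (rtop X)).+2 = rrk (rtop T) by rewrite /= /rprod_rk /=; lia.
  have rS : (rrk (rtop X)).+2 = rrk (rtop S).
    by rewrite /= /rprod_rk /= /rprod_rk /=; lia.
  have sT : flspan (rrk (rtop X)).+2 (fun j w => fl w j (rtop T)).
    by rewrite rT; apply: flspan_fl; apply: C_prod => //; do 2!apply: C_cone.
  have sS : flspan (rrk (rtop X)).+2 (fun j w => fl w j (rtop S)).
    rewrite rS; apply: flspan_fl; apply: C_prod; last exact: C_cone.
    by apply: C_prod => //; exact: C_cone.
  apply: flspan_ext (flspan_lin 4 sT (flspan_lin (-3) sS (flspan0 _))) => j w.
  by rewrite /Q /flQ addr0 mulNr.
exists (fun j w => c * Q j w + h j w); first exact: flspan_lin.
split=> [j w j2|j w]; first by rewrite h0 // /Q flQ_lt2 // mulr0 addr0.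
by rewrite hS gE /Q flQ_succ2.
Qed.

Lemma sign_shift (j i : nat) : (i <= j)%N -> (-1) ^+ (j - i) = (-1) ^+ j * (-1) ^+ i :> rat.
Proof.
move=> ij; rewrite -{2}(subnK ij) exprD -mulrA -exprMn mulrNN mulr1 expr1n.
by rewrite mulr1.
Qed.

(* The Dehn-Sommerville relations characterize the span of the polytopes: writing
   [h] for the part of [g] at [alpha = 0] and splitting off the last letter of its
   words gives a function [g'] of degree [n - 1]; the combination
   [cone - 1/2 prism] applied to [g'] has the same part at [alpha = 0] as [g], and
   the difference is divisible by [alpha ^ 2]. *)
Lemma ds_flspan n g : dehn_sommerville n g -> flspan n g.
Proof.
elim/ltn_ind: n g => -[|n] IH g dsg.
  apply: (FlSpanD (c := g 0%N [::]) C_pt erefl (flspan0 _)) => j w.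
  rewrite addr0 fl_rpt; have [w0|w0] := eqVneq (sumn w) 0%N; last first.
    by rewrite mulr0 (ds_deg dsg) //; lia.
  have [->|j0] := eqVneq j 0%N; last by rewrite mulr0 (ds_deg dsg) //; lia.
  rewrite mulr1 (ds_filter _ _ dsg); congr (g _ _).
  by elim: w w0 => [|[|k] w IHw] //=.
pose g1 (j : nat) (w : seq nat) := g 0%N (rcons w j.+1).
have dsg1 : dehn_sommerville n g1.
  split=> [j w ne|j u v|j u|j u v m m0].
  - by apply: (ds_deg dsg); rewrite sumn_rcons; lia.
  - by rewrite /g1 -!cats1 -!catA /= (ds_cat0 dsg).
  (* The interval relation of length [j + 1] at the end of the word, with the last letter read as a
     dimension plus one. Its top term ends in the letter 0 and is [g1 j u] up to sign; reversing the
     index turns the others into the terms of the Euler relation for [g1]. *)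
  - have := ds_interval dsg 0%N u [::] (ltn0Sn j).
    rewrite big_ord_recr /= subnn -cat_rcons (ds_cat0 dsg) cats0 -/(g1 j u).
    rewrite (reindex_inj rev_ord_inj) /=.
    have -> : \sum_(i < j.+1) (-1) ^+ (j.+1 - i.+1) *
        g 0%N (u ++ [:: (j.+1 - i.+1)%N; (j.+1 - (j.+1 - i.+1))%N]) =
        (-1) ^+ j * \sum_(i < j.+1) (-1) ^+ i * g1 i (rcons u (j - i)%N).
      rewrite mulr_sumr; apply: eq_bigr => i _; have := ltn_ord i => lti.
      rewrite subSS sign_shift // mulrA; congr (_ * _).
      by rewrite /g1 -!cats1 -catA /=; congr (g _ (_ ++ [:: _; _])); lia.
    rewrite exprS mulN1r mulNr => /eqP; rewrite subr_eq0 => /eqP e.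
    by apply/esym; apply: mulfI e; rewrite signr_eq0.
  - rewrite -[RHS](ds_interval dsg 0%N u (rcons v j.+1) m0).
    by apply: eq_bigr => i _; rewrite /g1 rcons_cat.
have [h sh [h0 hS hr]] := flspan_integral (IH n (ltnSn n) g1 dsg1).
pose g2 j w := g j w - h j w.
have dsg2 : dehn_sommerville n.+1 g2.
  have := ds_lin (-1) (flspan_ds sh) dsg; congr dehn_sommerville.
  by apply/funext => j; apply/funext => w; rewrite mulN1r addrC.
have g20 w : g2 0%N w = 0.
  rewrite (ds_filter _ _ dsg2); have := filter_all (ltn 0) w.
  case/lastP: (filter _ _) => [|u [|k]]; first by rewrite /g2 h0 (ds_deg dsg) ?subr0.
    by rewrite all_rcons.
  by rewrite all_rcons /= => u0; rewrite /g2 hr // subrr.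
have [g21 dsg3] := ds_divisible dsg2 g20.
suff [k sk gk] : exists2 k, flspan n.+1 k & forall j w, g2 j w = k j w.
  apply: flspan_ext (flspan_lin 1 sh sk) => j w; rewrite -gk /g2; lra.
(* In degree 1 nothing remains once the parts at alpha^0 and alpha^1 vanish; otherwise the induction
   applies two degrees lower. *)
case: n IH {dsg sh dsg1} dsg2 dsg3 => [|n] IH dsg2 dsg3.
  exists (fun _ _ => 0); first exact: flspan0.
  by move=> [|[|j]] w //; apply: (ds_deg dsg2); lia.
have := dsg3 isT; rewrite !subSS subn0 => {}dsg3.
have [k sk [k0 kS]] := flspan_alpha2 (IH n (leqnSn _) _ dsg3).
by exists k => // -[|[|j]] w; rewrite ?kS ?g20 ?g21 ?k0.
Qed.
End Span.

(** * The Euler characteristic *)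

Section Compact.
Local Open Scope classical_set_scope.
Import topology normedtype derive numFieldNormedType.Exports.
Variable R : realType.

(** Linear images of such sets are closed under hyperplane sections, since a section only adds a
    column to [L]. Thus polytopes can be sliced without computing the vertices of the slices. *)
Definition simplex_slice m p (L : 'M[R]_(m, p)) (l : 'rV[R]_p) : set 'rV[R]_m :=
  [set a : 'rV[R]_m | [/\ forall i, 0 <= a 0 i, \sum_i a 0 i = 1 & a *m L = l]].

Lemma continuous_lin m p (L : 'M[R]_(m, p)) j :
  continuous (fun a : 'rV[R]_m => (a *m L) 0 j).
Proof.
have -> : (fun a : 'rV[R]_m => (a *m L) 0 j) = (fun a => \sum_i a 0 i * L i j).
  by apply/funext => a; rewrite mxE.
apply: continuous_big => [|i _]; first exact: add_continuous.
move=> a; apply: continuousM; [exact: coord_continuous|exact: cst_continuous].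
Qed.

Lemma simplex_slice_compact m p (L : 'M[R]_(m, p)) (l : 'rV[R]_p) :
  compact (simplex_slice L l).
Proof.
pose box := [set a : 'rV[R]_m | forall i, `[0, 1]%classic (a ord0 i)].
have cbox : compact box.
  by apply: (@rV_compact R m (fun=> `[0, 1]%classic)) => i; exact: segment_compact.
pose S := [set a : 'rV[R]_m | (a *m const_mx 1 : 'rV_1) 0 0 = 1].
pose T := \bigcap_(j : 'I_p) [set a : 'rV[R]_m | (a *m L) 0 j = l 0 j].
have -> : simplex_slice L l = box `&` (S `&` T).
  apply/seteqP; split=> a /=.
    move=> [a0 a1 aL]; split=> [i|]; last split.
    - rewrite /= in_itv /= a0 /= -a1 (bigD1 i) //= lerDl; exact: sumr_ge0.
    - by rewrite /S /= mxE -[RHS]a1; apply: eq_bigr => i _; rewrite mxE mulr1.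
    - by move=> j _ /=; rewrite aL.
  move=> [a01 [a1 aL]]; split=> [i||].
  - by have := a01 i; rewrite /= in_itv /= => /andP[].
  - by rewrite -[RHS]a1 mxE; apply: eq_bigr => i _; rewrite mxE mulr1.
  - by apply/rowP => j; apply: aL.
apply: compact_closedI => //; apply: closedI.
  apply: (@preimage_closed _ _ (fun a : 'rV[R]_m => (a *m const_mx 1 : 'rV_1) 0 0) [set 1]).
    by move=> a _; exact: continuous_lin.
  exact: accessible_closed_set1 (@hausdorff_accessible _ (@norm_hausdorff R R)) 1.
apply: closed_bigI => j _.
apply: (@preimage_closed _ _ (fun a : 'rV[R]_m => (a *m L) 0 j) [set l 0 j]).
  by move=> a _; exact: continuous_lin.
exact: accessible_closed_set1 (@hausdorff_accessible _ (@norm_hausdorff R R)) _.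
Qed.

Lemma simplex_slice_max m p (L : 'M[R]_(m, p)) (l : 'rV[R]_p) (u : 'cV[R]_m) :
  simplex_slice L l !=set0 ->
  exists2 a, simplex_slice L l a &
    forall b, simplex_slice L l b -> (b *m u) 0 0 <= (a *m u) 0 0.
Proof.
move=> ne; have [|a aC amax] := EVT_max_rV (f := fun a : 'rV[R]_m => (a *m u) 0 0)
  ne (simplex_slice_compact (L := L) (l := l)).
  exact/continuous_subspaceT/continuous_lin.
by exists a; [rewrite -inE|move=> b bC; apply: amax; rewrite inE].
Qed.

End Compact.

Section EulerCharacteristic.
Local Open Scope classical_set_scope.
Variable R : realType.

(* [c] is the Euler characteristic of a multiple [s] of the indicator function of
   a nonempty bounded interval which is closed or open. *)
Definition interval_char (s : R -> rat) (c : rat) :=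
  (exists a b, a <= b /\ forall t, s t = if a <= t <= b then c else 0) \/
  (exists a b, a < b /\ forall t, s t = if a < t < b then - c else 0).

(** The Euler characteristic on the line is the sum over x of s(x) - s(x + 0). A closed interval
    contributes at its right end, an open one at its left end. The two conditions say that the step
    from [x] to [x + d] neither reaches nor crosses an endpoint from the left. *)
Lemma interval_char_jump s c : interval_char s c ->
  exists abe : R * R * R, forall x d : R, 0 < d ->
    (x < abe.1.1 -> x + d < abe.1.1) -> (x < abe.1.2 -> x + d < abe.1.2) ->
    s x - s (x + d) = if x == abe.2 then c else 0.
Proof.
case=> [[a [b [ab sE]]]|[a [b [ab sE]]]].
  have s_in t : a <= t -> t <= b -> s t = c by move=> *; rewrite sE ifT //; apply/andP.
  have s_lt t : t < a -> s t = 0 by move=> ta; rewrite sE ifF //; lra.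
  have s_gt t : b < t -> s t = 0 by move=> bt; rewrite sE ifF //; lra.
  exists (a, b, b) => x d d0 /= xa xb.
  have [ltxb|ltbx|->] := ltgtP x b.
  - have xdb := xb ltxb; have [ltxa|lexa] := ltP x a.
      by rewrite s_lt // s_lt ?subr0 //; exact: xa.
    by rewrite !s_in ?subrr //; lra.
  - by rewrite !s_gt ?subr0 //; lra.
  - by rewrite s_in // s_gt ?subr0 //; lra.
have s_in t : a < t -> t < b -> s t = - c by move=> *; rewrite sE ifT //; apply/andP.
have s_le t : t <= a -> s t = 0 by move=> ta; rewrite sE ifF //; lra.
have s_ge t : b <= t -> s t = 0 by move=> bt; rewrite sE ifF //; lra.
exists (a, b, a) => x d d0 /= xa xb.
have [ltxa|ltax|e] := ltgtP x a.
- by rewrite !s_le ?subr0 //; [apply/ltW/xa|apply/ltW].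
- have [ltxb|lexb] := ltP x b; last by rewrite !s_ge ?subr0 //; lra.
  by have xdb := xb ltxb; rewrite !s_in ?subrr //; lra.
- have xdb : x + d < b by apply: xb; rewrite e.
  by rewrite s_le ?e // s_in ?sub0r ?opprK // -e //; lra.
Qed.

Lemma pos_lower_bound (s : seq R) : (forall x, x \in s -> 0 < x) ->
  exists2 d, 0 < d & forall x, x \in s -> d < x.
Proof.
elim: s => [|y s IH] s0; first by exists 1.
have [|d d0 ds] := IH; first by move=> x xs; apply: s0; rewrite inE xs orbT.
have y0 : 0 < y by apply: s0; rewrite inE eqxx.
exists (Num.min (d / 2) (y / 2)); first by rewrite lt_min; apply/andP; split; lra.
move=> x; rewrite inE => /predU1P[->|/ds dx]; rewrite gt_min; last first.
  by apply/orP; left; lra.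
by apply/orP; right; lra.
Qed.

(** Finitely many intervals admit a common step [d]. Summing the jumps over all jump points gives
    the left-hand side, while the relation holds at [x] and at [x + d] separately. *)
Lemma interval_char_sum (I : finType) (n c : I -> rat) (s : I -> R -> rat) :
  (forall i, interval_char (s i) (c i)) -> (forall t, \sum_i n i * s i t = 0) ->
  \sum_i n i * c i = 0.
Proof.
move=> sc ns0.
have /choice[abe abeP] i := interval_char_jump (sc i).
pose L := undup [seq (abe i).2 | i : I].
pose ends := [seq (abe i).1.1 | i : I] ++ [seq (abe i).1.2 | i : I].
pose gaps := [seq y - x | x <- L, y <- ends].
have [|d d0 dP] := @pos_lower_bound [seq g <- gaps | 0 < g].
  by move=> x; rewrite mem_filter => /andP[].
have dend x y : x \in L -> y \in ends -> x < y -> x + d < y.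
  move=> xL yE xy; rewrite addrC -ltrBrDr; apply: dP.
  by rewrite mem_filter subr_gt0 xy; apply/allpairsP; exists (x, y).
transitivity (\sum_(x <- L) \sum_i n i * (s i x - s i (x + d))); last first.
  apply: big1 => x _; under eq_bigr do rewrite mulrBr.
  by rewrite sumrB !ns0 subr0.
rewrite exchange_big; apply: eq_bigr => i _ /=.
rewrite -mulr_sumr; congr (_ * _).
have eL : (abe i).2 \in L by rewrite mem_undup; apply/mapP; exists i => //; rewrite mem_enum.
rewrite (big_rem _ eL) /= abeP // ?eqxx; first last.
- by apply: dend => //; rewrite mem_cat; apply/orP; right; apply/mapP; exists i; rewrite ?mem_enum.
- by apply: dend => //; rewrite mem_cat; apply/orP; left; apply/mapP; exists i; rewrite ?mem_enum.
rewrite big1_seq ?addr0 // => x /=; rewrite rem_filter ?undup_uniq // mem_filter /=.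
move=> /andP[/negPf xe xL]; rewrite abeP // ?xe //.
- by apply: dend => //; rewrite mem_cat; apply/orP; left; apply/mapP; exists i; rewrite ?mem_enum.
- by apply: dend => //; rewrite mem_cat; apply/orP; right; apply/mapP; exists i; rewrite ?mem_enum.
Qed.


Definition cl_type d (A : set 'rV[R]_d) := exists m p (M : 'M[R]_(m, d))
  (L : 'M[R]_(m, p)) (l : 'rV[R]_p),
  forall x, A x <-> exists2 a, simplex_slice L l a & x = a *m M.

(** Bounded relatively open convex sets of dimension [k], with [V] spanning the directions. They are
    described by properties that pass to hyperplane sections, rather than by generators. *)
Record op_type d k (A : set 'rV[R]_d) : Prop := OpType {
  op_dir : exists r (V : 'M[R]_(r, d)), [/\ \rank V = k,
    forall x y, A x -> A y -> (x - y <= V)%MS &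
    forall x u, A x -> (u <= V)%MS -> exists2 e, 0 < e & A (x + e *: u)];
  op_convex : forall x y t, A x -> A y -> 0 <= t <= 1 -> A (t *: x + (1 - t) *: y);
  op_bounded : exists B, forall x i, A x -> `|x 0 i| <= B }.

Definition euler_char d (A : set 'rV[R]_d) (c : rat) :=
  [\/ (forall x, ~ A x) /\ c = 0,
      [/\ A !=set0, cl_type A & c = 1] |
      exists k, [/\ A !=set0, op_type k A & c = (-1) ^+ k]].

Definition slice d (A : set 'rV[R]_(1 + d)) (t : R) : set 'rV[R]_d :=
  [set y | A (row_mx t%:M y)].

Lemma euler_char_unit (A : set 'rV[R]_0) c : euler_char A c ->
  c = if `[< A 0 >] then 1 else 0.
Proof.
have A0 : A !=set0 -> A 0 by case=> x; rewrite [x]thinmx0.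
case=> [[nA ->]|[/A0 A0' _ ->]|[k [/A0 A0' oA ->]]].
- by rewrite asboolF.
- by rewrite asboolT.
rewrite asboolT //; have [r [V [<- _ _]]] := op_dir oA.
by rewrite [V]thinmx0 mxrank0 expr0.
Qed.

Lemma simplex_slice_convex m p (L : 'M[R]_(m, p)) l a b t :
  simplex_slice L l a -> simplex_slice L l b -> 0 <= t <= 1 ->
  simplex_slice L l (t *: a + (1 - t) *: b).
Proof.
move=> [a0 a1 aL] [b0 b1 bL] /andP[t0 t1]; split=> [i||].
- by rewrite !mxE addr_ge0 // mulr_ge0 // subr_ge0.
- under eq_bigr do rewrite !mxE.
  by rewrite big_split /= -!mulr_sumr a1 b1; lra.
- by rewrite mulmxDl -!scalemxAl aL bL -scalerDl addrC subrK scale1r.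
Qed.

Lemma mx11_lin (y z : R) (B C : 'M[R]_1) : (y *: B + z *: C) 0 0 = y * B 0 0 + z * C 0 0.
Proof. by rewrite !mxE. Qed.

Lemma mx11N (B : 'M[R]_1) : (- B) 0 0 = - B 0 0.
Proof. by rewrite mxE. Qed.

Lemma mx11B (B C : 'M[R]_1) : (B - C) 0 0 = B 0 0 - C 0 0.
Proof. by rewrite !mxE. Qed.

Lemma cl_type_slice d (A : set 'rV[R]_(1 + d)) t : cl_type A -> cl_type (slice A t).
Proof.
move=> [m [p [M [L [l AE]]]]].
exists m, (p + 1)%N, (rsubmx M), (row_mx L (lsubmx M)), (row_mx l t%:M) => y.
rewrite /slice /= AE; split=> [[a [a0 a1 aL] e]|[a [a0 a1 aL] e]].
  move: e; rewrite -{1}[M]hsubmxK mul_mx_row => /eq_row_mx[tM yM].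
  by exists a => //; split=> //; rewrite mul_mx_row aL tM.
move: aL; rewrite mul_mx_row => /eq_row_mx[aL tM].
by exists a; [split|rewrite -{1}[M]hsubmxK mul_mx_row tM e].
Qed.

(** By compactness the first coordinate attains its extremes on [A], and by convexity every value in
    between, so the nonempty slices lie over a closed interval. *)
Lemma euler_char_slice_cl d (A : set 'rV[R]_(1 + d)) : A !=set0 -> cl_type A ->
  exists2 s : R -> rat, interval_char s 1 & forall t, euler_char (slice A t) (s t).
Proof.
move=> A0 clA; exists (fun t => if `[< slice A t !=set0 >] then 1 else 0); last first.
  move=> t; case: asboolP => [St|St].
    by apply: Or32; split=> //; exact: cl_type_slice.
  by apply: Or31; split=> // x Sx; apply: St; exists x.
left; have [m [p [M [L [l AE]]]]] := clA.
have slE t : slice A t !=set0 <-> exists2 a, simplex_slice L l a & (a *m lsubmx M) 0 0 = t.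
  split=> [[y /AE[a aC e]]|[a aC e]].
    exists a => //; move: e; rewrite -{1}[M]hsubmxK mul_mx_row => /eq_row_mx[<- _].
    by rewrite mxE eqxx mulr1n.
  exists (a *m rsubmx M); apply/AE; exists a => //.
  rewrite -{2}[M]hsubmxK mul_mx_row; congr row_mx.
  by rewrite [RHS]mx11_scalar e.
have C0 : simplex_slice L l !=set0 by have [x /AE[a aC _]] := A0; exists a.
have [b bC bmax] := simplex_slice_max (lsubmx M) C0.
have [a aC amin] := simplex_slice_max (- lsubmx M) C0.
exists ((a *m lsubmx M) 0 0), ((b *m lsubmx M) 0 0).
have le_ab : (a *m lsubmx M) 0 0 <= (b *m lsubmx M) 0 0 by exact: bmax.
split=> // t; set u := lsubmx M in le_ab amin bmax slE *.
case: asboolP => [/slE[c cC <-]|nS].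
  rewrite ifT // bmax // andbT.
  by have := amin _ cC; rewrite !mulmxN !mx11N lerN2.
rewrite ifF //; apply/negP => /andP[at_ tb]; apply/nS/slE.
have [e|ne] := eqVneq ((a *m u) 0 0) ((b *m u) 0 0).
  by exists a => //; apply/eqP; rewrite eq_le at_ /= e.
have lt_ab : (a *m u) 0 0 < (b *m u) 0 0 by rewrite lt_neqAle ne.
pose q := (t - (a *m u) 0 0) / ((b *m u) 0 0 - (a *m u) 0 0).
exists (q *: b + (1 - q) *: a).
  apply: simplex_slice_convex => //; apply/andP; split.
    by apply: divr_ge0; lra.
  by rewrite ler_pdivrMr ?subr_gt0 // mul1r; lra.
have qE : q * ((b *m u) 0 0 - (a *m u) 0 0) = t - (a *m u) 0 0.
  by rewrite divfK // subr_eq0 gt_eqF.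
by rewrite mulmxDl -!scalemxAl mx11_lin; lra.
Qed.


Lemma op_type_flat_slice d k (A : set 'rV[R]_(1 + d)) t : A !=set0 -> op_type k A ->
  (forall x, A x -> lsubmx x = t%:M) -> op_type k (slice A t).
Proof.
move=> [x0 Ax0] [[r [V [rV Vsub Vop]]] Acvx [B AB]] At.
have V0 : lsubmx V = 0.
  apply/row_matrixP => i; rewrite row0.
  have [e e0 Ae] := Vop _ (row i V) Ax0 (row_sub i V).
  have := At _ Ae; rewrite linearD linearZ /= (At _ Ax0) => /(canRL (addKr _))/eqP.
  rewrite addNr scaler_eq0 gt_eqF //= => /eqP e'.
  by rewrite -e'; apply/rowP => j; rewrite !mxE.
have VE : V = row_mx 0 (rsubmx V) by rewrite -{1}[V]hsubmxK V0.
have sub0 u : (row_mx (0 : 'rV_1) u <= V)%MS = (u <= rsubmx V)%MS.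
  apply/submxP/submxP => -[D].
    by rewrite VE mul_mx_row => /eq_row_mx[_ ->]; exists D; rewrite row_mxKr.
  by move=> ->; exists D; rewrite {2}VE mul_mx_row mulmx0.
split.
- exists r, (rsubmx V); split; first by rewrite -rV {2}VE rank_row_0mx.
    by move=> x y Ax Ay; have := Vsub _ _ Ax Ay; rewrite opp_row_mx add_row_mx subrr sub0.
  move=> x u Ax uV; have [|e e0 Ae] := Vop _ (row_mx 0 u) Ax; first by rewrite sub0.
  by exists e => //; move: Ae; rewrite scale_row_mx scaler0 add_row_mx addr0.
- move=> x y q Ax Ay q01; have := Acvx _ _ _ Ax Ay q01.
  by rewrite !scale_row_mx add_row_mx -scalerDl addrC subrK scale1r /slice /= addrC.
- exists B => x i Ax; have := AB _ (rshift 1 i) Ax.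
  by rewrite row_mxEr.
Qed.

(** The hyperplane meets [A] without containing it, so [c] is nonzero on the directions of [A] and
    its kernel there has dimension [k - 1]. *)
Lemma op_type_section d k (A : set 'rV[R]_d) (c : 'cV[R]_d) t : op_type k A ->
  (exists2 x, A x & (x *m c) 0 0 = t) -> (exists2 y, A y & (y *m c) 0 0 != t) ->
  (0 < k)%N /\ op_type k.-1 (A `&` [set x | (x *m c) 0 0 = t]).
Proof.
move=> [[r [V [rV Vsub Vop]]] Acvx [B AB]] [x Ax xt] [y Ay yt].
have rc : \rank (V *m c) = 1%N.
  apply/eqP; rewrite eqn_leq rank_leq_col lt0n mxrank_eq0.
  apply: contraNneq yt => Vc0; have /submxP[D e] := Vsub _ _ Ay Ax.
  have : ((y - x) *m c) 0 0 = 0 by rewrite e -mulmxA Vc0 mulmx0 mxE.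
  by rewrite mulmxBl mx11B xt => /eqP; rewrite subr_eq0.
have rkV := mxrank_mul_ker V c; rewrite rc rV in rkV.
split; first by lia.
split.
- exists d, (V :&: kermx c)%MS; split; first by lia.
    move=> z w [Az zt] [Aw wt]; rewrite sub_capmx Vsub // sub_kermx mulmxBl.
    by apply/eqP/rowP => i; rewrite !ord1 mx11B zt wt subrr mxE.
  move=> z u [Az zt]; rewrite sub_capmx => /andP[uV /sub_kermxP uc].
  have [e e0 Ae] := Vop _ _ Az uV; exists e => //; split=> //=.
  by rewrite mulmxDl -scalemxAl uc scaler0 addr0.
- move=> z w q [Az zt] [Aw wt] q01; split; first exact: Acvx.
  by rewrite /= mulmxDl -!scalemxAl mx11_lin zt wt; lra.
- by exists B => z i [Az _]; exact: AB.
Qed.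


(** Either the first coordinate is constant and there is a single nonempty slice, or its values form
    an open interval with slices of dimension [k - 1]. In the second case the sign lost by the
    slices is restored by the sign of the open interval. *)
Lemma euler_char_slice_op d (k : nat) (A : set 'rV[R]_(1 + d)) : A !=set0 -> op_type k A ->
  exists2 s : R -> rat, interval_char s ((-1) ^+ k) & forall t, euler_char (slice A t) (s t).
Proof.
move=> A0 opA; have [x0 Ax0] := A0.
pose f (x : 'rV[R]_(1 + d)) := lsubmx x 0 0.
have fE x : lsubmx x = (f x)%:M by rewrite /f -mx11_scalar.
have sl0 t : slice A t !=set0 <-> exists2 x, A x & f x = t.
  split=> [[y Ay]|[x Ax <-]].
    by exists (row_mx t%:M y) => //; rewrite /f row_mxKl mxE eqxx mulr1n.
  by exists (rsubmx x); rewrite /slice /= -fE hsubmxK.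
have nsl t : ~ (slice A t !=set0) -> forall y, ~ slice A t y.
  by move=> nS y Sy; apply: nS; exists y.
have [flat|/existsNP[y0 /not_implyP[Ay0 /eqP ne]]] := pselect (forall x, A x -> f x = f x0).
  exists (fun t => if t == f x0 then (-1) ^+ k else 0).
    left; exists (f x0), (f x0); split=> // t.
    by rewrite eq_le andbC.
  move=> t; case: eqP => [->|ne].
    apply: Or33; exists k; split=> //; first by apply/sl0; exists x0.
    by apply: op_type_flat_slice => // x Ax; rewrite fE flat.
  by apply: Or31; split=> //; apply: nsl => /sl0[x Ax xt]; apply: ne; rewrite -xt flat.
pose c : 'cV[R]_(1 + d) := col_mx 1%:M 0.
have cE x : (x *m c) 0 0 = f x by rewrite -[x]hsubmxK mul_row_col mulmx1 mulmx0 addr0 /f row_mxKl.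
have sect t : (exists2 x, A x & f x = t) -> (0 < k)%N /\ op_type k.-1 (slice A t).
  move=> [x Ax xt]; have [||k0 opS] := op_type_section (c := c) (t := t) opA.
  - by exists x; rewrite ?cE.
  - have [e|ne'] := eqVneq (f x0) t; last by exists x0; rewrite ?cE.
    by exists y0; rewrite ?cE // -e.
  split=> //; have -> : slice A t = slice (A `&` [set x | (x *m c) 0 0 = t]) t.
    apply/seteqP; split=> y /=; last by case.
    by move=> Ay; split=> //=; rewrite cE /f row_mxKl mxE eqxx mulr1n.
  apply: op_type_flat_slice => //; first by exists x; split=> //=; rewrite cE.
  by move=> z [_ /=]; rewrite cE fE => ->.
have [k0 _] := sect _ (ex_intro2 _ _ _ Ax0 erefl).
pose T := [set t | exists2 x, A x & f x = t].
have T0 : T !=set0 by exists (f x0), x0.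
have [B AB] := op_bounded opA.
have fB x : A x -> `|f x| <= B by move=> Ax; rewrite /f mxE; exact: AB.
have supT : has_sup T.
  by split=> //; exists B => _ [x Ax <-]; exact: le_trans (ler_norm _) (fB _ Ax).
have infT : has_inf T.
  by split=> //; exists (- B) => _ [x Ax <-]; have := fB _ Ax; rewrite ler_norml => /andP[].
(* From any point of [A] one can move a little both ways along a direction [w] on which the first
   coordinate increases, so no value is extremal. *)
have Topen t : T t -> exists t1 t2, [/\ T t1, T t2, t1 < t & t < t2].
  move=> [x Ax xt]; have [r [V [rV Vsub Vop]]] := op_dir opA.
  pose w := if f x0 < f y0 then y0 - x0 else x0 - y0.
  have fD a b : f (a + b) = f a + f b by rewrite /f linearD mxE.
  have fZ e a : f (e *: a) = e * f a by rewrite /f linearZ mxE.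
  have fN a : f (- a) = - f a by rewrite /f linearN mxE.
  have w0 : 0 < f w.
    rewrite /w; case: (ltP (f x0)) => lt; rewrite fD fN subr_gt0 //.
    by rewrite lt_neqAle ne.
  have wV : (w <= V)%MS by rewrite /w; case: ifP => _; exact: Vsub.
  have [e e0 Ae] := Vop _ _ Ax wV.
  have wNV : (- w <= V)%MS by rewrite eqmx_opp.
  have [e' e'0 Ae'] := Vop _ _ Ax wNV.
  exists (f (x + e' *: - w)), (f (x + e *: w)).
  split; [by exists (x + e' *: - w)|by exists (x + e *: w)| |];
    rewrite fD fZ ?fN xt ?mulrN.
    by rewrite ltrBlDr ltrDl mulr_gt0.
  by rewrite ltrDl mulr_gt0.
have Tsup t : T t -> t < sup T.
  move=> /Topen[_ [t2 [_ Tt2 _ tt2]]]; apply: lt_le_trans tt2 _.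
  exact: sup_upper_bound.
have Tinf t : T t -> inf T < t.
  move=> /Topen[t1 [_ [Tt1 _ t1t _]]]; apply: le_lt_trans t1t.
  by apply: ge_inf => //; case: infT.
exists (fun t => if `[< slice A t !=set0 >] then (-1) ^+ k.-1 else 0); last first.
  move=> t; case: asboolP => [St|St]; last by apply: Or31; split=> //; exact: nsl.
  apply: Or33; exists k.-1; split=> //.
  by have /sl0/sect[] := St.
right; exists (inf T), (sup T); split.
  by have := lt_trans (Tinf _ (ex_intro2 _ _ _ Ax0 erefl)) (Tsup _ (ex_intro2 _ _ _ Ax0 erefl)).
move=> t; have -> : - (-1) ^+ k = (-1) ^+ k.-1 :> rat.
  by rewrite -{1}(prednK k0) exprS mulN1r opprK.
case: asboolP => [/sl0 Tt|nS]; first by rewrite ifT // Tinf ?Tsup.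
rewrite ifF //; apply/negP => /andP[lt1 lt2]; apply/nS/sl0.
have [t1 [x1 Ax1 xt1] t1t] : exists2 t1, T t1 & t1 < t.
  have e0 : 0 < t - inf T by rewrite subr_gt0.
  by have [e Te lte] := inf_adherent e0 infT; exists e => //; move: lte; rewrite addrC subrK.
have [t2 [x2 Ax2 xt2] tt2] : exists2 t2, T t2 & t < t2.
  have e0 : 0 < sup T - t by rewrite subr_gt0.
  by have [e Te lte] := sup_adherent e0 supT; exists e => //; move: lte; rewrite subKr.
pose q := (t - t1) / (t2 - t1).
exists (q *: x2 + (1 - q) *: x1).
  apply: (op_convex opA) => //; apply/andP; split.
    by apply: divr_ge0; lra.
  by rewrite ler_pdivrMr ?mul1r; lra.
have qE : q * (t2 - t1) = t - t1 by rewrite divfK // subr_eq0 gt_eqF //; lra.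
by rewrite -cE mulmxDl -!scalemxAl mx11_lin !cE xt1 xt2; lra.
Qed.

Lemma euler_char_slice d (A : set 'rV[R]_(1 + d)) c : euler_char A c ->
  exists2 s : R -> rat, interval_char s c & forall t, euler_char (slice A t) (s t).
Proof.
case=> [[nA ->]|[A0 clA ->]|[k [A0 opA ->]]].
- exists (fun=> 0); first by left; exists 0, 0; split=> // t; rewrite if_same.
  by move=> t; apply: Or31; split=> // y /nA.
- exact: euler_char_slice_cl.
- exact: euler_char_slice_op.
Qed.

(* The Euler characteristic is a valuation: linear relations between indicator
   functions are preserved.  A functional is computed coordinate by coordinate, by
   integrating the Euler characteristics of the slices. *)
Lemma euler_char_valuation d (I : finType) (n c : I -> rat) (A : I -> set 'rV[R]_d) :
  (forall i, euler_char (A i) (c i)) ->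
  (forall x, \sum_i n i * (if `[< A i x >] then 1 else 0) = 0) ->
  \sum_i n i * c i = 0.
Proof.
elim: d c A => [|d IH] c A Ac nA0.
  by rewrite -[RHS](nA0 0); apply: eq_bigr => i _; rewrite (euler_char_unit (Ac i)).
have /choice[s sP] i : exists s : R -> rat, interval_char s (c i) /\
    forall t, euler_char (slice (A i : set 'rV_(1 + d)) t) (s t).
  by have [s ? ?] := @euler_char_slice d (A i) _ (Ac i); exists s.
apply: (@interval_char_sum _ n c s) => [i|t]; first by have [] := sP i.
apply: (IH _ (fun i => slice (A i : set 'rV_(1 + d)) t)) => [i|x]; first by have [] := sP i.
exact: (nA0 (row_mx t%:M x)).
Qed.

End EulerCharacteristic.

(** * Faces of polytopes *)

Section Farkas.
Variables (R : realFieldType) (d : nat).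

Definition dot (x : 'rV[R]_d) (c : 'cV[R]_d) : R := (x *m c) 0 0.

Lemma dotDl x y c : dot (x + y) c = dot x c + dot y c.
Proof. by rewrite /dot mulmxDl mxE. Qed.
Lemma dotNl x c : dot (- x) c = - dot x c.
Proof. by rewrite /dot mulNmx mxE. Qed.
Lemma dotBl x y c : dot (x - y) c = dot x c - dot y c.
Proof. by rewrite dotDl dotNl. Qed.
Lemma dotZl a x c : dot (a *: x) c = a * dot x c.
Proof. by rewrite /dot -scalemxAl mxE. Qed.
Lemma dotDr x c c' : dot x (c + c') = dot x c + dot x c'.
Proof. by rewrite /dot mulmxDr mxE. Qed.
Lemma dotNr x c : dot x (- c) = - dot x c.
Proof. by rewrite /dot mulmxN mxE. Qed.
Lemma dotBr x c c' : dot x (c - c') = dot x c - dot x c'.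
Proof. by rewrite dotDr dotNr. Qed.
Lemma dotZr a x c : dot x (a *: c) = a * dot x c.
Proof. by rewrite /dot -scalemxAr mxE. Qed.
Lemma dot0l c : dot 0 c = 0.
Proof. by rewrite /dot mul0mx mxE. Qed.
Lemma dot_suml (I : Type) (r : seq I) (P : pred I) F c :
  dot (\sum_(i <- r | P i) F i) c = \sum_(i <- r | P i) dot (F i) c.
Proof. by rewrite /dot mulmx_suml summxE. Qed.
Lemma dot_sumr (I : Type) (r : seq I) (P : pred I) x F :
  dot x (\sum_(i <- r | P i) F i) = \sum_(i <- r | P i) dot x (F i).
Proof. by rewrite /dot mulmx_sumr summxE. Qed.

Lemma dot_tr_gt0 x : x != 0 -> 0 < dot x x^T.
Proof.
move=> /rV0Pn[k xk]; rewrite /dot mxE (bigD1 k) //= mxE -expr2 ltr_wpDr //.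
  by apply: sumr_ge0 => i _; rewrite mxE -expr2 sqr_ge0.
by rewrite exprn_even_gt0.
Qed.

(** Induction on the number of generators. If the functional [c] found for the others is positive on
    the first one, [w0], everything is projected along [w0] to the hyperplane [c = 0], where the
    induction hypothesis is applied again. *)
Lemma farkas n (w : 'I_n -> 'rV[R]_d) b :
  (exists2 l : 'I_n -> R, forall i, 0 <= l i & b = \sum_i l i *: w i) \/
  (exists2 c, forall i, dot (w i) c <= 0 & 0 < dot b c).
Proof.
elim: n w b => [|n IH] w b.
  have [->|b0] := eqVneq b 0; first by left; exists (fun=> 0) => //; rewrite big_ord0.
  by right; exists b^T => [[]//|]; exact: dot_tr_gt0.
pose w1 i := w (lift ord0 i); pose w0 := w ord0.
have [[l l0 bE]|[c cw cb]] := IH w1 b.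
  left; exists (fun i => if unlift ord0 i is Some j then l j else 0).
    by move=> i; case: unliftP.
  rewrite big_ord_recl unlift_none scale0r add0r bE.
  by apply: eq_bigr => i _; rewrite liftK.
have [cw0|cw0] := leP (dot w0 c) 0.
  by right; exists c => // i; case: (unliftP ord0 i) => [j|] ->; [apply: cw|].
pose q := dot w0 c.
have [[l l0 bE]|[c' cw' cb']] :=
    IH (fun i => q *: w1 i - dot (w1 i) c *: w0) (q *: b - dot b c *: w0).
  (* Undoing the projection puts all corrections on [w0]; their total [s] is nonnegative since [c]
     is positive on [b] and nonpositive on each [w1 i]. *)
  left; pose s := dot b c - \sum_i l i * dot (w1 i) c.
  exists (fun i => if unlift ord0 i is Some j then l j else q^-1 * s).
    move=> i; case: unliftP => // _; apply: mulr_ge0; first by rewrite invr_ge0 ltW.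
    rewrite subr_ge0; apply: le_trans (ltW cb).
    by apply: sumr_le0 => j _; apply: mulr_ge0_le0.
  rewrite big_ord_recl unlift_none.
  under eq_bigr do rewrite liftK.
  have q0 : q != 0 by rewrite gt_eqF.
  apply: (scalerI q0); rewrite scalerDr !scalerA mulVKf // -/w0.
  have -> : q *: b = dot b c *: w0 + \sum_i l i *: (q *: w1 i - dot (w1 i) c *: w0).
    by rewrite -bE addrC subrK.
  have -> : \sum_i l i *: (q *: w1 i - dot (w1 i) c *: w0) =
      q *: (\sum_i l i *: w1 i) - (\sum_i l i * dot (w1 i) c) *: w0.
    rewrite scaler_sumr scaler_suml -sumrB; apply: eq_bigr => i _.
    by rewrite scalerBr !scalerA mulrC.
  by rewrite /s scalerBl -addrA [- _ + _]addrC.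
(* The correction makes the functional vanish on [w0]; on [w1 i] and on [b] it takes the values of
   [c'] at their projections. *)
right; exists (q *: c' - dot w0 c' *: c) => [i|].
  case: (unliftP ord0 i) => [j|] ->; rewrite dotBr !dotZr -/w0.
    have := cw' j; rewrite dotBl !dotZl /w1; lra.
  by rewrite -/q mulrC subrr.
by move: cb'; rewrite dotBl !dotZl dotBr !dotZr; lra.
Qed.
End Farkas.

Section Faces.
Variables (R : realType) (d m : nat) (v : 'I_m -> 'rV[R]_d).
Implicit Types (A B G : {set 'I_m}) (a : 'I_m -> R) (b : R) (x y : 'rV[R]_d).

(** Faces are encoded by the indices of all generators on them, which makes them a finite type. The
    generators may repeat or fail to be vertices. *)
Definition exposed A (c : 'cV[R]_d) b :=
  (forall i, dot (v i) c <= b) /\ forall i, (i \in A) = (dot (v i) c == b).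

Definition is_face A := A != finset.set0 /\ exists c b, exposed A c b.

Definition weights A a := [/\ forall i, 0 <= a i, forall i, i \notin A -> a i = 0 & \sum_i a i = 1].

Definition comb a : 'rV[R]_d := \sum_i a i *: v i.

Definition hullA A : set 'rV[R]_d := [set x | exists2 a, weights A a & x = comb a].

(** For faces [A] these are the relative interiors, and they partition the polytope by [relint_inj]
    and [relint_cover]. *)
Definition relint A : set 'rV[R]_d :=
  [set x | exists a, [/\ weights A a, forall i, i \in A -> 0 < a i & x = comb a]].

Lemma relint_hullA A B x : A \subset B -> relint A x -> hullA B x.
Proof.
move=> /fintype.subsetP AB [a [[a0 aA a1] _ ->]]; exists a => //; split=> // i iB.
by apply: aA; apply: contra iB => /AB.
Qed.

Lemma dot_comb a c : dot (comb a) c = \sum_i a i * dot (v i) c.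
Proof. by rewrite /comb dot_suml; apply: eq_bigr => i _; rewrite dotZl. Qed.

Lemma dot_comb_face A a c b : (forall i, i \in A -> dot (v i) c = b) ->
  weights A a -> dot (comb a) c = b.
Proof.
move=> Ab [_ aA a1]; rewrite dot_comb -[RHS]mul1r -a1 mulr_suml.
by apply: eq_bigr => i _; have [/Ab->//|/aA->] := boolP (i \in A); rewrite !mul0r.
Qed.

(** A combination with positive weights attains the maximum of a functional only if every generator
    involved does. *)
Lemma exposed_hullA_sub A B c b x : exposed B c b -> relint A x -> dot x c = b -> A \subset B.
Proof.
move=> [vb BE] [a [[a0 aA a1] apos ->]] xb; apply/fintype.subsetP => i iA.
rewrite BE eq_le vb /= leNgt; apply/negP => lt.
have : \sum_j a j * (b - dot (v j) c) = 0.
  under eq_bigr do rewrite mulrBr.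
  by rewrite sumrB -mulr_suml a1 mul1r -dot_comb xb subrr.
apply/eqP; rewrite gt_eqF // (bigD1 i) //= ltr_pwDl //.
  by apply: mulr_gt0; [exact: apos|rewrite subr_gt0].
by apply: sumr_ge0 => j _; apply: mulr_ge0 => //; rewrite subr_ge0.
Qed.

Lemma relint_face_sub A B x : is_face B -> relint A x -> hullA B x -> A \subset B.
Proof.
move=> [_ [c [b cb]]] Ax [a wa xE]; apply: (exposed_hullA_sub cb Ax).
rewrite xE; apply: dot_comb_face wa => i iB.
by apply/eqP; case: cb => _ <-.
Qed.

Lemma relint_inj A B x : is_face A -> is_face B -> relint A x -> relint B x -> A = B.
Proof.
move=> fA fB Ax Bx; apply/eqP; rewrite finset.eqEsubset; apply/andP; split.
  exact: relint_face_sub fB Ax (relint_hullA (subxx _) Bx).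
exact: relint_face_sub fA Bx (relint_hullA (subxx _) Ax).
Qed.

(* The face whose relative interior contains [x] consists of the vertices which
   have a positive coefficient in some representation of [x]; by Farkas' lemma it
   is exposed. *)
Lemma relint_cover x : hullA finset.setT x -> exists2 A, is_face A & relint A x.
Proof.
move=> [a0 [a0_ge0 _ a0_sum] xE].
pose rep a := [/\ forall i, 0 <= a i, \sum_i a i = 1 & x = comb a].
pose Pos i := exists2 a, rep a & 0 < a i.
pose A := [set i | `[< Pos i >]]%SET.
have AP i : i \in A <-> Pos i by rewrite inE; split=> [/asboolP|?]; last exact/asboolP.
have m0 : (0 < m)%N.
  by case: (m) a0 a0_sum {a0_ge0 xE} => // a0; rewrite big_ord0 => /eqP; rewrite eq_sym oner_eq0.
have /choice[r rP] i : exists a, rep a /\ (i \in A -> 0 < a i).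
  have [/AP[a ra ai]|iA] := boolP (i \in A); first by exists a.
  by exists a0.
(* The average of one representation for each index is positive on all of [A] at once. *)
pose a i := m%:R^-1 * \sum_j r j i.
have mR0 : 0 < m%:R :> R by rewrite ltr0n.
have m_neq0 : m%:R != 0 :> R by rewrite gt_eqF.
have a_ge0 i : 0 <= a i.
  apply: mulr_ge0; first by rewrite invr_ge0 ltW.
  by apply: sumr_ge0 => j _; have [[]] := rP j.
have ra : rep a.
  split=> //.
    rewrite -mulr_sumr exchange_big /=; apply: (canLR (mulKf m_neq0)).
    rewrite mulr1; under eq_bigr => j _ do (have [[_ -> _] _] := rP j).
    by rewrite sumr_const card_ord.
  apply: (scalerI m_neq0).
  rewrite /comb scaler_sumr; under eq_bigr do rewrite scalerA mulVKf ?gt_eqF // scaler_suml.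
  rewrite exchange_big /= -[in LHS](card_ord m) -sumr_const scaler_suml.
  by apply: eq_bigr => j _; have [[_ _ xj] _] := rP j; rewrite scale1r {1}xj.
have a_pos i : i \in A -> 0 < a i.
  move=> iA; apply: mulr_gt0; first by rewrite invr_gt0.
  rewrite (bigD1 i) //= ltr_pwDl //; first by have [_ ->] := rP i.
  by apply: sumr_ge0 => j _; have [[]] := rP j.
have a_out i : i \notin A -> a i = 0.
  move=> iA; apply/eqP; rewrite eq_le a_ge0 leNgt andbT; apply/negP => ai.
  by case/negP: iA; apply/AP; exists a.
have Ax : relint A x by exists a; case: ra.
exists A => //; split.
  apply/negP => /eqP A0; have [_ + _] := ra.
  rewrite big1 => [/eqP|i _]; first by rewrite eq_sym oner_eq0.
  by apply: a_out; rewrite A0 inE.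
(* For [i] outside [A], Farkas separates [- (v i - x)] from the vectors [v j - x]; otherwise [x]
   would have a representation with positive weight at [i]. The sum [C] of these functionals exposes
   [A]. *)
have /choice[c cP] i : exists c : 'cV[R]_d,
    (forall j, dot (v j - x) c <= 0) /\ (i \notin A -> dot (v i - x) c < 0).
  have [iA|iA] := boolP (i \in A).
    by exists 0; split=> // j; rewrite /dot mulmx0 mxE.
  have [[l l0 lE]|[c cw cb]] := farkas (fun j => v j - x) (- (v i - x)); last first.
    by exists c; split=> // _; rewrite dotNl oppr_gt0 in cb.
  case/negP: iA; apply/AP.
  pose s := 1 + \sum_j l j.
  have s0 : 0 < s by apply: ltr_pwDl => //; apply: sumr_ge0.
  exists (fun j => s^-1 * ((j == i)%:R + l j)); last first.
    by apply: mulr_gt0; rewrite ?invr_gt0 // eqxx ltr_pwDl.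
  split.
  - by move=> j; apply: mulr_ge0; rewrite ?invr_ge0 ?(ltW s0) // addr_ge0.
  - rewrite -mulr_sumr big_split /= (bigD1 i) //= eqxx big1 => [|j /negPf->//].
    by rewrite addr0 -/s mulVf ?gt_eqF.
  have s_neq0 : s != 0 by rewrite gt_eqF.
  apply: (scalerI s_neq0); rewrite /comb scaler_sumr.
  under eq_bigr do rewrite scalerA mulVKf // scalerDl.
  rewrite big_split /= (bigD1 i) //= eqxx scale1r big1 => [|j /negPf->]; last by rewrite scale0r.
  rewrite addr0 /s scalerDl scale1r.
  have : - (v i - x) = \sum_j l j *: v j - (\sum_j l j) *: x.
    by rewrite lE scaler_suml -sumrB; apply: eq_bigr => j _; rewrite scalerBr.
  rewrite opprB => e; rewrite -[\sum_j l j *: v j](subrK ((\sum_j l j) *: x)) -e.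
  by rewrite addrA [v i + _]addrC subrK.
pose C := \sum_i c i.
have CP j : dot (v j - x) C <= 0.
  by rewrite dot_sumr; apply: sumr_le0 => i _; have [->] := cP i.
exists C, (dot x C); split=> i; first by have := CP i; rewrite dotBl; lra.
have [iA|iA] := boolP (i \in A); last first.
  apply/esym/negP => /eqP e; have : dot (v i - x) C < 0; last by rewrite dotBl e subrr ltxx.
  rewrite dot_sumr (bigD1 i) //= ltr_nwDl //; first by have [_ ->] := cP i.
  by apply: sumr_le0 => j _; have [->] := cP j.
apply/esym/eqP; have := CP i; rewrite dotBl => le.
have : \sum_j a j * (dot x C - dot (v j) C) = 0.
  have [_ a1 ax] := ra; under eq_bigr do rewrite mulrBr.
  by rewrite sumrB -mulr_suml a1 mul1r -dot_comb -ax subrr.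
move=> /eqP; rewrite psumr_eq0 => [/allP/(_ i)|j _]; last first.
  by apply: mulr_ge0 => //; have := CP j; rewrite dotBl; lra.
by rewrite mem_index_enum mulf_eq0 gt_eqF ?a_pos //= subr_eq0 => /(_ isT)/eqP.
Qed.

End Faces.

(** * Dimension of faces and Euler's formula *)

Section FaceDimension.
Variables (R : realType) (d m : nat) (v : 'I_m -> 'rV[R]_d).
Implicit Types (A B G : {set 'I_m}) (a : 'I_m -> R) (b : R) (x y : 'rV[R]_d).

Definition dirmx A : 'M[R]_(m, d) := if [pick i in A] is Some i0 then
  \matrix_i (if i \in A then v i - v i0 else 0) else 0.

Definition dimA A := \rank (dirmx A).

Lemma comb_dirmx A a : (forall i, i \notin A -> a i = 0) -> \sum_i a i = 0 ->
  (comb v a <= dirmx A)%MS.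
Proof.
move=> aA a0; rewrite /dirmx; case: pickP => [i0 i0A|A0]; last first.
  by rewrite /comb big1 ?sub0mx // => i _; rewrite aA ?scale0r // A0.
apply/submxP; exists (\row_i a i).
rewrite mulmx_sum_row; transitivity (comb v a - (\sum_i a i) *: v i0).
  by rewrite a0 scale0r subr0.
rewrite scaler_suml /comb -sumrB; apply: eq_bigr => i _; rewrite rowK mxE -scalerBr.
by case: ifPn => // /aA->; rewrite !scale0r.
Qed.

Lemma dirmx_comb A u : (u <= dirmx A)%MS ->
  exists a, [/\ forall i, i \notin A -> a i = 0, \sum_i a i = 0 & u = comb v a].
Proof.
rewrite /dirmx; case: pickP => [i0 i0A|A0] /submxP[D ->]; last first.
  by exists (fun=> 0); split=> //; rewrite ?big1 // mulmx0 /comb big1 // => i _; rewrite scale0r.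
pose s := \sum_(i in A) D 0 i.
exists (fun i => (if i \in A then D 0 i else 0) - (if i == i0 then s else 0)); split.
- by move=> i iA; rewrite (negPf iA); case: eqP => [e|]; [rewrite e i0A in iA|rewrite subr0].
- by rewrite sumrB -!big_mkcond big_pred1_eq subrr.
rewrite mulmx_sum_row /comb.
under [RHS]eq_bigr do rewrite scalerBl.
rewrite sumrB [X in _ = _ - X](bigD1 i0) //= eqxx [X in _ = _ - (_ + X)]big1 => [|i /negPf->]; last first.
  by rewrite scale0r.
rewrite addr0 /s scaler_suml [X in _ = _ - X]big_mkcond -sumrB; apply: eq_bigr => i _.
by rewrite rowK; case: ifP; rewrite ?scaler0 ?scale0r ?subr0 ?scalerBr.
Qed.

Lemma comb_delta i : comb v (fun k => (k == i)%:R) = v i.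
Proof.
rewrite /comb (bigD1 i) //= eqxx scale1r big1 ?addr0 // => k /negPf->.
by rewrite scale0r.
Qed.

Lemma combB a a' : comb v (fun i => a i - a' i) = comb v a - comb v a'.
Proof. by rewrite /comb -sumrB; apply: eq_bigr => i _; rewrite scalerBl. Qed.

Lemma combD a a' : comb v (fun i => a i + a' i) = comb v a + comb v a'.
Proof. by rewrite /comb -big_split; apply: eq_bigr => i _; rewrite scalerDl. Qed.

Lemma combZ b a : comb v (fun i => b * a i) = b *: comb v a.
Proof. by rewrite /comb scaler_sumr; apply: eq_bigr => i _; rewrite scalerA. Qed.

Lemma dirmx_sub A i j : i \in A -> j \in A -> (v i - v j <= dirmx A)%MS.
Proof.
move=> iA jA; rewrite -!comb_delta -combB; apply: comb_dirmx => [k kA|].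
  have [ki kj] : k == i = false /\ k == j = false.
    by split; apply: contraNF kA => /eqP->.
  by rewrite ki kj subrr.
have sum1 l : \sum_k (k == l)%:R = 1 :> R.
  by rewrite (bigD1 l) //= eqxx big1 ?addr0 // => k /negPf->.
by rewrite sumrB !sum1 subrr.
Qed.

Lemma dirmxS A B : A \subset B -> (dirmx A <= dirmx B)%MS.
Proof.
move=> /fintype.subsetP AB; apply/row_subP => i; have [a [aA a0 ->]] := dirmx_comb (row_sub i (dirmx A)).
by apply: comb_dirmx => // k kB; apply: aA; apply: contra kB => /AB.
Qed.

Lemma dot_dirmx A c b u : (forall i, i \in A -> dot (v i) c = b) -> (u <= dirmx A)%MS ->
  dot u c = 0.
Proof.
move=> Ab /dirmx_comb[a [aA a0 ->]]; rewrite dot_comb.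
transitivity (\sum_i a i * b); last by rewrite -mulr_suml a0 mul0r.
by apply: eq_bigr => i _; have [/Ab->//|/aA->] := boolP (i \in A); rewrite !mul0r.
Qed.

(** The functional exposing [A] is zero on the directions of [A] but not on a direction from [A] to
    a generator in [B] outside [A]. *)
Lemma face_dim_lt A B : is_face v A -> A \proper B -> (dimA A < dimA B)%N.
Proof.
move=> [A0 [c [b [vb AE]]]] /fintype.properP[AB [i iB iA]].
have le := dirmxS AB; rewrite ltnNge; apply/negP => ge.
have : (dirmx B <= dirmx A)%MS.
  by rewrite -(mxrank_leqif_sup le).2 eqn_leq ge mxrankS.
have /set0Pn[j jA] := A0.
move=> /(submx_trans (dirmx_sub iB (fintype.subsetP AB _ jA)))/(dot_dirmx (b := b)) e.
have : dot (v i - v j) c = 0 by apply: e => k; rewrite AE => /eqP.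
rewrite dotBl => /eqP; rewrite subr_eq0; move: jA iA; rewrite !AE => /eqP ->.
by move/negP.
Qed.

Lemma hullA_cl B : cl_type (hullA v B).
Proof.
pose M : 'M[R]_(m, d) := \matrix_i v i.
pose L : 'M[R]_m := \matrix_(i, j) ((i == j) && (i \notin B))%:R.
exists m, m, M, L, 0 => x.
have LE (a : 'rV[R]_m) j : (a *m L) 0 j = if j \in B then 0 else a 0 j.
  rewrite mxE (bigD1 j) //= mxE eqxx /= big1 => [|i /negPf ne].
    by case: ifP => _; rewrite ?mulr0 ?mulr1 addr0.
  by rewrite mxE ne mulr0.
have ME (a : 'rV[R]_m) : a *m M = comb v (a 0).
  by rewrite mulmx_sum_row; apply: eq_bigr => i _; rewrite rowK.
split=> [[a [a0 aB a1] ->]|[a [a0 a1 aL] ->]].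
  exists (\row_i a i); last by rewrite ME; apply: eq_bigr => i _; rewrite mxE.
  split=> [i||]; first by rewrite mxE.
    by rewrite -a1; apply: eq_bigr => i _; rewrite mxE.
  by apply/rowP => j; rewrite LE !mxE; case: ifPn => // /aB.
exists (a 0); last exact: ME.
split=> // i iB; have := LE a i; rewrite aL mxE (negPf iB).
by move=> <-.
Qed.

Lemma weights_convex A a a' t : weights A a -> weights A a' -> 0 <= t <= 1 ->
  weights A (fun i => t * a i + (1 - t) * a' i).
Proof.
move=> [a0 aA a1] [a0' aA' a1'] /andP[t0 t1]; split=> [i|i iA|].
- by rewrite addr_ge0 // mulr_ge0 // subr_ge0.
- by rewrite aA // aA' // !mulr0 addr0.
- by rewrite big_split /= -!mulr_sumr a1 a1'; lra.
Qed.

Lemma weights_le1 A a i : weights A a -> a i <= 1.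
Proof. by move=> [a0 _ <-]; rewrite (bigD1 i) //= lerDl sumr_ge0. Qed.

Lemma relint_op A : op_type (dimA A) (relint v A).
Proof.
split.
- exists m, (dirmx A); split=> //.
    move=> x y [a [[a0 aA a1] _ ->]] [a' [[a0' aA' a1'] _ ->]].
    rewrite -combB; apply: comb_dirmx => [i iA|]; first by rewrite aA // aA' // subrr.
    by rewrite sumrB a1 a1' subrr.
  move=> x u [a [[a0 aA a1] apos ->]] /dirmx_comb[w [wA w0 ->]].
  (* With this step the weights [a + e w] stay positive on [A]; the added 1 keeps the denominators
     nonzero. *)
  have [|e e0 eP] := @pos_lower_bound R [seq a i / (`|w i| + 1) | i <- enum A].
    move=> _ /mapP[i iA ->]; apply: divr_gt0; first by apply: apos; rewrite mem_enum in iA.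
    by rewrite ltr_pwDr.
  have pos i : i \in A -> 0 < a i + e * w i.
    move=> iA; have : e < a i / (`|w i| + 1).
      by apply: eP; apply/mapP; exists i; rewrite ?mem_enum.
    have w1 : 0 < `|w i| + 1 by rewrite ltr_pwDr.
    rewrite ltr_pdivlMr // => lt.
    have := ler_norm (- w i); rewrite normrN => le.
    have : e * - w i <= e * `|w i| by rewrite ler_pM2l.
    by rewrite mulrDr in lt; lra.
  exists e => //; exists (fun i => a i + e * w i); split=> //; last by rewrite combD combZ.
  split=> [i|i iA|]; last by rewrite big_split /= -mulr_sumr w0 a1 mulr0 addr0.
    have [iA|iA] := boolP (i \in A); first exact/ltW/pos.
    by rewrite aA // wA // mulr0 addr0 lexx.
  by rewrite aA // wA // mulr0 addr0.
- move=> x y t [a [wa apos ->]] [a' [wa' apos' ->]] t01.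
  exists (fun i => t * a i + (1 - t) * a' i); split.
  + exact: weights_convex.
  + move=> i iA; have /andP[t0 t1] := t01.
    have [->|t_neq0] := eqVneq t 0; first by rewrite mul0r add0r subr0 mul1r apos'.
    apply: ltr_pwDl; first by apply: mulr_gt0; rewrite ?apos // lt_neqAle eq_sym t_neq0.
    by apply: mulr_ge0; rewrite ?subr_ge0 // ltW // apos'.
  + by rewrite combD !combZ.
- exists (\sum_i \sum_k `|v i 0 k|) => x k [a [wa _ ->]].
  rewrite summxE; apply: le_trans (ler_norm_sum _ _ _) _; apply: ler_sum => i _.
  rewrite mxE normrM.
  apply: (@le_trans _ _ `|v i 0 k|); last by rewrite (bigD1 k) //= lerDl sumr_ge0.
  rewrite -[leRHS]mul1r ler_wpM2r // ger0_norm; first exact: weights_le1 wa.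
  by case: wa.
Qed.

Definition faceb A := `[< is_face v A >].

Lemma relint0 A : A != finset.set0 -> (relint v A !=set0)%classic.
Proof.
move=> A0; have cA : 0 < #|A|%:R :> R by rewrite ltr0n card_gt0.
exists (comb v (fun i => if i \in A then #|A|%:R^-1 else 0)).
exists (fun i => if i \in A then #|A|%:R^-1 else 0); split=> //; last first.
  by move=> i ->; rewrite invr_gt0.
split=> [i|i /negPf->//|].
  by case: ifP => // _; rewrite invr_ge0 ltW.
by rewrite -big_mkcond sumr_const -(mulr_natl (_^-1)) mulfV ?gt_eqF.
Qed.

Lemma hullA_cover B x : is_face v B -> hullA v B x ->
  exists2 A, is_face v A & A \subset B /\ relint v A x.
Proof.
move=> fB Bx; have [|A fA Ax] := @relint_cover _ _ _ v x.
  by have [a [a0 aB a1] xE] := Bx; exists a => //; split=> // i; rewrite inE.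
by exists A => //; split=> //; exact: relint_face_sub fB Ax Bx.
Qed.

Lemma sum_option (T : finType) (F : option T -> rat) :
  \sum_o F o = F None + \sum_x F (Some x).
Proof.
rewrite (bigD1 None) //=; congr (_ + _).
rewrite (reindex_omap Some id) /=; last by case.
by apply: eq_bigl => x; rewrite eqxx.
Qed.

(** The indicator function of the hull of [B], cut by [H], is the sum of those of the relative
    interiors of its faces, cut by [H]. In the proof [None] stands for the hull, and index sets that
    are not faces of [B] get the empty set. *)
Lemma valuation_faces (B : {set 'I_m}) (H : set 'rV[R]_d) (k : rat) (c : {set 'I_m} -> rat) :
  is_face v B ->
  euler_char (hullA v B `&` H)%classic k ->
  (forall A, is_face v A -> A \subset B -> euler_char (relint v A `&` H)%classic (c A)) ->
  \sum_(A | faceb A && (A \subset B)) c A = k.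
Proof.
move=> fB eB eA.
pose P A := faceb A && (A \subset B).
pose S (o : option {set 'I_m}) : set 'rV[R]_d := if o is Some A then
  (if P A then relint v A `&` H else set0)%classic else (hullA v B `&` H)%classic.
pose chi (o : option {set 'I_m}) : rat := if o is Some A then (if P A then c A else 0) else k.
pose n (o : option {set 'I_m}) : rat := if o is Some A then -1 else 1.
have := @euler_char_valuation R d _ n chi S.
rewrite !sum_option /= mul1r.
under eq_bigr do rewrite mulN1r.
rewrite sumrN -big_mkcond => val; apply/eqP; rewrite eq_sym -subr_eq0; apply/eqP/val.
  case=> [A|] //=; case: ifP => [/andP[/asboolP fA AB]|_]; first exact: eA.
  by apply: Or31; split=> // x [].
move=> x; rewrite sum_option /= mul1r.
under eq_bigr do rewrite mulN1r.
rewrite sumrN; apply/eqP; rewrite subr_eq0; apply/eqP.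
transitivity (\sum_(A : {set 'I_m}) if P A && `[< relint v A x /\ H x >] then 1 else 0 : rat);
  last first.
  by apply: eq_bigr => A _; case: (P A) => //=; rewrite asboolF.
case: asboolP => [[Bx Hx]|nB].
  have [A fA [AB Ax]] := hullA_cover fB Bx.
  rewrite (bigD1 A) //= /P /faceb AB !asboolT //= big1 ?addr0 // => A' neA.
  case: ifP => // /andP[/andP[/asboolP fA' _] /asboolP[A'x _]].
  by case/eqP: neA; exact: relint_inj fA' fA A'x Ax.
rewrite big1 // => A _; case: ifP => // /andP[/andP[_ AB] /asboolP[Ax Hx]].
by case: nB; split=> //; exact: relint_hullA Ax.
Qed.

Lemma face_euler B : is_face v B ->
  \sum_(A | faceb A && (A \subset B)) (-1) ^+ dimA A = 1 :> rat.
Proof.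
move=> fB; apply: (@valuation_faces B setT) => //.
  rewrite setIT; apply: Or32; split=> //; last exact: hullA_cl.
  by have [x Bx] := relint0 fB.1; exists x; exact: relint_hullA Bx.
move=> A fA _; rewrite setIT; apply: Or33; exists (dimA A); split=> //; last exact: relint_op.
by apply: relint0; case: fA.
Qed.

End FaceDimension.

(** * Euler's formula for intervals of faces *)

Section FaceIntervals.
Variables (R : realType) (d m : nat) (v : 'I_m -> 'rV[R]_d).
Implicit Types (A B G K : {set 'I_m}) (a : 'I_m -> R) (b : R) (x y : 'rV[R]_d).

Lemma face_setI A B : is_face v A -> is_face v B -> A :&: B != finset.set0 ->
  is_face v (A :&: B).
Proof.
move=> [_ [c [b [cb cA]]]] [_ [c' [b' [cb' cB]]]] AB0; split=> //.
exists (c + c'), (b + b'); split=> i; rewrite dotDr; first exact: lerD.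
rewrite finset.in_setI cA cB; have := cb i; have := cb' i => le' le.
by apply/andP/eqP => [[/eqP-> /eqP->//]|e]; split; apply/eqP; lra.
Qed.

Lemma cl_type_section (C : set 'rV[R]_d) (c : 'cV[R]_d) b :
  cl_type C -> cl_type (C `&` [set x | dot x c = b])%classic.
Proof.
move=> [n [p [M [L [l CE]]]]].
exists n, (p + 1)%N, M, (row_mx L (M *m c)), (row_mx l b%:M) => x.
split=> [[/CE[a [a0 a1 aL] ->] /= e]|[a [a0 a1 aL] ->]].
  exists a => //; split=> //; rewrite mul_mx_row aL; congr row_mx.
  by rewrite mulmxA [LHS]mx11_scalar -[X in X%:M]/(dot _ _) e.
move: aL; rewrite mul_mx_row => /eq_row_mx[aL e]; split; first by apply/CE; exists a.
by rewrite /= /dot -mulmxA e mxE eqxx mulr1n.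
Qed.

(** The hyperplane supporting [G] is pushed into [B] by a small [eta]. It misses the faces disjoint
    from [G] and those inside [G]; the other faces are cut transversally and lose one dimension,
    while the section of [B] is closed and has Euler characteristic 1. *)
Lemma face_section_euler B G : is_face v B -> is_face v G -> G \proper B ->
  \sum_(A | faceb v A && (A \subset B))
    (if (A :&: G != finset.set0) && ~~ (A \subset G) then (-1) ^+ (dimA v A).-1 else 0) = 1 :> rat.
Proof.
move=> fB fG /fintype.properP[GB [i1 i1B i1G]].
have [G0 [c [b [vb GE]]]] := fG.
have m0 : 0 < m%:R :> R by rewrite ltr0n (leq_ltn_trans _ (ltn_ord i1)).
(* The division by [m] ensures that the barycenter of a face not inside [G] lies at or beyond the
   pushed hyperplane: it has weight at least 1/m at a generator off [G]. *)
have [|eta eta0 etaP] := @pos_lower_bound R [seq (b - dot (v i) c) / m%:R | i <- enum (~: G)].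
  move=> _ /mapP[i iG ->]; apply: divr_gt0 => //.
  by rewrite mem_enum finset.in_setC GE in iG; rewrite subr_gt0 lt_neqAle iG vb.
have gap i : i \notin G -> m%:R * eta < b - dot (v i) c.
  move=> iG; rewrite mulrC -ltr_pdivlMr //; apply: etaP; apply/mapP; exists i => //.
  by rewrite mem_enum finset.in_setC.
have m1 : 1 <= m%:R :> R by rewrite ler1n -(ltr0n R).
have gap1 i : i \notin G -> eta < b - dot (v i) c.
  move=> /gap; apply: le_lt_trans; rewrite -[leLHS]mul1r ler_pM2r //.
pose H : set 'rV[R]_d := [set x | dot x c = b - eta]%classic.
apply: (@valuation_faces _ _ _ v B H) => //.
  apply: Or32; split=> //; last by apply: cl_type_section; exact: hullA_cl.
  have /set0Pn[g gG] := G0.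
  have dg : dot (v g) c = b by apply/eqP; rewrite -GE.
  have gB : g \in B := fintype.subsetP GB _ gG.
  have g1 := gap1 _ i1G.
  pose t := eta / (b - dot (v i1) c).
  have w1 k : k \in B -> weights B (fun i => (i == k)%:R : R).
    move=> kB; split=> [i|i iB|] //.
      by case: eqP iB => // ->; rewrite kB.
    by rewrite (bigD1 k) //= eqxx big1 ?addr0 // => i /negPf->.
  exists (comb v (fun i => t * (i == i1)%:R + (1 - t) * (i == g)%:R)); split.
    exists (fun i => t * (i == i1)%:R + (1 - t) * (i == g)%:R) => //.
    apply: weights_convex; try exact: w1.
    by rewrite /t ler_pdivrMr ?mul1r ?divr_ge0 //; lra.
  have tE : t * (b - dot (v i1) c) = eta by rewrite divfK // gt_eqF //; lra.
  by rewrite /H /= combD !combZ !comb_delta dotDl !dotZl dg; lra.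
move=> A fA AB.
have [AG0|AG0] := eqVneq (A :&: G) finset.set0.
  apply: Or31; split=> // x [[a [[a0 aA a1] _ ->]]]; rewrite /H /= dot_comb.
  apply/eqP; rewrite lt_eqF // -subr_gt0.
  have -> : b - eta - \sum_i a i * dot (v i) c = \sum_i a i * (b - eta - dot (v i) c).
    by under [RHS]eq_bigr do rewrite mulrBr; rewrite sumrB -mulr_suml a1 mul1r.
  have [A0 _] := fA; have pos i : i \in A -> 0 < b - eta - dot (v i) c.
    move=> iA; have iG : i \notin G.
      by apply/negP => iG; move: AG0 => /setP/(_ i); rewrite finset.in_setI iA iG inE.
    by have := gap1 _ iG; lra.
  have term i : 0 <= a i * (b - eta - dot (v i) c).
    have [/pos/ltW p|/aA->] := boolP (i \in A); last by rewrite mul0r.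
    exact: mulr_ge0.
  rewrite lt_neqAle sumr_ge0 // andbT eq_sym psumr_eq0 //.
  apply/negP => /allP z; have := oner_neq0 R; rewrite -a1 big1 ?eqxx // => i _.
  have [iA|/aA//] := boolP (i \in A).
  have := z i; rewrite mem_index_enum mulf_eq0 => /(_ isT)/orP[/eqP//|].
  by rewrite gt_eqF // pos.
have [AG|nAG] := boolP (A \subset G).
  apply: Or31; split=> // x [[a [wa _ ->]]]; rewrite /H /= (dot_comb_face _ wa (b := b)); first lra.
  by move=> i /(fintype.subsetP AG); rewrite GE => /eqP.
apply: Or33; exists (dimA v A).-1.
have [A0 _] := fA.
have /subsetPn[i2 i2A i2G] := nAG.
have /set0Pn[g] := AG0; rewrite finset.in_setI => /andP[gA gG].
have dg : dot (v g) c = b by apply/eqP; rewrite -GE.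
have cA : 0 < #|A|%:R :> R by rewrite ltr0n card_gt0.
pose q i : R := if i \in A then #|A|%:R^-1 else 0.
have wq : weights A q.
  split=> [i|i /negPf iA|]; rewrite /q ?iA //; first by case: ifP => // _; rewrite invr_ge0 ltW.
  by rewrite -big_mkcond sumr_const -(mulr_natl (_^-1)) mulfV ?gt_eqF.
pose be := dot (comb v q) c.
have be_eta : eta <= b - be.
  have -> : b - be = \sum_i q i * (b - dot (v i) c).
    under [RHS]eq_bigr do rewrite mulrBr; rewrite sumrB -mulr_suml.
    by have [_ _ ->] := wq; rewrite mul1r /be dot_comb.
  rewrite (bigD1 i2) //= ler_wpDr //.
    apply: sumr_ge0 => i _; apply: mulr_ge0; last by rewrite subr_ge0.
    by have [] := wq.
  rewrite /q i2A mulrC ler_pdivlMr //.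
  apply: (le_trans _ (ltW (gap _ i2G))); rewrite mulrC ler_pM2r // ler_nat.
  by rewrite -[X in (_ <= X)%N](card_ord m) max_card.
have be_b : 0 < b - be by apply: lt_le_trans be_eta.
pose t := eta / (b - be).
have t01 : 0 <= t <= 1.
  by rewrite /t ler_pdivrMr // mul1r be_eta divr_ge0 // ltW.
have t0 : 0 < t by rewrite divr_gt0.
have neA : ((relint v A `&` H) !=set0)%classic.
  exists (comb v (fun i => t * q i + (1 - t) * (i == g)%:R)); split.
    exists (fun i => t * q i + (1 - t) * (i == g)%:R); split=> //.
      apply: weights_convex => //; split=> [i|i iA|] //.
        by case: eqP iA => // ->; rewrite gA.
      by rewrite (bigD1 g) //= eqxx big1 ?addr0 // => i /negPf->.
    move=> i iA; rewrite ltr_pwDl //; last by rewrite mulr_ge0 // subr_ge0; case/andP: t01.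
    by rewrite mulr_gt0 // /q iA invr_gt0.
  have tE : t * (b - be) = eta by rewrite divfK // gt_eqF.
  by rewrite /H /= combD !combZ comb_delta dotDl !dotZl dg -/be; lra.
have [x [Ax xH]] := neA.
(* Transversality: if the barycenter lies on the hyperplane, its midpoint with the generator [g] of
   [G] does not. *)
suff neH : exists2 y, relint v A y & (y *m c) 0 0 != b - eta.
  have hx : exists2 x, relint v A x & (x *m c) 0 0 = b - eta by exists x.
  have [_ oA] := op_type_section (relint_op v A) hx neH.
  by split=> //=; rewrite ?AG0 ?nAG.
have qA (y' : 'I_m -> R) : weights A y' -> (forall i, i \in A -> 0 < y' i) -> relint v A (comb v y').
  by move=> *; exists y'.
have [e|ne] := eqVneq (dot (comb v q) c) (b - eta); last first.
  by exists (comb v q) => //; apply: qA => // i iA; rewrite /q iA invr_gt0.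
pose q' i := 2^-1 * q i + (1 - 2^-1) * (i == g)%:R.
have h01 : 0 <= (2^-1 : R) <= 1 by apply/andP; split; lra.
exists (comb v q').
  apply: qA.
    apply: weights_convex => //; split=> [i|i iA|] //.
      by case: eqP iA => // ->; rewrite gA.
    by rewrite (bigD1 g) //= eqxx big1 ?addr0 // => i /negPf->.
  move=> i iA; rewrite ltr_pwDl //; last by rewrite mulr_ge0 // subr_ge0; case/andP: h01.
  by rewrite mulr_gt0 // /q ?iA ?invr_gt0.
rewrite -[X in X != _]/(dot _ _) combD !combZ comb_delta dotDl !dotZl dg e.
by apply/eqP; lra.
Qed.

(** The faces inside [G] contribute 1 by Euler's formula for [G]; the others that meet [G]
    contribute -1, by the section formula with dimensions raised by one. *)
Lemma face_meet_euler B G : is_face v B -> is_face v G -> G \proper B ->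
  \sum_(A | faceb v A && (A \subset B))
    (if A :&: G != finset.set0 then (-1) ^+ dimA v A else 0) = 0 :> rat.
Proof.
move=> fB fG GB; have := face_section_euler fB fG GB.
have := face_euler fG.
have dim_pos A : is_face v A -> A :&: G != finset.set0 -> ~~ (A \subset G) -> (0 < dimA v A)%N.
  move=> fA AG nAG; have fAG := face_setI fA fG AG.
  apply: leq_ltn_trans (leq0n _) (face_dim_lt fAG _).
  rewrite properE finset.subsetIl /=; apply: contra nAG => /fintype.subset_trans; apply.
  exact: finset.subsetIr.
have -> : \sum_(A | faceb v A && (A \subset B))
    (if (A :&: G != finset.set0) && ~~ (A \subset G) then (-1) ^+ (dimA v A).-1 else 0) =
    - \sum_(A | faceb v A && (A \subset B))
    (if (A :&: G != finset.set0) && ~~ (A \subset G) then (-1) ^+ dimA v A else 0) :> rat.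
  rewrite -sumrN; apply: eq_bigr => A /andP[/asboolP fA _].
  case: ifP => [/andP[AG nAG]|]; last by rewrite oppr0.
  by rewrite -[in RHS](prednK (dim_pos _ fA AG nAG)) exprS mulN1r opprK.
set S := \sum_(A | _) _; set T := \sum_(A | _) _; set U := \sum_(A | _) _ => S1 T1.
suff -> : U = S + T by lra.
have -> : S = \sum_(A | faceb v A && (A \subset B))
    (if A \subset G then (-1) ^+ dimA v A else 0) :> rat.
  rewrite -big_mkcondr; apply: eq_bigl => A; case: faceb => //=.
  have [AG|] := boolP (A \subset G); last by rewrite andbF.
  by rewrite (fintype.subset_trans AG (proper_sub GB)).
rewrite -big_split; apply: eq_bigr => A /andP[/asboolP [A0 _] _] /=.
have [AG|] := boolP (A \subset G); last by rewrite andbT add0r.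
by rewrite (finset.setIidPl AG) A0 /= addr0.
Qed.

(** Induction on [G]. The signed sum of [h K] over all faces [K] of [G] regroups by [A]: for each
    [A] meeting [G] the inner sum is Euler's formula for the face common to [A] and [G], so the
    total is the sum of [face_meet_euler]. By induction only the term of [G] itself is left. *)
Lemma face_interval_euler B G : is_face v B -> is_face v G -> G \proper B ->
  \sum_(A | faceb v A && ((G \subset A) && (A \subset B))) (-1) ^+ dimA v A = 0 :> rat.
Proof.
move=> fB; move: {2}#|G|.+1 (ltnSn #|G|) => n; elim: n G => // n IH G Gn fG GB.
pose h K : rat := \sum_(A | faceb v A && ((K \subset A) && (A \subset B))) (-1) ^+ dimA v A.
have : \sum_(K | faceb v K && (K \subset G)) (-1) ^+ dimA v K * h K = 0 :> rat.
  rewrite -[RHS](face_meet_euler fB fG GB); under eq_bigr do rewrite /h mulr_sumr.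
  rewrite (exchange_big_dep (fun A => faceb v A && (A \subset B))) /=; last first.
    by move=> K A _ /and3P[-> _ ->].
  apply: eq_bigr => A /andP[/asboolP fA AB]; case: ifPn => [AG|/negPn AG].
    rewrite -mulr_suml -[RHS]mul1r; congr (_ * _).
    rewrite -[RHS](face_euler (face_setI fA fG AG)).
    apply: eq_bigl => K; rewrite finset.subsetI AB /faceb (asboolT fA) /= andbT.
    by rewrite -andbA; congr (_ && _); rewrite andbC.
  apply: big_pred0 => K; apply/negP => /andP[/andP[/asboolP [K0 _] KG] /and3P[_ KA _]].
  case/negP: K0; rewrite -finset.subset0 -(eqP AG) finset.subsetI KA; exact: KG.
rewrite (bigD1 G) /=; last by rewrite /faceb asboolT //= fintype.subxx.
rewrite big1 ?addr0 => [/eqP|K /andP[/andP[/asboolP fK KG] KneG]].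
  by rewrite mulf_eq0 signr_eq0 => /eqP.
have KpG : K \proper G by rewrite finset.properEneq KneG.
rewrite [h K]IH ?mulr0 //; last exact: proper_trans KpG GB.
exact: leq_trans (proper_card KpG) Gn.
Qed.

End FaceIntervals.

(** * Existence of facets *)

Section Facets.
Variables (R : realType) (d m : nat) (v : 'I_m -> 'rV[R]_d).
Implicit Types (A B G K : {set 'I_m}) (a : 'I_m -> R) (b : R) (x y : 'rV[R]_d).

Lemma face_trans B c b : is_face v B -> (forall i, i \in B -> dot (v i) c <= b) ->
  [set i in B | dot (v i) c == b] != finset.set0 ->
  is_face v [set i in B | dot (v i) c == b].
Proof.
move=> [_ [cB [bB [vB BE]]]] vb A0; split=> //.
(* A multiple of [cB] large enough that its slack at every generator outside [B] outweighs the
   excess of [c] there. *)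
pose N := 1 + \sum_(i | i \notin B) `|dot (v i) c - b| / (bB - dot (v i) cB).
have pos i : i \notin B -> 0 < bB - dot (v i) cB.
  by rewrite BE subr_gt0 lt_neqAle vB andbT.
have term i : i \notin B -> 0 <= `|dot (v i) c - b| / (bB - dot (v i) cB).
  by move=> /pos p; apply: divr_ge0 => //; exact: ltW.
have out i : i \notin B -> dot (v i) (N *: cB + c) < N * bB + b.
  move=> iB; have p := pos _ iB.
  have : `|dot (v i) c - b| / (bB - dot (v i) cB) < N.
    rewrite /N (bigD1 i) //=; have : 0 <= \sum_(j | (j \notin B) && (j != i))
      `|dot (v j) c - b| / (bB - dot (v j) cB) by apply: sumr_ge0 => j /andP[/term].
    lra.
  rewrite ltr_pdivrMr // dotDr dotZr => lt.
  by have := ler_norm (dot (v i) c - b); lra.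
exists (N *: cB + c), (N * bB + b); split=> i.
  have [iB|/out/ltW//] := boolP (i \in B).
  have /eqP e : dot (v i) cB == bB by rewrite -BE.
  by rewrite dotDr dotZr e lerD2l vb.
rewrite !inE; have [iB|/out lt] := boolP (i \in B); last by rewrite (lt_eqF lt).
have /eqP e : dot (v i) cB == bB by rewrite -BE.
by rewrite dotDr dotZr e /= (inj_eq (addrI _)).
Qed.

Lemma dimA_gt0 B : (0 < dimA v B)%N -> exists i j, [/\ i \in B, j \in B & v i != v j].
Proof.
rewrite lt0n mxrank_eq0 /dirmx; case: pickP => [i0 i0B|]; last by rewrite eqxx.
move=> n0; apply/not_existsP => H; case/negP: n0; apply/eqP/row_matrixP => i.
rewrite rowK row0; case: ifP => // iB; apply/eqP; rewrite subr_eq0; apply/negPn/negP => ne.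
by apply: (H i); exists i0.
Qed.

Lemma proper_face_exists B : is_face v B -> (0 < dimA v B)%N ->
  exists2 A, is_face v A & A \proper B.
Proof.
move=> fB /dimA_gt0[i [j [iB jB ne]]].
pose c : 'cV[R]_d := (v i - v j)^T.
have cij : dot (v j) c < dot (v i) c.
  by rewrite -subr_gt0 -dotBl dot_tr_gt0 // subr_eq0.
have [k kB kmax] : exists2 k, k \in B & forall l, l \in B -> dot (v l) c <= dot (v k) c.
  by case: (Order.TotalTheory.arg_maxP (fun k => dot (v k) c) iB) => k kB kmax; exists k.
exists [set l in B | dot (v l) c == dot (v k) c].
  by apply: face_trans => //; apply/set0Pn; exists k; rewrite !inE kB /=.
apply/fintype.properP; split; first by apply/fintype.subsetP => l; rewrite inE => /andP[].
exists j => //; rewrite inE jB /=; apply/negP => /eqP e.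
by have := kmax _ iB; rewrite leNgt -e cij.
Qed.

(* If [A] has codimension at least [2] in [B], the hyperplane supporting [A] can be
   rotated about [A], keeping some vertex of [B] off it, until it meets [B] in a
   larger proper face. *)
Lemma face_between A B : is_face v A -> is_face v B -> A \proper B ->
  ((dimA v A).+1 < dimA v B)%N ->
  exists2 A', is_face v A' & (A \proper A') && (A' \proper B).
Proof.
move=> fA fB /fintype.properP[AB [i0 i0B i0A]] dAB.
have [/set0Pn[a aA] [cA [bA [vA AE]]]] := fA.
have aB := fintype.subsetP AB _ aA.
(* The rank of [W] is at most dim A + 1, less than dim B, so some functional kills [W] but is not
   constant on [B]. Being constant on [A] and [i0], it keeps [i0] off the rotated hyperplane. *)
pose W := col_mx (dirmx v A) (v i0 - v a).
have nBW : ~~ (dirmx v B <= W)%MS.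
  apply/negP => /mxrankS; rewrite leqNgt => /negP; apply; apply: leq_ltn_trans dAB.
  rewrite -addsmxE; apply: leq_trans (mxrank_adds_leqif _ _).1 _.
  by rewrite -/(dimA v A) -[X in (_ <= X)%N]addn1 leq_add2l rank_leq_row.
have [c [cW [i1 i1B i1a]]] : exists c : 'cV[R]_d, W *m c = 0 /\
    exists2 i, i \in B & dot (v i) c != dot (v a) c.
  move: nBW; rewrite submxE => /matrix0Pn[i [j nz]].
  exists (col j (cokermx W)); split.
    by rewrite colE mulmxA mulmx_coker mul0mx.
  have : dot (row i (dirmx v B)) (col j (cokermx W)) != 0.
    by rewrite /dot colE mulmxA -row_mul -colE !mxE; rewrite mxE in nz.
  rewrite /dirmx; case: pickP => [k kB|_]; last by rewrite row0 dot0l eqxx.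
  rewrite rowK; case: ifP => [iB|_]; last by rewrite dot0l eqxx.
  set c := col _ _; rewrite dotBl subr_eq0 => ne.
  have [ea|] := eqVneq (dot (v i) c) (dot (v a) c); last by exists i.
  by exists k => //; rewrite eq_sym -ea.
have dirA i : i \in A -> dot (v i) c = dot (v a) c.
  move=> iA; apply/eqP; rewrite -subr_eq0 -dotBl; apply/eqP.
  have /submxP[D ->] := dirmx_sub v iA aA.
  have e : dirmx v A *m c = 0.
    by have /(congr1 usubmx) := cW; rewrite mul_col_mx col_mxKu linear0.
  by rewrite /dot -mulmxA e mulmx0 mxE.
have di0 : dot (v i0) c = dot (v a) c.
  apply/eqP; rewrite -subr_eq0 -dotBl; apply/eqP.
  have e : (v i0 - v a) *m c = 0.
    by have /(congr1 dsubmx) := cW; rewrite mul_col_mx col_mxKd linear0.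
  by rewrite /dot e mxE.
wlog i1pos : c cW i1a dirA di0 / dot (v a) c < dot (v i1) c.
  move=> wl; have [lt|] := ltP (dot (v a) c) (dot (v i1) c); first exact: wl lt.
  rewrite le_eqVlt (negPf i1a) /= => lt; apply: (wl (- c)).
  - by rewrite mulmxN cW oppr0.
  - by rewrite !dotNr (inj_eq oppr_inj).
  - by move=> i iA; rewrite !dotNr dirA.
  - by rewrite !dotNr di0.
  - by rewrite !dotNr ltrN2.
pose P i := (i \in B) && (dot (v a) c < dot (v i) c).
(* The amount of rotation at which the hyperplane reaches the generator [i]; the smallest one
   supports [B]. *)
pose s i := (bA - dot (v i) cA) / (dot (v i) c - dot (v a) c).
have Pi1 : P i1 by rewrite /P i1B.
have [k [kB kpos] kmin] : exists2 k, k \in B /\ dot (v a) c < dot (v k) c &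
    forall l, P l -> s k <= s l.
  by case: (Order.TotalTheory.arg_minP s Pi1) => k /andP[kB kpos] kmin; exists k.
have s_ge0 : 0 <= s k by apply: divr_ge0; rewrite subr_ge0 ?vA // ltW.
pose c' := cA + s k *: c; pose b' := bA + s k * dot (v a) c.
have vb' i : i \in B -> dot (v i) c' <= b'.
  move=> iB; rewrite /c' /b' dotDr dotZr.
  have [ipos|ineg] := ltP (dot (v a) c) (dot (v i) c); last first.
    have : s k * dot (v i) c <= s k * dot (v a) c by rewrite ler_wpM2l.
    by have := vA i; lra.
  have := kmin i; rewrite /P iB ipos => /(_ isT).
  rewrite [s i]/s ler_pdivlMr ?subr_gt0 // mulrBr; lra.
have inA' i : i \in B -> dot (v i) c' == b' -> i \in [set i in B | dot (v i) c' == b'].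
  by move=> iB e; rewrite !inE iB.
have AA' : A \subset [set i in B | dot (v i) c' == b'].
  apply/fintype.subsetP => i iA; apply: inA'; first exact: fintype.subsetP AB _ iA.
  rewrite /c' /b' dotDr dotZr dirA //; have : i \in A by []; rewrite AE => /eqP->.
  by rewrite eqxx.
have kA' : k \in [set i in B | dot (v i) c' == b'].
  apply: inA' => //; apply/eqP; rewrite /c' /b' dotDr dotZr.
  have : s k * (dot (v k) c - dot (v a) c) = bA - dot (v k) cA.
    by rewrite /s divfK // subr_eq0 gt_eqF.
  by rewrite mulrBr; lra.
exists [set i in B | dot (v i) c' == b'].
  by apply: face_trans => //; apply/set0Pn; exists k.
apply/andP; split; apply/fintype.properP; split=> //.
- by exists k => //; apply/negP => /dirA e; rewrite e ltxx in kpos.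
- by apply/fintype.subsetP => i; rewrite inE => /andP[].
- exists i0 => //; rewrite inE i0B /= /c' /b' dotDr dotZr di0.
  by rewrite (inj_eq (addIr _)) -AE.
Qed.

(** A proper face of largest dimension has codimension 1, since otherwise [face_between] enlarges
    it. *)
Lemma facet_exists B : is_face v B -> (0 < dimA v B)%N ->
  exists2 A, is_face v A & (A \subset B) /\ (dimA v A).+1 = dimA v B.
Proof.
move=> fB dB; have [A0 fA0 A0B] := proper_face_exists fB dB.
have P0 : faceb v A0 && (A0 \proper B) by rewrite A0B /faceb asboolT.
case: (@arg_maxnP _ A0 (fun A => faceb v A && (A \proper B)) (dimA v) P0) => A.
move=> /andP[/asboolP fA AB] Amax; exists A => //; split; first exact: proper_sub.
apply/eqP; rewrite eqn_leq face_dim_lt //= leqNgt; apply/negP => lt.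
have [A' fA' /andP[AA' A'B]] := face_between fA fB AB lt.
have := Amax A'; rewrite /faceb asboolT // A'B => /(_ isT).
by move=> /(leq_trans (face_dim_lt fA AA')); rewrite ltnn.
Qed.

End Facets.

Section FacePoset.
Variables (R : realType) (d m : nat) (v : 'I_m -> 'rV[R]_d).
Hypothesis m_gt0 : (0 < m)%N.

Definition face_set := {A : {set 'I_m} | faceb v A}.
HB.instance Definition _ := Finite.on face_set.
Definition face_set_le (A B : face_set) := val A \subset val B.
Definition face_set_dim (A : face_set) := dimA v (val A).

Lemma face_setP (A : face_set) : is_face v (val A).
Proof. by have /asboolP := valP A. Qed.

Lemma face_setT : faceb v finset.setT.
Proof.
apply/asboolP; split; first by apply/set0Pn; exists (Ordinal m_gt0).
by exists 0, 0; split=> i; rewrite /dot mulmx0 mxE ?lexx // eqxx inE.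
Qed.

Fact face_set_refl : reflexive face_set_le. Proof. by move=> A; exact: fintype.subxx. Qed.
Fact face_set_trans : transitive face_set_le.
Proof. by move=> B A C; exact: fintype.subset_trans. Qed.
Fact face_set_top A : face_set_le A (exist _ finset.setT face_setT).
Proof. exact: finset.subsetT. Qed.
Fact face_set_lt A B : face_set_le A B -> A != B -> (face_set_dim A < face_set_dim B)%N.
Proof.
move=> AB ne; apply: face_dim_lt; first exact: face_setP.
by rewrite finset.properEneq; apply/andP; split; [rewrite (inj_eq val_inj)|].
Qed.
Fact face_set_pred A : (0 < face_set_dim A)%N ->
  exists B, face_set_le B A && ((face_set_dim B).+1 == face_set_dim A).
Proof.
move=> /(facet_exists (face_setP A))[B /asboolP fB [BA e]].
by exists (exist _ B fB); rewrite /face_set_le /face_set_dim /= BA e eqxx.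
Qed.

Definition face_poset : rposet := RPoset face_set_refl face_set_trans face_set_top
  face_set_lt face_set_pred.

Lemma big_face_set (P : pred {set 'I_m}) (F : {set 'I_m} -> rat) :
  \sum_(A : face_set | P (val A)) F (val A) = \sum_(A | faceb v A && P A) F A.
Proof.
rewrite [RHS](reindex_omap (val : face_set -> _) insub) => [|A /andP[fA _]]; last first.
  by rewrite insubT.
by apply: eq_bigl => A; rewrite valK eqxx andbT (valP A).
Qed.

Lemma face_poset_eulerian : eulerian face_poset.
Proof.
split=> [B|G B GB ne].
  rewrite -[RHS](face_euler (face_setP B)).
  exact: (big_face_set (fun A => A \subset val B) (fun A => (-1) ^+ dimA v A)).
have GpB : val G \proper val B by rewrite finset.properEneq; apply/andP.
rewrite -[RHS](face_interval_euler (face_setP B) (face_setP G) GpB).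
exact: (big_face_set (fun A => (val G \subset A) && (A \subset val B))
  (fun A => (-1) ^+ dimA v A)).
Qed.

End FacePoset.

Section RposetIso.
Variables (X Y : rposet) (f : X -> Y).
Hypotheses (f_bij : bijective f) (fle : forall x x', rle (f x) (f x') = rle x x').

Lemma iso_eulerian : eulerian Y -> eulerian X.
Proof.
move=> [E I]; have frk := rrk_unique f_bij fle.
have re (P : pred Y) (F : Y -> rat) : \sum_(y | P y) F y = \sum_(x | P (f x)) F (f x).
  by apply: reindex; exact: onW_bij.
split=> [x|y x yx ne].
  rewrite -[RHS](E (f x)) re; apply: eq_big => [z|z _]; first by rewrite fle.
  by rewrite frk.
rewrite -[RHS](I (f y) (f x)) ?fle ?(inj_eq (bij_inj f_bij)) // re.
by apply: eq_big => [z|z _]; rewrite ?fle ?frk.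
Qed.

End RposetIso.

Section VertexFaces.
Variables (R : realType) (d m : nat) (v : 'I_m -> 'rV[R]_d).
Implicit Types A B : {set 'I_m}.

Lemma hull_vertex i : hull v (v i).
Proof.
exists (fun k => (k == i)%:R); split; rewrite -?(comb_delta v i) //.
by rewrite (bigD1 i) //= eqxx big1 ?addr0 // => k /negPf->.
Qed.

Lemma exposed_hullA A c b : exposed v A c b ->
  hullA v A = [set x | hull v x /\ (x *m c) 0 0 = b]%classic.
Proof.
move=> [vb AE]; apply/seteqP; split=> x.
  move=> [a wa ->]; split.
    by have [a0 _ a1] := wa; exists a.
  by apply: dot_comb_face wa => i; rewrite AE => /eqP.
move=> [[a [a0 a1 ->]] e]; exists a => //; split=> // i iA.
apply/eqP; have : \sum_j a j * (b - dot (v j) c) = 0.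
  under eq_bigr do rewrite mulrBr.
  by rewrite sumrB -mulr_suml a1 mul1r -dot_comb [dot _ _]e subrr.
move=> /eqP; rewrite psumr_eq0 => [/allP/(_ i)|j _]; last first.
  by apply: mulr_ge0 => //; rewrite subr_ge0.
rewrite mem_index_enum => /(_ isT); rewrite mulf_eq0 subr_eq0 => /orP[//|/eqP eb].
by case/negP: iA; rewrite AE -eb.
Qed.

Lemma hullA_face A : is_face v A -> face (hull v) (hullA v A).
Proof.
move=> fA; split.
  by have [x Ax] := relint0 v fA.1; exists x; exact: relint_hullA Ax.
have [_ [c [b cb]]] := fA; exists c, b; split; last exact: exposed_hullA.
move=> x [a [a0 a1 ->]]; rewrite -[X in X <= _]/(dot (comb v a) c) dot_comb.
rewrite -[leRHS]mul1r -a1 mulr_suml; apply: ler_sum => i _.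
by rewrite ler_wpM2l //; case: cb.
Qed.

Lemma face_hullA F : face (hull v) F -> exists2 A, is_face v A & F = hullA v A.
Proof.
move=> [[x Fx] [c [b [vb FE]]]].
pose A := [set i | dot (v i) c == b].
have cb : exposed v A c b.
  by split=> i; [apply/vb/hull_vertex|rewrite inE].
have FA : F = hullA v A by rewrite FE (exposed_hullA cb).
exists A => //; split; last by exists c, b.
move: Fx; rewrite FA => -[a [_ aA a1] _]; apply/eqP => A0.
have := oner_neq0 R; rewrite -a1 big1 ?eqxx // => i _.
by apply: aA; rewrite A0 inE.
Qed.

Lemma hullA_sub A B : is_face v A -> is_face v B ->
  (hullA v A `<=` hullA v B)%classic <-> A \subset B.
Proof.
move=> fA fB; split=> [AB|/fintype.subsetP AB x [a [a0 aA a1] ->]].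
  have [x Ax] := relint0 v fA.1.
  by apply: (relint_face_sub fB Ax); apply/AB; exact: relint_hullA Ax.
by exists a => //; split=> // i iB; apply: aA; apply: contra iB => /AB.
Qed.

(** For the lower bound, a point of the relative interior is moved along suitably scaled vectors of
    a basis of the directions, which stay inside. *)
Lemma affdim_hullA A : A != finset.set0 -> affdim (hullA v A) = dimA v A.
Proof.
move=> A0; apply/eqP; rewrite eqn_leq; apply/andP; split.
  apply/bigmax_leqP => k /asboolP[x [M [[a [_ aA a1] xE] AM /eqP <-]]].
  apply/mxrankS/row_subP => i.
  have [a' [_ a'A a'1] e] := AM i.
  rewrite (_ : row i M = comb v (fun k => a' k - a k)); last first.
    by rewrite combB -e -xE addrC addKr.
  apply: comb_dirmx => [l lA|]; first by rewrite a'A // aA // subrr.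
  by rewrite sumrB a'1 a1 subrr.
have dd : (dimA v A < d.+1)%N by rewrite ltnS rank_leq_col.
apply: (leq_bigmax_cond (Ordinal dd)); apply/asboolP => /=.
have [x Ax] := relint0 v A0.
have [r [V [rV Vsub Vop]]] := op_dir (relint_op v A).
have rE : \rank V = dimA v A by [].
rewrite -rE; pose M := row_base V.
have /choice[e eP] i : exists e, 0 < e /\ relint v A (x + e *: row i M).
  have [|e e0 Ae] := Vop _ (row i M) Ax; last by exists e.
  by rewrite (submx_trans (row_sub _ _)) // eq_row_base.
exists x, (diag_mx (\row_i e i) *m M); split.
- exact: relint_hullA Ax.
- move=> i; have -> : row i (diag_mx (\row_i e i) *m M) = e i *: row i M.
    by apply/rowP => j; rewrite mul_diag_mx !mxE.
  apply: (@relint_hullA _ _ _ _ A) => //.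
  by have [] := eP i.
- rewrite /row_free mxrankMfree ?row_base_free //.
  have : diag_mx (\row_i e i) \in unitmx.
    rewrite unitmxE det_diag unitfE; apply/prodf_neq0 => i _.
    by rewrite mxE gt_eqF //; have [] := eP i.
  by rewrite -row_free_unit.
Qed.

End VertexFaces.

(** * Finite models of the face posets of polytopes *)

Section Models.
Variable R : realType.
Implicit Types (P Q : polytope R) (X Y : rposet).

Definition models P X := order_iso (fun x y : X => rle x y) (@face_le R P).

Lemma face_poset_iso (P : polytope R) m (v : 'I_m -> 'rV[R]_(ambient P)) (m0 : (0 < m)%N) :
  carrier P = hull v -> exists h : face_poset v m0 -> face_of P,
  [/\ bijective h, forall A B, face_le (h A) (h B) <-> rle A B &
      forall A, affdim (sval (h A)) = rrk A].
Proof.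
move=> PE; have fP (A : face_poset v m0) : face (carrier P) (hullA v (val A)).
  by rewrite PE; apply: hullA_face; exact: face_setP.
pose h A : face_of P := exist _ _ (fP A).
have hle A B : face_le (h A) (h B) <-> rle A B.
  by apply: hullA_sub; exact: face_setP.
exists h; split=> // [|A]; last first.
  by rewrite affdim_hullA //; case: (face_setP A).
rewrite -setTT_bijective; split=> //.
  move=> A B _ _ e; apply/val_inj/eqP; rewrite finset.eqEsubset; apply/andP; split.
    by apply/(hle A B); rewrite e.
  by apply/(hle B A); rewrite e.
move=> [F fF] _; have fF' : face (hull v) F by rewrite -PE.
have [A /asboolP fA FE] := face_hullA fF'.
by exists (exist _ A fA : face_poset v m0) => //; apply: eq_exist.
Qed.

Lemma hull_nonempty d m (v : 'I_m -> 'rV[R]_d) : (hull v !=set0)%classic -> (0 < m)%N.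
Proof.
case: m v => // v [x [a [_ + _]]]; rewrite big_ord0 => /eqP.
by rewrite eq_sym oner_eq0.
Qed.

(** The dimension is the rank in the model built from generators, and the rank depends only on the
    order. *)
Lemma models_rrk P X (h : X -> face_of P) : bijective h ->
  (forall x y, face_le (h x) (h y) <-> rle x y) -> forall x, affdim (sval (h x)) = rrk x.
Proof.
move=> h_bij hle x; have [P0 [m [v PE]]] := polytopeP P.
have m0 : (0 < m)%N by apply: (@hull_nonempty _ _ v); rewrite -PE.
have [k [k_bij kle krk]] := face_poset_iso m0 PE.
have [k' kK k'K] := k_bij.
have f_bij : bijective (k' \o h) by apply: bij_comp => //; exists k.
have fle y z : rle ((k' \o h) y) ((k' \o h) z) = rle y z.
  by apply/idP/idP => /=; [move/kle; rewrite !k'K => /hle|move/hle => le; apply/kle; rewrite !k'K].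
by rewrite -[RHS](rrk_unique f_bij fle) -krk /= k'K.
Qed.

Lemma models_exists P : exists2 X, models P X & eulerian X.
Proof.
have [P0 [m [v PE]]] := polytopeP P.
have m0 : (0 < m)%N by apply: (@hull_nonempty _ _ v); rewrite -PE.
have [k [k_bij kle _]] := face_poset_iso m0 PE.
by exists (face_poset v m0); [exists k|exact: face_poset_eulerian].
Qed.

Lemma models_iso P X Y : models P X -> models P Y ->
  exists2 f : X -> Y, bijective f & forall x x', rle (f x) (f x') = rle x x'.
Proof.
move=> [h h_bij hle] [k [k' kK k'K] kle].
exists (k' \o h); first by apply: bij_comp => //; exists k.
move=> x x'; apply/idP/idP => /=.
  by move/kle; rewrite !k'K => /hle.
by move/hle => le; apply/kle; rewrite !k'K.
Qed.

Lemma models_eulerian P X : models P X -> eulerian X.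
Proof.
have [Y PY EY] := models_exists P; move=> PX.
by have [f f_bij fle] := models_iso PX PY; exact: (iso_eulerian f_bij fle EY).
Qed.

Lemma models_rtop P X (h : X -> face_of P) : bijective h ->
  (forall x y, face_le (h x) (h y) <-> rle x y) -> sval (h (rtop X)) = carrier P.
Proof.
move=> [h' hK h'K] hle.
pose PP : face_of P := exist _ _ (face_self P).
have le : face_le PP (h (rtop X)) by rewrite -(h'K PP); apply/hle; exact: rle_top.
apply/seteqP; split=> // x.
by case: (h _) => F /= [_ [c [b [_ ->]]]] [].
Qed.

Lemma models_dim P X : models P X -> affdim (carrier P) = rrk (rtop X).
Proof.
by move=> [h h_bij hle]; rewrite -(models_rrk h_bij hle) (models_rtop h_bij hle).
Qed.

Lemma models_equiv P Q X : comb_equiv P Q -> models P X -> models Q X.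
Proof. by move=> PQ PX; exact: order_iso_trans PQ. Qed.

Lemma models_prod P Q X Y : models P X -> models Q Y -> models (polytope_prod P Q) (rprod X Y).
Proof.
move=> PX QY; apply: order_iso_trans (order_iso_trans (order_iso_prod PX QY) (face_of_prod P Q)).
exists id; first by exists id.
by move=> [x y] [x' y']; split=> [[/= xx' yy']|/andP[]//]; apply/andP.
Qed.

Lemma models_point : models (Defs.point R) rpt.
Proof.
apply: order_iso_trans (face_of_point R); exists id; first by exists id.
by move=> [] [].
Qed.

Section ConePolytope.
Variables (d m : nat) (v : 'I_m -> 'rV[R]_d) (m0 : (0 < m)%N).

Definition cone_vertex (i : 'I_m.+1) : 'rV[R]_(d + 1) :=
  if unlift ord0 i is Some j then row_mx (v j) 0 else row_mx 0 1%:M.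

Let w := cone_vertex.

Lemma dot_cone_base j c : dot (w (lift ord0 j)) c = dot (v j) (usubmx c).
Proof.
by rewrite /w /cone_vertex liftK /dot -{1}[c]vsubmxK mul_row_col mul0mx addr0.
Qed.

Lemma dot_cone_apex c : dot (w ord0) c = dsubmx c 0 0.
Proof.
by rewrite /w /cone_vertex unlift_none /dot -{1}[c]vsubmxK mul_row_col mul0mx mul1mx add0r.
Qed.

Definition cone_face (A : {set 'I_m}) (b : bool) : {set 'I_m.+1} :=
  [set i | if unlift ord0 i is Some j then j \in A else b].

Lemma cone_face_base A b j : (lift ord0 j \in cone_face A b) = (j \in A).
Proof. by rewrite inE liftK. Qed.

Lemma cone_face_apex A b : (ord0 \in cone_face A b) = b.
Proof. by rewrite inE unlift_none. Qed.

Lemma cone_faceE (B : {set 'I_m.+1}) :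
  B = cone_face [set j | lift ord0 j \in B] (ord0 \in B).
Proof.
apply/setP => i; rewrite inE; case: unliftP => [j ->|-> //].
by rewrite inE.
Qed.

Lemma cone_face_sub A b A' b' :
  (cone_face A b \subset cone_face A' b') = (A \subset A') && (b ==> b').
Proof.
apply/fintype.subsetP/andP => [s|[/fintype.subsetP s bb'] i].
  split; first by apply/fintype.subsetP => j; have := s (lift ord0 j); rewrite !cone_face_base.
  by apply/implyP; have := s ord0; rewrite !cone_face_apex.
rewrite !inE; case: unliftP => [j _|_]; first exact: s.
exact/implyP.
Qed.

Lemma cone_face_is_face A b : is_face v A -> is_face w (cone_face A b).
Proof.
move=> [/set0Pn[k kA] [c [e [vb AE]]]]; split.
  by apply/set0Pn; exists (lift ord0 k); rewrite cone_face_base.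
(* The value at the apex is the maximum [e] if the apex is to lie on the face, and [e - 1]
   otherwise. *)
exists (col_mx c (e - (~~ b)%:R)%:M), e; split=> i; case: (unliftP ord0 i) => [j|] ->.
- by rewrite dot_cone_base col_mxKu.
- by rewrite dot_cone_apex col_mxKd mxE eqxx mulr1n gerBl.
- by rewrite dot_cone_base col_mxKu cone_face_base.
- rewrite dot_cone_apex col_mxKd cone_face_apex mxE eqxx mulr1n.
  by rewrite subr_eq addrC -subr_eq subrr eq_sym pnatr_eq0; case: (b).
Qed.

Lemma cone_apex_is_face : is_face w (cone_face finset.set0 true).
Proof.
split; first by apply/set0Pn; exists ord0; rewrite cone_face_apex.
exists (col_mx 0 1%:M), 1; split=> i; case: (unliftP ord0 i) => [j|] ->.
- by rewrite dot_cone_base col_mxKu /dot mulmx0 mxE ler01.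
- by rewrite dot_cone_apex col_mxKd mxE.
- by rewrite dot_cone_base col_mxKu cone_face_base /dot mulmx0 mxE inE eq_sym oner_eq0.
- by rewrite dot_cone_apex col_mxKd cone_face_apex mxE !eqxx.
Qed.

Lemma is_face_cone A b : is_face w (cone_face A b) -> A != finset.set0 -> is_face v A.
Proof.
move=> [_ [c [e [wb BE]]]] A0; split=> //; exists (usubmx c), e; split=> j.
  by rewrite -dot_cone_base.
by rewrite -dot_cone_base -BE cone_face_base.
Qed.

Definition cone_face_map (p : rcone (face_poset v m0)) : {set 'I_m.+1} :=
  if p is Some (A, b) then cone_face (val A) b else cone_face finset.set0 true.

Lemma cone_face_mapP p : faceb w (cone_face_map p).
Proof.
apply/asboolP; case: p => [[A b]|]; last exact: cone_apex_is_face.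
by apply: cone_face_is_face; exact: face_setP.
Qed.

Lemma cone_face_iso : exists2 f : rcone (face_poset v m0) -> face_poset w (ltn0Sn m),
  bijective f & forall p q, rle (f p) (f q) = rle p q.
Proof.
pose f p : face_poset w (ltn0Sn m) := exist (fun B => is_true (faceb w B)) _ (cone_face_mapP p).
have fle p q : rle (f p) (f q) = rle p q.
  rewrite -[LHS]/(cone_face_map p \subset cone_face_map q).
  case: p q => [[A b]|] [[A' b']|] /=; rewrite cone_face_sub ?finset.sub0set ?implybT ?andbT //.
  by rewrite finset.subset0; have [/negPf->] := face_setP A.
exists f => //; rewrite -setTT_bijective; split=> //.
  have anti (X : rposet) (x y : X) : rle x y -> rle y x -> x = y.
    move=> xy yx; apply/eqP/negPn/negP => ne.
    by have := rrk_lt xy ne; rewrite ltnNge rrk_le.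
  by move=> p q _ _ e; apply: anti; rewrite -fle e rle_refl.
move=> B _; have := face_setP B; rewrite [val B]cone_faceE.
set A := [set j | _]; set b := (_ \in _) => fB.
have [A0|A0] := eqVneq A finset.set0; last first.
  have /asboolP fA := is_face_cone fB A0.
  exists (Some (exist _ A fA : face_poset v m0, b)) => //.
  by apply: val_inj; rewrite /= [RHS]cone_faceE.
exists None => //; apply: val_inj; rewrite /= [RHS]cone_faceE -/A -/b A0.
case: b fB => // -[/set0Pn[i]]; rewrite A0; case: (unliftP ord0 i) => [j|] ->.
  by rewrite cone_face_base inE.
by rewrite cone_face_apex.
Qed.

End ConePolytope.

Lemma rcone_iso X Y (f : X -> Y) : bijective f -> (forall x y, rle (f x) (f y) = rle x y) ->
  exists2 g : rcone X -> rcone Y, bijective g & forall p q, rle (g p) (g q) = rle p q.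
Proof.
move=> [f' fK f'K] fle; exists (omap (fun p => (f p.1, p.2))).
  by exists (omap (fun p => (f' p.1, p.2))) => -[[x b]|] //=; rewrite ?fK ?f'K.
by move=> [[x b]|] [[y c]|] //=; rewrite fle.
Qed.

Lemma models_cone P X : models P X -> exists Q, models Q (rcone X).
Proof.
move=> PX; have [P0 [m [v PE]]] := polytopeP P.
have m0 : (0 < m)%N by apply: (@hull_nonempty _ _ v); rewrite -PE.
have [h [h_bij hle _]] := face_poset_iso m0 PE.
have [f f_bij fle] := models_iso PX (ex_intro2 _ _ h h_bij hle : models P (face_poset v m0)).
have [g g_bij gle] := rcone_iso f_bij fle.
have [k k_bij kle] := cone_face_iso v m0.
have QP : (hull (cone_vertex v) !=set0)%classic /\
    exists n (u : 'I_n -> 'rV[R]_(ambient P + 1)), hull (cone_vertex v) = hull u.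
  split; last by exists m.+1, (cone_vertex v).
  by exists (cone_vertex v ord0); exact: hull_vertex.
pose Q := Polytope QP.
have [l [l_bij lle _]] := @face_poset_iso Q _ (cone_vertex v) (ltn0Sn m) erefl.
exists Q, (l \o (k \o g)); first by do 2!apply: bij_comp => //.
by move=> p q; have := lle (k (g p)) (k (g q)); rewrite kle gle.
Qed.

End Models.

(** * Coefficients of the f-polynomial *)

Import monalg.
Local Notation "1" := (@mone _) : monom_scope.
Local Notation "x * y" := (mmul x y) : monom_scope.

Section Monomials.
Implicit Types (m : {cmonom nat}) (k i : nat) (w : seq nat).

Lemma cmonomP m m' : (forall i, m i = m' i) -> m = m'.
Proof. by move=> e; apply/eqP/cmP. Qed.

Definition consm k m : {cmonom nat} :=
  mkcmonom [fsfun i in (0%N |` [fset i.+1 | i in finsupp m])%fset =>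
    if i is i'.+1 then m i' else k | 0%N].

Lemma consmE k m i : consm k m i = if i is i'.+1 then m i' else k.
Proof.
rewrite /consm cmE fsfunE; case: ifPn => //; case: i => [|i].
  by rewrite in_fset1U eqxx.
rewrite in_fset1U negb_or /=; move=> ni; apply/esym/eqP; rewrite cmE_eq0.
by apply: contra ni => im; apply/imfsetP; exists i.
Qed.

Definition tailm m : {cmonom nat} := 
  mkcmonom [fsfun i in [fset i.-1 | i in finsupp m]%fset => m i.+1 | 0%N].

Lemma tailmE m i : tailm m i = m i.+1.
Proof.
rewrite /tailm cmE fsfunE; case: ifPn => // ni; apply/esym/eqP; rewrite cmE_eq0.
by apply: contra ni => im; apply/imfsetP; exists i.+1.
Qed.

Lemma consm_eta m : m = consm (m 0%N) (tailm m).
Proof. by apply: cmonomP => -[|i]; rewrite consmE // tailmE. Qed.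

Lemma consmM k k' m m' : (consm k m * consm k' m')%M = consm (k + k')%N (m * m')%M.
Proof. by apply: cmonomP => -[|i]; rewrite cmM !consmE ?cmM. Qed.

Lemma consm01 : consm 0 1%M = 1%M.
Proof. by apply: cmonomP => -[|i]; rewrite consmE !cm1. Qed.

Lemma consm_inj k k' m m' : consm k m = consm k' m' -> k = k' /\ m = m'.
Proof.
move=> e; split; first by have := congr1 (fun x : {cmonom nat} => x 0%N) e; rewrite !consmE.
by apply: cmonomP => i; have := congr1 (fun x : {cmonom nat} => x i.+1) e; rewrite !consmE.
Qed.

Definition mbound m := (\max_(i <- finsupp m) i.+1)%N.

Lemma mbound_out m i : (mbound m <= i)%N -> m i = 0%N.
Proof.
move=> le; apply/eqP; rewrite cmE_eq0; apply: contraL le => im.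
rewrite -ltnNge /mbound (big_fsetD1 i im) /=; exact: leq_maxl.
Qed.

(** A monomial involves finitely many variables and is built up from its last one. This is the
    induction matching the recursion of [fl] on its first letter. *)
Lemma consm_ind (T : {cmonom nat} -> Prop) :
  T 1%M -> (forall k m, T m -> T (consm k m)) -> forall m, T m.
Proof.
move=> T1 TS m; have : forall i, (mbound m <= i)%N -> m i = 0%N by move=> i; exact: mbound_out.
move: (mbound m) => N; elim: N m => [|N IH] m m0.
  by rewrite (_ : m = 1%M) //; apply: cmonomP => i; rewrite m0 // cm1.
by rewrite (consm_eta m); apply/TS/IH => i Ni; rewrite tailmE m0.
Qed.

Definition msup m := [seq i <- iota 0 (mbound m) | 0 < m i]%N.
(** M_w is the sum of the monomials whose word of nonzero exponents is w, so a coefficient of a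
    quasi-symmetric series depends only on [word m]. *)
Definition word m := [seq m i | i <- msup m].

Lemma mem_msup m i : (i \in msup m) = (0 < m i)%N.
Proof.
rewrite mem_filter mem_iota /= add0n; case: ltnP => //= mi.
by apply/negPn/negP; rewrite -leqNgt => /mbound_out e; rewrite e in mi.
Qed.

Lemma sorted_msup m : sorted ltn (msup m).
Proof. by apply: sorted_filter; [exact: ltn_trans|exact: iota_ltn_sorted]. Qed.

Lemma msup_eq m s : sorted ltn s -> (forall i, (i \in s) = (0 < m i)%N) -> msup m = s.
Proof.
move=> ss sm; apply: (irr_sorted_eq ltn_trans ltnn) => // [|i].
  exact: sorted_msup.
by rewrite mem_msup sm.
Qed.

Lemma word_pos m : all (ltn 0) (word m).
Proof. by apply/allP => _ /mapP[i + ->]; rewrite mem_msup. Qed.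

Lemma word1 : word 1%M = [::].
Proof. by rewrite /word (@msup_eq _ [::]) // => i; rewrite cm1. Qed.

Lemma word_consm k m : word (consm k m) = if k == 0%N then word m else k :: word m.
Proof.
have ss : sorted ltn [seq i.+1 | i <- msup m].
  by rewrite sorted_map; exact: sorted_msup.
have ms i : (i \in [seq i.+1 | i <- msup m]) = (0 < i)%N && (0 < m i.-1)%N.
  case: i => [|i]; first by apply/mapP => -[].
  by rewrite mem_map ?mem_msup //; exact: succn_inj.
have wE l : [seq consm l m i | i <- [seq i.+1 | i <- msup m]] = word m.
  by rewrite -map_comp; apply: eq_map => i /=; rewrite consmE.
rewrite /word; have [->|k0] := eqVneq k 0%N.
  rewrite (@msup_eq _ [seq i.+1 | i <- msup m]) ?wE //.
  by case=> [|i]; rewrite ms consmE.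
rewrite (@msup_eq _ (0%N :: [seq i.+1 | i <- msup m])) /=.
- by rewrite consmE wE.
- by rewrite path_sortedE ?ss ?andbT; [apply/allP => i; rewrite ms => /andP[]|exact: ltn_trans].
- by case=> [|i]; rewrite inE ms consmE //= lt0n k0.
Qed.

Lemma expcmnE m e j : expcmn m e j = (e * m j)%N.
Proof.
elim: e => [|[|e] IH]; first exact: cm1; first by rewrite mul1n.
have -> : expcmn m e.+2 = (m * expcmn m e.+1)%M by [].
by rewrite cmM IH mulSn.
Qed.

Lemma tmonomialE l w j :
  tmonomial l w j = \sum_(p <- zip l w) (if p.1 == j then p.2 else 0)%N.
Proof.
rewrite /tmonomial; apply: (big_ind2 (fun (x : {cmonom nat}) y => x j = y)).
- exact: cm1.
- by move=> x1 y1 x2 y2 <- <-; rewrite cmM.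
move=> [i e] _ /=; rewrite expcmnE cmU; case: eqP => _; first exact: muln1.
exact: muln0.
Qed.

Lemma Mqsym_coef (K : comNzRingType) w m : all (ltn 0) w ->
  tcoef (Mqsym K w) m = (word m == w)%:R.
Proof.
move=> w0 /=; case: asboolP => [[l [sl ls mE]]|nl].
  have lu : uniq l by apply: sorted_uniq ls; [exact: ltn_trans|exact: ltnn].
  have mw : [seq m i | i <- l] = w.
    apply: (@eq_from_nth _ 0%N); rewrite size_map // => i il.
    rewrite (nth_map 0%N) // mE tmonomialE (big_nth (0%N, 0%N)) size_zip sl minnn.
    rewrite sl in il.
    rewrite big_mkord (bigD1 (Ordinal il)) //= nth_zip //= eqxx big1 => [|k ne].
      by rewrite [LHS]addn0.
    rewrite nth_zip //= nth_uniq ?sl //.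
    by rewrite ifF //; apply: contraNF ne => /eqP e; apply/eqP/val_inj.
  suff -> : word m = w by rewrite eqxx.
  rewrite /word (@msup_eq _ l) // => i; apply/idP/idP => [il|].
    have : m i \in w by rewrite -mw map_f.
    by move/(allP w0).
  apply: contraTT => il; rewrite -leqNgt leqn0 mE tmonomialE big1_seq // => -[a b] /= ab.
  case: eqP => // e; case/negP: il; rewrite -e.
  have := map_f fst ab; rewrite -/unzip1 unzip1_zip ?sl //.
case: eqP => // e; case: nl; exists (msup m); split.
- by rewrite -e size_map.
- exact: sorted_msup.
apply: cmonomP => j; rewrite tmonomialE -e /word.
have -> : zip (msup m) [seq m i | i <- msup m] = [seq (i, m i) | i <- msup m].
  by elim: (msup m) => //= a s ->.
rewrite big_map /=.
have um : uniq (msup m) by rewrite filter_uniq // iota_uniq.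
have [j0|j0] := posnP (m j).
  by rewrite j0 big1_seq // => i _; case: eqP => // ->.
rewrite (big_rem j) ?mem_msup //= eqxx big1_seq; first by rewrite [RHS]addn0.
by move=> i; rewrite mem_rem_uniq // inE => /andP[_ /andP[/negPf->]].
Qed.

End Monomials.

(** * Flags and compositions *)

Section Chains.
Variable X : rposet.
Implicit Types (x y : X) (r w : seq nat).

Fixpoint chains r x : seq (seq X) :=
  if r is b :: r' then
    [seq y :: u | y <- [seq y <- enum X | rle y x && (rrk y == b)], u <- chains r' y]
  else [:: [::]].

Lemma mem_chains r x u :
  (u \in chains r x) = (map (@rrk X) u == r) && path (fun y z => rle z y) x u.
Proof.
elim: r x u => [|b r IH] x u /=; first by rewrite inE; case: u.
apply/allpairsPdep/andP => [[y [t [+ + ->]]]|].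
  rewrite mem_filter IH => /andP[/andP[yx /eqP yb] _] /andP[/eqP tr yt].
  by rewrite /= yb tr yx.
case: u => [|y t] /= []; first by [].
rewrite eqseq_cons => /andP[yb tr] /andP[yx yt]; exists y, t; split=> //.
  by rewrite mem_filter yx yb mem_enum.
by rewrite IH tr.
Qed.

Lemma uniq_chains r x : uniq (chains r x).
Proof.
elim: r x => [//|b r IH] x /=; apply: allpairs_uniq_dep => //.
  by rewrite filter_uniq // enum_uniq.
by move=> [y t] [y' t'] _ _ /= [-> ->].
Qed.

(** Up to reversal this inverts [flag_composition]: [w] lists codimensions from the polytope
    downwards, whereas flags are listed upwards. *)
Fixpoint dims_of (n : nat) w : seq nat :=
  if w is k :: w' then (n - k)%N :: dims_of (n - k) w' else [::].

Lemma fl_chains j w x : (j + sumn w = rrk x)%N ->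
  fl w j x = (size (chains (dims_of (rrk x) w) x))%:R.
Proof.
elim: w x => [|k w IH] x /=; first by rewrite addn0 => ->; rewrite eqxx.
move=> e; rewrite size_allpairs_dep sumnE big_map big_filter natr_sum.
rewrite big_enum_cond /=.
apply: eq_big => [y|y /andP[_ /eqP yk]]; first by congr (_ && _); lia.
have -> : (rrk x - k = rrk y)%N by lia.
by apply: IH; lia.
Qed.
End Chains.

Section FlagComposition.

Lemma flag_composition_rcons n b r : r != [::] ->
  flag_composition n (rev (b :: r)) = (n - b)%N :: flag_composition b (rev r).
Proof.
case/lastP: r => // r c _; rewrite /flag_composition.
rewrite !rev_cons !rev_rcons /= -rev_rcons; congr (rev _).
have pr s x y f : pairmap f x (rcons s y) = rcons (pairmap f x s) (f (last x s) y) :> seq nat.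
  by elim: s x => //= a s ->.
by rewrite !pr last_rcons.
Qed.

Lemma flag_composition1 n b : flag_composition n [:: b] = [:: (n - b)%N].
Proof. by []. Qed.

Lemma flag_composition_dims n w : w != [::] -> (sumn w <= n)%N ->
  flag_composition n (rev (dims_of n w)) = w.
Proof.
elim: w n => // k [|l w] IH n _ /= le.
  by rewrite flag_composition1; congr [:: _]; lia.
rewrite flag_composition_rcons // IH //=; last by lia.
by congr cons; lia.
Qed.

Lemma dims_flag_composition n r : path (fun a b => b < a)%N n r -> r != [::] ->
  dims_of n (flag_composition n (rev r)) = r.
Proof.
elim: r n => // b [|c r] IH n /andP[bn pr] _.
  by rewrite flag_composition1 /=; congr [:: _]; lia.
rewrite flag_composition_rcons // [LHS]/=.
have -> : (n - (n - b) = b)%N by lia.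
by rewrite IH.
Qed.

Lemma last_dims n w : (sumn w <= n)%N -> last n (dims_of n w) = (n - sumn w)%N.
Proof.
elim: w n => [|k w IH] n /=; first by rewrite subn0.
by move=> le; rewrite IH; lia.
Qed.

Lemma flag_composition_pos n r : path (fun a b => b < a)%N n r -> r != [::] ->
  all (ltn 0) (flag_composition n (rev r)) /\
  (last n r + sumn (flag_composition n (rev r)) = n)%N.
Proof.
elim: r n => // b [|c r] IH n /andP[bn pr] _.
  by rewrite flag_composition1 /=; split; lia.
rewrite flag_composition_rcons //; have [] := IH b pr isT.
by rewrite /= => -> e; split; [lia|move: e => /=; lia].
Qed.

Lemma path_dims n w : all (ltn 0) w -> (sumn w <= n)%N ->
  path (fun a b => b < a)%N n (dims_of n w).
Proof.
elim: w n => //= k w IH n /andP[k0 w0] le.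
by rewrite IH //; [rewrite andbT; lia|lia].
Qed.

Lemma size_dims n w : size (dims_of n w) = size w.
Proof. by elim: w n => //= k w IH n; rewrite IH. Qed.

End FlagComposition.

Section FlagNumbers.
Variable R : realType.
Variables (P : polytope R) (X : rposet) (h : X -> face_of P).
Hypotheses (h_bij : bijective h) (hle : forall x y, face_le (h x) (h y) <-> rle x y).

Lemma flag_number_chains r : flag_number P (rev r) = size (chains r (rtop X)).
Proof.
rewrite /flag_number; have [h' hK h'K] := h_bij.
pose H (x : X) : set 'rV[R]_(ambient P) := sval (h x).
have H_inj : injective H.
  have sval_inj (F G : face_of P) : sval F = sval G -> F = G.
    by case: F G => [F fF] [G fG] /= e; exact: eq_exist.
  by move=> x y /sval_inj; exact: (can_inj hK).
have -> : fset_set (@flags R P (rev r)) =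
    [fset rev (map H u) | u in chains r (rtop X)]%fset.
  apply/fsetP => s.
  have fl_eq : @flags R P (rev r) = [set` [fset rev (map H u) | u in chains r (rtop X)]%fset]%classic.
    have Hle x y : `[< H x `<=` H y >]%classic = rle x y.
      by apply/asboolP/idP => /hle.
    have sortE t : sorted (fun F G => `[< F `<=` G >]%classic) (map H (rev t)) =
        path (fun y z => rle z y) (rtop X) t.
      rewrite sorted_map (eq_sorted (e' := @rle X)) => [|x y]; last exact: Hle.
      by rewrite rev_sorted; case: t => //= y t; rewrite rle_top.
    have dimE t : map (@affdim R _) (map H t) = map (@rrk X) t.
      by rewrite -map_comp; apply: eq_map => x; exact: models_rrk.
    apply/seteqP; split=> s' /=.
      move=> [sf sr ss]; have [t tE] : exists t, s' = map H t.
        elim: s' sf {sr ss} => [|F s' IH] sf; first by exists [::].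
        have [|t tE] := IH; first by move=> G Gs; apply: sf; rewrite inE Gs orbT.
        have fF : face P F by apply: sf; rewrite inE eqxx.
        by exists (h' (exist _ F fF) :: t); rewrite /= -tE /H h'K.
      apply/imfsetP; exists (rev t) => /=; last by rewrite map_rev revK.
      by rewrite mem_chains -sortE revK -tE ss andbT map_rev -dimE -tE sr revK.
    case/imfsetP => u /=; rewrite mem_chains => /andP[/eqP ur up] ->.
    rewrite -map_rev; split.
    - by move=> F /mapP[x _ ->]; exact: svalP (h x).
    - by rewrite dimE map_rev ur.
    - by rewrite sortE.
  by rewrite fl_eq set_fsetK.
rewrite card_imfset /=; last by move=> u t /(can_inj revK)/(inj_map H_inj).
by rewrite undup_id ?uniq_chains.
Qed.

End FlagNumbers.

Section Tcoef.
Variable K : comNzRingType.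
Implicit Types (f g : tseries K) (m : {cmonom nat}).

Lemma tcoef0 m : tcoef (0 : tseries K) m = 0.
Proof. by rewrite -[0]/(tsC 0) /= if_same. Qed.

Lemma tcoefD f g m : tcoef (f + g) m = tcoef f m + tcoef g m.
Proof. by []. Qed.

Lemma tcoefN f m : tcoef (- f) m = - tcoef f m.
Proof. by []. Qed.

Lemma tcoef1 m : tcoef (1 : tseries K) m = (m == mone)%:R.
Proof. by rewrite -[LHS]/(if _ then _ else _); case: eqP. Qed.

Lemma tcoef_sum (I : Type) (r : seq I) (P : pred I) (F : I -> tseries K) m :
  tcoef (\sum_(i <- r | P i) F i) m = \sum_(i <- r | P i) tcoef (F i) m.
Proof. by apply: (big_morph (fun f => tcoef f m)) => //; exact: tcoef0. Qed.

Lemma tcoefMn f n m : tcoef (f *+ n) m = tcoef f m *+ n.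
Proof.
elim: n => [|n IH]; first by rewrite !mulr0n tcoef0.
by rewrite !mulrS -IH.
Qed.

Lemma tcoef_natl f n m : tcoef (n%:R * f) m = tcoef f m *+ n.
Proof. by rewrite mulr_natl tcoefMn. Qed.

Lemma tcoef_natr f n m : tcoef (f * n%:R) m = tcoef f m *+ n.
Proof. by rewrite mulr_natr tcoefMn. Qed.

End Tcoef.

Section FPolynomialCoef.
Variable R : realType.

Lemma size_le_sumn w : all (ltn 0) w -> (size w <= sumn w)%N.
Proof. by elim: w => //= k w IH /andP[k0 /IH]; lia. Qed.

Lemma sorted_rev_path n s : sorted ltn s -> all (fun a => a < n)%N s ->
  path (fun a b => b < a)%N n (rev s).
Proof.
move=> ss sn; rewrite -[path _ _ _]/(sorted _ (n :: rev s)) -rev_rcons rev_sorted.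
case: s ss sn => // a s /= ps /andP[an sn]; rewrite rcons_path ps /=.
by case/lastP: s {ps} sn => // s b; rewrite last_rcons all_rcons => /andP[].
Qed.

Lemma word_nil m : (word m == [::]) = (m == mone).
Proof.
apply/eqP/eqP => [|->]; last exact: word1.
move=> /(congr1 size); rewrite size_map => /size0nil e.
apply: cmonomP => i; rewrite cm1; apply/eqP; rewrite -leqn0 leqNgt -mem_msup.
by rewrite e.
Qed.

(** The word of [m] determines the dimensions of the flags that contribute, so at most one index
    tuple of the double sum survives; the empty word comes from the term alpha^n. *)
Lemma f_polynomial_coef (P : polytope R) X j m : models P X ->
  (tcoef (f_polynomial P)`_j m)%:~R = fl (word m) j (rtop X).
Proof.
move=> PX; rewrite /f_polynomial (models_dim PX); set n := rrk (rtop X).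
have [h h_bij hle] := PX.
set w := word m; have w_pos : all (ltn 0) w := word_pos m.
rewrite coefD coefXn coef_sum tcoefD tcoef_sum.
pose T k (a : k.-tuple 'I_n) : int := let s := map val a in
  if (head 0%N s == j) && (flag_composition n s == w) then (flag_number P s)%:R else 0.
have pathP k (a : k.-tuple 'I_n) : sorted ltn (map val a) ->
    path (fun a b => b < a)%N n (rev (map val a)).
  by move=> sa; apply: sorted_rev_path => //; apply/allP => _ /mapP[i _ ->]; exact: ltn_ord.
have neP k (a : k.-tuple 'I_n) : (0 < k)%N -> rev (map val a) != [::].
  by move=> k0; apply/eqP => /(congr1 size); rewrite size_rev size_map size_tuple => e; rewrite e in k0.
have -> : \sum_(1 <= k < n.+1) tcoef (\sum_(a : k.-tuple 'I_n | sorted ltn (map val a))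
      ((flag_number P (map val a))%:R * Mqsym int (flag_composition n (map val a))) *:
         'X^(head 0%N (map val a)))`_j m =
    \sum_(1 <= k < n.+1) \sum_(a : k.-tuple 'I_n | sorted ltn (map val a)) T k a.
  apply: eq_big_nat => k /andP[k0 _]; rewrite coef_sum tcoef_sum; apply: eq_bigr => a sa.
  rewrite coefZ coefXn /T (eq_sym j); move: (flag_number P (map val a)) => N.
  rewrite tcoef_natr tcoef_natl Mqsym_coef.
    rewrite (eq_sym (word m)) -/w; case: (_ == j); last by rewrite mulr0n.
    by case: (_ == w); rewrite ?mul0rn // mulr1n.
  by have [] := flag_composition_pos (pathP _ _ sa) (neP _ _ k0); rewrite revK.
have TP k (a : k.-tuple 'I_n) : (0 < k)%N -> sorted ltn (map val a) -> T k a != 0 ->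
    [/\ w != [::], map val a = rev (dims_of n w) & (j + sumn w = n)%N].
  move=> k0 sa; rewrite /T; case: ifP => [/andP[/eqP hj /eqP fw] _|]; last by rewrite eqxx.
  have pa := pathP _ _ sa; have na := neP _ a k0.
  have dE := dims_flag_composition pa na; have [_ le] := flag_composition_pos pa na.
  rewrite revK fw in dE le; split.
  - by apply/eqP => w0; rewrite -dE w0 in na.
  - by rewrite dE revK.
  - rewrite -le -hj; congr (_ + _)%N.
    by case: (map val a) na => // b s _; rewrite rev_cons last_rcons.
have [w0|w0] := eqVneq w [::].
  rewrite w0 /= big_nat_cond big1 ?addr0 => [|k /andP[/andP[k0 _] _]]; last first.
    apply: big1 => a sa; apply/eqP/negPn/negP => /(TP _ _ k0 sa)[].
    by rewrite w0.
  have m1 : m = mone by apply/eqP; rewrite -word_nil -/w w0.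
  by rewrite m1 eq_sym; case: eqP => _; rewrite ?tcoef1 ?eqxx ?tcoef0.
have m1 : (m == mone) = false by rewrite -word_nil; exact/negbTE.
have -> : tcoef ((j == n)%:R : tseries int) m = 0.
  by case: eqP => _; rewrite ?tcoef1 ?m1 ?tcoef0.
rewrite add0r.
have [jn|jn] := eqVneq (j + sumn w)%N n; last first.
  rewrite fl_deg // big_nat_cond big1 // => k /andP[/andP[k0 _] _].
  apply: big1 => a sa; apply/eqP/negPn/negP => /(TP _ _ k0 sa)[_ _ e].
  by rewrite e eqxx in jn.
have n_gt0 : (0 < n)%N.
  by case: (w) w0 w_pos jn => //= k w' _ /andP[k0 _]; lia.
pose d := rev (dims_of n w).
have le_wn : (sumn w <= n)%N by lia.
have pd := path_dims w_pos le_wn.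
have dn : all (fun a => a < n)%N d.
  rewrite all_rev; move: pd; rewrite path_sortedE; first by case/andP.
  by move=> a b c /= ab bc; exact: ltn_trans bc ab.
pose a0 := [seq insubd (Ordinal n_gt0) x | x <- d].
have sz : size a0 == size w by rewrite size_map size_rev size_dims.
have a0E : map val (Tuple sz) = d.
  rewrite /= /a0 -map_comp -[RHS]map_id; apply/eq_in_map => x xd.
  by rewrite /= insubdK //; exact: (allP dn).
have sd : sorted ltn d by rewrite rev_sorted; exact: path_sorted pd.
rewrite (bigD1_seq (size w)) ?iota_uniq //=; last first.
  rewrite mem_index_iota lt0n size_eq0 w0 ltnS (leq_trans (size_le_sumn w_pos)) //.
rewrite [X in _ + X]big1_seq ?addr0 => [|k /andP[kw]]; last first.
  rewrite mem_index_iota => /andP[k0 _]; apply: big1 => a sa.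
  apply/eqP/negPn/negP => /(TP _ _ k0 sa)[_ /(congr1 size)].
  by rewrite size_rev size_dims size_map size_tuple => e; rewrite e eqxx in kw.
rewrite (bigD1 (Tuple sz)) /=; last by rewrite [map _ _]a0E.
rewrite big1 ?addr0 => [|a /andP[sa ne]]; last first.
  apply/eqP/negPn/negP => /(TP _ _ _ sa)[]; first by rewrite lt0n size_eq0.
  move=> _ e _; case/eqP: ne; apply/val_inj/(inj_map val_inj).
  by rewrite e a0E.
rewrite /T a0E (flag_number_chains h_bij hle) (fl_chains jn) flag_composition_dims // eqxx andbT.
have -> : (head 0 d == j)%N.
  have := last_dims le_wn; rewrite -nth_last /d.
  case/lastP: (dims_of n w) (size_dims n w) => [|s b _].
    by move=> e; rewrite -size_eq0 -e in w0.
  rewrite nth_last last_rcons rev_rcons /= => ->; lia.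
by rewrite rmorph_nat.
Qed.

End FPolynomialCoef.

(** * The algebra of solutions *)

Section Shift.
Variable K : comNzRingType.
Implicit Types (f g : tseries K) (F G : {poly tseries K}).

(* The coefficient of [t_0 ^ k], as a series in the variables [t_1, t_2, ...]
   renamed to [t_0, t_1, ...]. *)
Definition dts k f : tseries K := TSeries (fun m => tcoef f (consm k m)).

Lemma dts_add k f g : dts k (f + g) = dts k f + dts k g.
Proof. exact: tseriesP. Qed.

Lemma dts0 k : dts k 0 = 0 :> tseries K.
Proof. by apply: tseriesP => m; rewrite -[LHS]/(tcoef 0 _) !tcoef0. Qed.

Lemma dts_sum k (I : Type) (r : seq I) (P : pred I) (F : I -> tseries K) :
  dts k (\sum_(i <- r | P i) F i) = \sum_(i <- r | P i) dts k (F i).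
Proof. by apply: (big_morph (dts k)); [exact: dts_add|exact: dts0]. Qed.

Lemma factorization1 (p : {cmonom nat} * {cmonom nat}) :
  factorizations 1%M p -> p = (1%M, 1%M).
Proof. by case: p => a b /unitm[/= -> ->]. Qed.

Lemma tcoefM1 f g : tcoef (f * g) 1%M = tcoef f 1%M * tcoef g 1%M.
Proof.
rewrite -[LHS]/(\sum_(p \in factorizations 1%M) tcoef f p.1 * tcoef g p.2).
rewrite (_ : factorizations 1%M = [set (1%M, 1%M)]%classic) ?fsbig_set1 //.
apply/seteqP; split=> [p /factorization1 -> //|_ ->].
by rewrite /factorizations /= mulm1.
Qed.

Lemma tcoef_mul f g m : tcoef (f * g) m =
  \sum_(p <- fset_set (factorizations m)) tcoef f p.1 * tcoef g p.2.
Proof.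
rewrite -[LHS]/(\sum_(p \in factorizations m) tcoef f p.1 * tcoef g p.2).
by rewrite fsbig_finite //; exact: finite_factorizations.
Qed.

Lemma mem_factorizations m p :
  (p \in fset_set (factorizations m)) = ((p.1 * p.2)%M == m).
Proof.
rewrite in_fset_set; last exact: finite_factorizations.
by apply/idP/eqP; rewrite inE.
Qed.

(** Factorizations of t_0^k m correspond to a splitting of [k] together with a factorization of the
    shifted [m]. *)
Lemma dtsM k f g : dts k (f * g) = \sum_(i < k.+1) dts i f * dts (k - i) g.
Proof.
apply: tseriesP => m; rewrite tcoef_sum [LHS]tcoef_mul.
under [RHS]eq_bigr do rewrite tcoef_mul.
rewrite -(big_mkord xpredT (fun i => \sum_(p <- fset_set (factorizations m))
  tcoef (dts i f) p.1 * tcoef (dts (k - i) g) p.2)).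
pose c i (p : {cmonom nat} * {cmonom nat}) := (consm i p.1, consm (k - i) p.2).
transitivity (\sum_(p <- [seq c i p | i <- index_iota 0 k.+1, p <- fset_set (factorizations m)])
  tcoef f p.1 * tcoef g p.2); last by rewrite big_allpairs_dep.
apply: perm_big; apply: uniq_perm; first exact: fset_uniq.
  apply: allpairs_uniq; [exact: iota_uniq|exact: fset_uniq|].
  move=> [i [a b]] [j [a' b']] _ _ /= [/consm_inj[-> ->] /consm_inj[_ ->]] //.
move=> [a b]; rewrite mem_factorizations; apply/eqP/allpairsPdep => [e|].
  have := e; rewrite /= {1}(consm_eta a) {1}(consm_eta b) consmM => /consm_inj[ek em].
  exists (a 0%N), (tailm a, tailm b) => /=; split.
  - by rewrite mem_index_iota -ek /= ltnS leq_addr.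
  - by rewrite mem_factorizations em.
  - by rewrite /c /= -consm_eta; congr pair; rewrite {1}(consm_eta b) -ek addKn.
case=> i [[a' b'] []]; rewrite mem_index_iota mem_factorizations /= => ik /eqP <- [-> ->].
by rewrite consmM; congr consm; lia.
Qed.

Definition dS k F : {poly tseries K} := map_poly (dts k) F.

Lemma coef_dS k F j : (dS k F)`_j = dts k F`_j.
Proof. by rewrite coef_map_id0 // dts0. Qed.

Lemma dS_add k F G : dS k (F + G) = dS k F + dS k G.
Proof. by apply/polyP => j; rewrite coefD !coef_dS coefD dts_add. Qed.

Lemma dS0 k : dS k 0 = 0.
Proof. by apply/polyP => j; rewrite coef_dS !coef0 dts0. Qed.

Lemma dSM k F G : dS k (F * G) = \sum_(i < k.+1) dS i F * dS (k - i) G.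
Proof.
apply/polyP => j; rewrite coef_dS coefM dts_sum coef_sum.
under [RHS]eq_bigr do rewrite coefM.
rewrite exchange_big; apply: eq_bigr => l _; rewrite dtsM; apply: eq_bigr => i _.
by rewrite !coef_dS.
Qed.

End Shift.

Section Scalars.
Local Notation T := (tseries rat).
Local Notation S := {poly tseries rat}.

Lemma dts_tsC k (c : rat) (f : T) : dts k (tsC c * f) = tsC c * dts k f.
Proof.
have d0 : dts 0 (tsC c) = tsC c.
  apply: tseriesP => m' /=; rewrite -{1}consm01; case: eqP => [/consm_inj[_ ->]|ne].
    by rewrite eqxx.
  by case: eqP ne => // -> [].
have dS i : dts i.+1 (tsC c) = 0.
  apply: tseriesP => m' /=; rewrite if_same; case: eqP => // /(congr1 (fun x : {cmonom nat} => x 0%N)).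
  by rewrite consmE cm1.
rewrite dtsM big_ord_recl /= d0 subn0 big1 ?addr0 // => i _.
by rewrite dS mul0r.
Qed.

Lemma tcoefCM (c : rat) (f : T) m : tcoef (tsC c * f) m = c * tcoef f m.
Proof.
elim/consm_ind: m c f => [|k m IH] c f; first by rewrite tcoefM1 /= eqxx.
by rewrite -[LHS]/(tcoef (dts k (tsC c * f)) m) dts_tsC IH.
Qed.

Definition scal (c : rat) : S := (tsC c)%:P.

Fact tsC_is_additive : additive (@tsC rat).
Proof. by move=> a b; apply: tseriesP => m /=; case: eqP; rewrite ?subr0. Qed.

Fact scal_is_additive : additive scal.
Proof. by move=> a b; rewrite /scal tsC_is_additive polyCB. Qed.

Fact scal_is_monoid : monoid_morphism scal.
Proof.
split; first by rewrite /scal polyC1.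
move=> a b; rewrite /scal -polyCM; congr (_%:P); apply: tseriesP => m.
by rewrite tcoefCM /=; case: eqP; rewrite ?mulr0.
Qed.

HB.instance Definition _ := GRing.isZmodMorphism.Build rat S scal scal_is_additive.
HB.instance Definition _ := GRing.isMonoidMorphism.Build rat S scal scal_is_monoid.

Lemma coef_scal (c : rat) (F : S) j m : tcoef (scal c * F)`_j m = c * tcoef F`_j m.
Proof. by rewrite coefCM tcoefCM. Qed.

Lemma dS_scal k c (F : S) : dS k (scal c * F) = scal c * dS k F.
Proof.
by apply/polyP => j; rewrite coef_dS /scal !coefCM dts_tsC coef_dS.
Qed.

End Scalars.

(** * Homogeneous elements and their operations *)

Section FlagAlgebra.
Variable R : realType.
Local Notation T := (tseries rat).
Local Notation S := {poly tseries rat}.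
Implicit Types (F G H : S) (n k j : nat).

(* [F] is the homogeneous element of degree [n] with coefficients [g]; over the
   rationals these are the elements of degree [n] of [f(P) (x) Q]. *)
Definition coefs F (g : nat -> seq nat -> rat) := forall j m, tcoef F`_j m = g j (word m).

Definition homog n F := exists2 g, dehn_sommerville n g & coefs F g.

Lemma coefs_inj F G g : coefs F g -> coefs G g -> F = G.
Proof.
by move=> Fg Gg; apply/polyP => j; apply: tseriesP => m; rewrite Fg Gg.
Qed.

Lemma coefs_lin c F G g h : coefs F g -> coefs G h ->
  coefs (scal c * F + G) (fun j w => c * g j w + h j w).
Proof. by move=> Fg Gh j m; rewrite coefD tcoefD coef_scal Fg Gh. Qed.

Lemma homog_lin n c F G : homog n F -> homog n G -> homog n (scal c * F + G).
Proof.
move=> [g dg Fg] [h dh Gh]; exists (fun j w => c * g j w + h j w); first exact: ds_lin.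
exact: coefs_lin.
Qed.

Lemma homog0 n : homog n 0.
Proof.
exists (fun _ _ => 0) => [|j m]; last by rewrite coef0 tcoef0.
split=> // [j u|j u v m _]; first by rewrite big1 // => i _; rewrite mulr0.
by rewrite big1 // => i _; rewrite mulr0.
Qed.

Lemma homogD n F G : homog n F -> homog n G -> homog n (F + G).
Proof. by move=> nF nG; have := homog_lin 1 nF nG; rewrite rmorph1 mul1r. Qed.

Lemma homogZ n c F : homog n F -> homog n (scal c * F).
Proof. by move=> nF; have := homog_lin c nF (homog0 n); rewrite addr0. Qed.

Lemma homog_sum n (I : Type) (r : seq I) (P : pred I) (E : I -> S) :
  (forall i, P i -> homog n (E i)) -> homog n (\sum_(i <- r | P i) E i).
Proof. by move=> nE; apply: big_ind => //; [exact: homog0|exact: homogD]. Qed.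

Definition frat (P : polytope R) : S := map_poly tseries_rat (f_polynomial P).

Lemma tseries_rat0 : tseries_rat 0 = 0.
Proof. by apply: tseriesP => m; rewrite -[LHS]/((tcoef 0 m)%:~R) !tcoef0. Qed.

Lemma coefs_frat P X : models P X -> coefs (frat P) (fun j w => fl w j (rtop X)).
Proof.
move=> PX j m; rewrite coef_map_id0; last exact: tseries_rat0.
exact: f_polynomial_coef.
Qed.

Lemma homog_frat P X : models P X -> homog (rrk (rtop X)) (frat P).
Proof.
move=> PX; exists (fun j w => fl w j (rtop X)); last exact: coefs_frat.
exact/ds_fl/models_eulerian/PX.
Qed.

Lemma frat_comb_class P : frat (repr (comb_class P)) = frat P.
Proof.
have [X PX _] := models_exists P.
apply: (coefs_inj _ (coefs_frat PX)); apply: coefs_frat.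
by apply: models_equiv PX; apply: order_iso_sym; exact: repr_comb_class.
Qed.

Definition realized (X : rposet) := exists P : polytope R, models P X.

Lemma homog_flspan n F : homog n F -> exists2 g, flspan realized n g & coefs F g.
Proof.
move=> [g dg Fg]; exists g => //; apply: ds_flspan => //.
- by move=> X [P PX]; exact: models_eulerian PX.
- by exists (Defs.point R); exact: models_point.
- by move=> X Y [P PX] [Q QY]; exists (polytope_prod P Q); exact: models_prod.
- by move=> X [P PX]; exact: models_cone PX.
Qed.

(** Every solution of the relations is a combination of f-polynomials, so linear properties need
    only be checked on polytopes. *)
Lemma homog_ind n (E : S -> Prop) : E 0 ->
  (forall c P X F, models P X -> rrk (rtop X) = n -> homog n F -> E F -> E (scal c * frat P + F)) ->
  forall F, homog n F -> E F.
Proof.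
move=> E0 ED F /homog_flspan[g sg]; elim: sg F => {g} [g g0|X c h g [P PX] rX sh IH gE] F Fg.
  by rewrite (@coefs_inj F 0 (fun _ _ => 0)) // => j m; rewrite ?coef0 ?tcoef0 // Fg g0.
have Gh : coefs (F - scal c * frat P) h.
  move=> j m; rewrite coefB tcoefD tcoefN coef_scal Fg gE (coefs_frat PX).
  by rewrite addrC addKr.
have -> : F = scal c * frat P + (F - scal c * frat P) by rewrite addrC subrK.
apply: (ED c P X) => //; last exact: IH.
exists h => //; apply: (flspan_ds _ sh) => Y [Q QY]; exact: models_eulerian QY.
Qed.

(* Both sides satisfy the same recursion in the first variable. *)
Lemma frat_prod P Q : frat (polytope_prod P Q) = frat P * frat Q.
Proof.
have [X PX _] := models_exists P; have [Y QY _] := models_exists Q.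
apply: (coefs_inj (coefs_frat (models_prod PX QY))).
(* Defined for every face [z] and not only for the top, because the recursion in the first variable
   descends to faces. *)
pose e (Z : rposet) (z : Z) j : T := TSeries (fun m => fl (word m) j z).
have eE (Z : rposet) (z : Z) j k : dts k (e Z z j) = \sum_(y | rle y z && (rrk y + k == rrk z)%N) e Z y j.
  apply: tseriesP => m; rewrite tcoef_sum /= word_consm.
  by have [->|_] //= := eqVneq k 0%N; rewrite -[RHS]/(csum 0 z (fl (word m) j)) csum0.
have eM m : forall j (x : X) (y : Y),
    tcoef (\sum_(i < j.+1) e X x i * e Y y (j - i)%N) m = fl (word m) j ((x, y) : rprod X Y).
  elim/consm_ind: m => [|k m IH] j x y.
    rewrite tcoef_sum; under eq_bigr do rewrite tcoefM1.
    rewrite /= word1 /= /rprod_rk /=.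
    have [le|lt] := leqP (rrk x) j; last first.
      rewrite big1 => [|i _]; first by rewrite gtn_eqF //; lia.
      by have := ltn_ord i; case: eqP => [e1|_]; [lia|rewrite mul0r].
    rewrite (bigD1 (Ordinal (le : rrk x < j.+1)%N)) //= eqxx mul1r big1 ?addr0 => [|i ne].
      by congr (nat_of_bool _)%:R; lia.
    case: eqP => [e1|_]; last exact: mul0r.
    by case/eqP: ne; apply: val_inj.
  have -> : fl (word (consm k m)) j ((x, y) : rprod X Y) =
      @csum (rprod X Y) k (x, y) (fl (word m) j).
    by rewrite word_consm; have [->|] := eqVneq k 0%N; rewrite ?csum0.
  rewrite csum_prod.
  rewrite -[LHS]/(tcoef (dts k (\sum_(i < j.+1) e X x i * e Y y (j - i)%N)) m).
  rewrite dts_sum; under eq_bigr do rewrite dtsM.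
  rewrite exchange_big tcoef_sum; apply: eq_bigr => l _.
  under eq_bigr do rewrite !eE big_distrlr /=.
  rewrite exchange_big tcoef_sum; apply: eq_bigr => x' _.
  rewrite exchange_big tcoef_sum; apply: eq_bigr => y' _.
  exact: IH.
move=> j m; rewrite -[RHS]eM coefM; congr (tcoef _ m); apply: eq_bigr => i _.
by congr (_ * _); apply: tseriesP => m'; rewrite (coefs_frat PX, coefs_frat QY).
Qed.

(** By bilinearity both factors may be taken to be f-polynomials, whose product is that of a
    polytope. *)
Lemma homogM n k F G : homog n F -> homog k G -> homog (n + k) (F * G).
Proof.
move=> nF kG; elim/homog_ind: nF => [|c P X {}F PX rX nF IH].
  by rewrite mul0r; exact: homog0.
rewrite mulrDl; apply: homogD => //; rewrite -mulrA; apply: homogZ => {F nF IH}.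
elim/homog_ind: kG => [|d Q Y {}G QY rY kG IH]; first by rewrite mulr0; exact: homog0.
rewrite mulrDr; apply: homogD => //; rewrite mulrCA; apply: homogZ.
rewrite -frat_prod -rX -rY; exact: homog_frat (models_prod PX QY).
Qed.

Lemma homog_dS n k F : homog n F -> homog (n - k) (dS k F).
Proof.
move=> [g dg Fg]; have [kn|nk] := leqP k n; last first.
  rewrite (_ : dS k F = 0); first exact: homog0.
  apply/polyP => j; apply: tseriesP => m; rewrite coef_dS coef0 tcoef0 /= Fg word_consm.
  by rewrite ifF; [apply: (ds_deg dg) => /=; lia|lia].
exists (fun j w => g j (k :: w)); first exact: ds_cons.
move=> j m; rewrite coef_dS /= Fg word_consm; case: eqP => // ->.
exact: esym (ds_cat0 dg j [::] (word m)).
Qed.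

Lemma dS0_homog n F : homog n F -> dS 0 F = F.
Proof.
move=> [g dg Fg]; apply: (coefs_inj _ Fg) => j m.
by rewrite coef_dS /= Fg word_consm.
Qed.

Lemma homog_deg n F m j : homog n F -> tcoef F`_j m != 0 -> (j + sumn (word m) = n)%N.
Proof.
move=> [g dg Fg]; rewrite Fg => nz; apply/eqP; apply: contraNT nz => ne.
by rewrite (ds_deg dg).
Qed.

Lemma homog1 : homog 0 1.
Proof.
suff <- : frat (Defs.point R) = 1 by exact: homog_frat (models_point R).
apply: (coefs_inj (coefs_frat (models_point R))) => j m; rewrite fl_rpt coef1.
have -> : (sumn (word m) == 0)%N = (m == 1%M).
  rewrite -word_nil; case: (word m) (word_pos m) => //= k w /andP[k0 _].
  by rewrite addn_eq0 eqn0Ngt k0.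
by case: j => [|j]; rewrite ?andbF ?andbT ?tcoef0 ?tcoef1.
Qed.

Definition mon (w : seq nat) : {cmonom nat} := foldr consm 1%M w.

Lemma word_mon w : word (mon w) = filter (ltn 0) w.
Proof. by elim: w => [|k w IH] /=; rewrite ?word1 // word_consm IH lt0n; case: eqP. Qed.

Lemma homogX2 n F : homog n F -> homog n.+2 ('X^2 * F).
Proof.
move=> /homog_flspan[g sg Fg].
have C_pt : realized rpt by exists (Defs.point R); exact: models_point.
have C_prod X Y : realized X -> realized Y -> realized (rprod X Y).
  by move=> [P PX] [Q QY]; exists (polytope_prod P Q); exact: models_prod.
have C_cone X : realized X -> realized (rcone X) by move=> [P PX]; exact: models_cone PX.
have [h sh [h0 hS]] := flspan_alpha2 C_pt C_prod C_cone sg.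
exists h.
  by apply: (flspan_ds _ sh) => X [P PX]; exact: models_eulerian PX.
move=> j m; rewrite coefXnM; case: ltnP => j2; first by rewrite tcoef0 h0.
by rewrite Fg -hS; congr (h _ _); lia.
Qed.

Lemma homog_ker n F : homog n F -> F`_0 = 0 -> exists2 G, homog (n - 2) G & F = 'X^2 * G.
Proof.
move=> [g dg Fg] F0.
(* [F] only determines [g] on words with positive letters; [ds_filter] covers the others. *)
have g0 w : g 0%N w = 0.
  by rewrite (ds_filter _ _ dg) -word_mon -Fg F0 tcoef0.
have [g1 dg2] := ds_divisible dg g0.
exists (drop_poly 2 F).
  have [n1|n1] := ltnP 1 n.
    exists (fun j w => g j.+2 w); first exact: dg2.
    by move=> j m; rewrite coef_drop_poly Fg addn2.
  rewrite (_ : drop_poly 2 F = 0); first exact: homog0.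
  apply/polyP => j; apply: tseriesP => m.
  by rewrite coef_drop_poly Fg coef0 tcoef0 (ds_deg dg) //; lia.
apply/polyP => j; rewrite coefXnM; case: ltnP => j2.
  case: j j2 => [|[|j]] // _; apply: tseriesP => m.
  by rewrite Fg g1 tcoef0.
by rewrite coef_drop_poly subnK.
Qed.

End FlagAlgebra.

Section GradedAlgebra.
Variable R : realType.
Local Notation T := (tseries rat).
Local Notation S := {poly tseries rat}.
Implicit Types (F G H : S) (n k j : nat).

Definition graded G := exists N (E : nat -> S), (forall n, homog n (E n)) /\ G = \sum_(n < N) E n.

Lemma graded_ind (T : S -> Prop) : T 0 -> (forall F G, T F -> T G -> T (F + G)) ->
  (forall n F, homog n F -> T F) -> forall G, graded G -> T G.
Proof.
by move=> T0 TD Th G [N [E [hE ->]]]; apply: big_ind => // i _; exact: Th (hE i).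
Qed.

Lemma graded_homog n F : homog n F -> graded F.
Proof.
move=> nF; exists n.+1, (fun k => if k == n then F else 0); split=> [k|].
  by case: eqP => [->//|_]; exact: homog0.
rewrite (bigD1 ord_max) //= eqxx big1 ?addr0 // => i ne.
by rewrite ifN //; apply: contraNneq ne => e; apply/eqP/val_inj.
Qed.

Lemma graded0 : graded 0. Proof. exact: graded_homog (homog0 0). Qed.

Lemma gradedD F G : graded F -> graded G -> graded (F + G).
Proof.
move=> [N [E [hE ->]]] [M [D [hD ->]]].
exists (maxn N M), (fun n => (if (n < N)%N then E n else 0) + (if (n < M)%N then D n else 0)).
split=> [n|]; first by apply: homogD; case: ifP => // _; exact: homog0.
rewrite big_split /=; congr (_ + _).
  rewrite -big_mkcond -(big_mkord (fun n => n < N)%N) -(big_mkord xpredT).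
  rewrite (big_nat_widen _ _ _ _ _ (leq_maxl N M)).
  by apply: eq_bigl => i; rewrite andTb.
rewrite -big_mkcond -(big_mkord (fun n => n < M)%N) -(big_mkord xpredT).
rewrite (big_nat_widen _ _ _ _ _ (leq_maxr N M)).
by apply: eq_bigl => i; rewrite andTb.
Qed.

Lemma graded_sum (I : Type) (r : seq I) (P : pred I) (E : I -> S) :
  (forall i, P i -> graded (E i)) -> graded (\sum_(i <- r | P i) E i).
Proof. by move=> gE; apply: big_ind => //; [exact: graded0|exact: gradedD]. Qed.

Lemma gradedM F G : graded F -> graded G -> graded (F * G).
Proof.
move=> gF gG; elim/graded_ind: gF => [|F1 F2 g1 g2|n {}F nF].
- by rewrite mul0r; exact: graded0.
- by rewrite mulrDl; exact: gradedD.
elim/graded_ind: gG => [|G1 G2 g1 g2|k {}G kG].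
- by rewrite mulr0; exact: graded0.
- by rewrite mulrDr; exact: gradedD.
exact: graded_homog (homogM R nF kG).
Qed.

Lemma gradedZ c F : graded F -> graded (scal c * F).
Proof.
elim/graded_ind => [|F1 F2 g1 g2|n {}F nF].
- by rewrite mulr0; exact: graded0.
- by rewrite mulrDr; exact: gradedD.
exact: graded_homog (homogZ c nF).
Qed.

Lemma graded_dS k F : graded F -> graded (dS k F).
Proof.
elim/graded_ind => [|F1 F2 g1 g2|n {}F nF].
- by rewrite dS0; exact: graded0.
- by rewrite dS_add; exact: gradedD.
exact: graded_homog (homog_dS k nF).
Qed.

Lemma dS0_graded F : graded F -> dS 0 F = F.
Proof.
elim/graded_ind => [|F1 F2 g1 g2|n {}F nF]; first exact: dS0.
  by rewrite dS_add g1 g2.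
exact: dS0_homog nF.
Qed.

Lemma graded1 : graded 1. Proof. exact: graded_homog (homog1 R). Qed.

Lemma gradedX2 : graded 'X^2.
Proof. by rewrite -['X^2]mulr1; exact: graded_homog (homogX2 R (homog1 R)). Qed.

(** At alpha = 0 a monomial determines the degree of the component it comes from, so every
    homogeneous component vanishes there. *)
Lemma graded_ker F : graded F -> F`_0 = 0 -> exists2 G, graded G & F = 'X^2 * G.
Proof.
move=> [N [E [hE FE]]] F0.
have E0 (n : 'I_N) : (E n)`_0 = 0.
  apply: tseriesP => m; rewrite tcoef0; apply/eqP/negPn/negP => nz.
  have nE := homog_deg (hE n) nz; move: F0 => /(congr1 (fun f => tcoef f m)).
  rewrite FE coef_sum tcoef_sum (bigD1 n) // big1 => [e|k ne].
    by rewrite tcoef0 /= addr0 in e; rewrite e eqxx in nz.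
  apply/eqP/negPn/negP => /(homog_deg (hE k)) e.
  by case/eqP: ne; apply: val_inj; rewrite /= -e -nE.
have /choice[D DP] (n : 'I_N) : exists G, homog (n - 2) G /\ E n = 'X^2 * G.
  by have [G ? ?] := homog_ker (hE n) (E0 n); exists G.
exists (\sum_n D n); last by rewrite FE mulr_sumr; apply: eq_bigr => n _; have [] := DP n.
by apply: graded_sum => n _; have [h _] := DP n; exact: graded_homog h.
Qed.

Lemma tcoef_mulrz (f : tseries int) (z : int) m : tcoef (f *~ z) m = tcoef f m *~ z.
Proof.
case: z => n; first by rewrite -!pmulrn tcoefMn.
by rewrite !NegzE !mulrNz tcoefN -!pmulrn tcoefMn.
Qed.

Let A : set S := tensor_rat (@f_image R).

Lemma tensor_rat_add F G : A F -> A G -> A (F + G).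
Proof.
move=> [n [c [x [xA ->]]]] [m [d [y [yA ->]]]].
exists (n + m)%N, (fun i => match fintype.split i with inl j => c j | inr j => d j end).
exists (fun i => match fintype.split i with inl j => x j | inr j => y j end).
split=> [i|]; first by case: fintype.split.
rewrite big_split_ord /=; congr (_ + _); apply: eq_bigr => i _.
  by rewrite (unsplitK (inl i)).
by rewrite (unsplitK (inr i)).
Qed.

Lemma tensor_rat0 : A 0.
Proof.
exists 0%N, (fun=> 0), (fun=> f_map (0 : polytope_ring R)); split=> [[]//|].
by rewrite big_ord0.
Qed.

Lemma tensor_rat_frat c (P : polytope R) : A (scal c * frat P).
Proof.
exists 1%N, (fun=> c), (fun=> f_map (<< comb_class P >> : polytope_ring R)); split=> [_|].
  by exists << comb_class P >>.
by rewrite big_ord1 /f_map mmapU /= mulr1z mul1r -/(frat _) frat_comb_class -mul_polyC.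
Qed.

Lemma tensor_ratE : A = graded.
Proof.
apply/seteqP; split=> F; last first.
  move=> gF; elim/graded_ind: gF => [|F1 F2|n {}F nF].
  - exact: tensor_rat0.
  - exact: tensor_rat_add.
  elim/(homog_ind (R := R)): nF => [|c P X {}F _ _ _ AF]; first exact: tensor_rat0.
  by apply: tensor_rat_add AF; exact: tensor_rat_frat.
move=> [n [c [x [xA ->]]]]; apply: graded_sum => i _.
rewrite -mul_polyC; apply: gradedZ; have [y _ <-] := xA i.
have -> : map_poly tseries_rat (f_map y) =
    \sum_(k <- msupp y) scal (y@_k)%:~R * frat (repr k).
  apply/polyP => j; apply: tseriesP => m.
  rewrite coef_map_id0 ?tseries_rat0 // -[LHS]/((tcoef (f_map y)`_j m)%:~R).
  rewrite /f_map mmapE !coef_sum !tcoef_sum raddf_sum; apply: eq_bigr => k _.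
  rewrite coef_scal coef_map_id0 ?tseries_rat0 // -[tcoef (tseries_rat _) m]/((tcoef _ m)%:~R).
  rewrite mulrzl coefMrz tcoef_mulrz mulrzz mulrC.
  exact: intrM.
apply: graded_sum => k _; apply: gradedZ.
have [X PX _] := models_exists (repr k); exact: graded_homog (homog_frat PX).
Qed.

End GradedAlgebra.

(** * Complements and dual functionals in finite dimension *)

Section Complement.
Variables (K : fieldType) (N : nat).
Implicit Types (E D : 'rV[K]_N -> Prop) (u v : 'rV[K]_N).

Definition subspace E := E 0 /\ forall a u v, E u -> E v -> E (a *: u + v).

Lemma subspace_mx E : subspace E -> exists M : 'M[K]_N, forall u, E u <-> (u <= M)%MS.
Proof.
move=> [E0 Elin].
pose P k := `[< exists M : 'M[K]_N, \rank M = k /\ forall u, (u <= M)%MS -> E u >].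
have P0 : exists k, P k.
  exists 0%N; apply/asboolP; exists 0; split; first exact: mxrank0.
  by move=> u /submx0null ->.
have PN k : P k -> (k <= N)%N by move=> /asboolP[M [<- _]]; exact: rank_leq_row.
case: (ex_maxnP P0 PN) => k /asboolP[M [rM ME]] kmax; exists M => u; split=> [Eu|]; last exact: ME.
have : P (\rank (M + u)%MS).
  apply/asboolP; exists (M + u)%MS; split=> // w /sub_addsmxP[[a b] /= ->].
  have /sub_rVP[c ->] : (b *m u <= u)%MS by exact: submxMl.
  rewrite addrC; apply: Elin => //.
  by apply: ME; exact: submxMl.
move=> /kmax le; have := mxrank_leqif_sup (addsmxSl M u); rewrite rM.
move=> [le' eq]; have /esym := eq; rewrite eqn_leq le' le /=.
by rewrite addsmx_sub => /andP[].
Qed.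

Lemma complement E D : subspace E -> subspace D -> (forall u, D u -> E u) ->
  exists r (x : 'I_r -> 'rV[K]_N) (phi : 'M[K]_(N, r)),
  [/\ forall i, E (x i), forall i j, (x j *m phi) 0 i = (i == j)%:R,
      forall u, D u -> u *m phi = 0 &
      forall u, E u -> D (u - \sum_i (u *m phi) 0 i *: x i)].
Proof.
move=> /subspace_mx[ME EE] /subspace_mx[MD DD] DE.
have sDE : (MD <= ME)%MS by apply/row_subP => i; apply/EE/DE/DD; exact: row_sub.
pose C := (ME :\: MD)%MS.
have CD0 : (C :&: MD)%MS = 0 by exact: capmx_diff.
have CE : (C <= ME)%MS by exact: diffmxSl.
have ECD : (ME <= C + MD)%MS.
  by rewrite -(addsmx_diff_cap_eq ME MD) addsmxS // capmxSr.
(* Projection onto the complement [C] along [MD], followed by coordinates in the basis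
   [row_base C]. *)
pose phi := proj_mx C MD *m pinvmx (row_base C).
exists (\rank C), (fun i => row i (row_base C)), phi; split.
- move=> i; apply/EE; apply: submx_trans CE.
  by apply: submx_trans (row_sub _ _) _; rewrite eq_row_base.
- move=> i j; rewrite /phi mulmxA proj_mx_id //; last first.
    by apply: submx_trans (row_sub _ _) _; rewrite eq_row_base.
  by rewrite -row_mul mulmxVp ?row_base_free // !mxE eq_sym.
- by move=> u /DD uD; rewrite /phi mulmxA proj_mx_0 // mul0mx.
- move=> u /EE uE; have uCD := submx_trans uE ECD.
  rewrite -mulmx_sum_row /phi mulmxA mulmxKpV; first by apply/DD; exact: proj_mx_compl_sub.
  by rewrite eq_row_base proj_mx_sub.
Qed.

End Complement.

(** * Freeness *)

Section Indecomposables.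
Local Notation T := (tseries rat).
Local Notation S := {poly tseries rat}.
Implicit Types (F G H : S) (n k j : nat).

(** A word of degree at most [n] with positive letters has at most [n] of them and can be padded
    with zeros to length [n]. So finitely many coefficients determine a homogeneous element. *)
Definition coord_type n : predArgType := ('I_n.+1 * n.-tuple 'I_n.+1)%type.

(** The test on the degree makes the coordinates, and hence the functionals built on them, vanish on
    all other degrees. *)
Definition coords n F : 'rV[rat]_#|coord_type n| :=
  \row_(p < #|coord_type n|) let: (j, t) := (enum_val p : coord_type n) in
    if (j + sumn (map val t) == n)%N then tcoef F`_j (mon (map val t)) else 0.

Lemma coords_lin n c F G : coords n (scal c * F + G) = c *: coords n F + coords n G.
Proof.
apply/rowP => p; rewrite !mxE; case: (enum_val p) => j t.
by case: ifP => _; rewrite ?mulr0 ?addr0 // coefD tcoefD coef_scal.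
Qed.

Lemma sumn_filter w : sumn (filter (ltn 0) w) = sumn w.
Proof. by elim: w => [|[|k] w IH] //=; rewrite IH. Qed.

Lemma coords_deg n k F : homog k F -> k != n -> coords n F = 0.
Proof.
move=> kF ne; apply/rowP => p; rewrite !mxE; case: (enum_val p) => j t.
case: eqP => // e; apply/eqP/negPn/negP => /(homog_deg kF).
by rewrite word_mon sumn_filter e => e'; rewrite e' eqxx in ne.
Qed.

Lemma coords_inj n F : homog n F -> coords n F = 0 -> F = 0.
Proof.
move=> nF c0; have [g dg Fg] := nF.
apply/polyP => j; apply: tseriesP => m; rewrite coef0 tcoef0.
apply/eqP/negPn/negP => nz; have e := homog_deg nF nz.
set w := word m in e; have w_pos : all (ltn 0) w := word_pos m.
have size_w : (size w <= n)%N by rewrite (leq_trans (size_le_sumn w_pos)) // -e leq_addl.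
pose s := w ++ nseq (n - size w) 0%N.
have sz : size [seq inord k : 'I_n.+1 | k <- s] == n.
  by rewrite size_map size_cat size_nseq subnKC.
have sn : all (fun k => k < n.+1)%N s.
  rewrite all_cat all_nseq orbT andbT; apply/allP => k kw.
  rewrite ltnS -e (leq_trans _ (leq_addl _ _)) //.
  by rewrite (perm_sumn (perm_to_rem kw)) /= leq_addr.
have valE : map val (Tuple sz) = s.
  rewrite /= -map_comp -[RHS]map_id; apply/eq_in_map => k ks /=.
  by rewrite inordK //; exact: (allP sn).
have sumn_s : sumn s = sumn w by rewrite sumn_cat sumn_nseq mul0n addn0.
have jn : (j < n.+1)%N by rewrite ltnS -e leq_addr.
move: c0 => /rowP/(_ (enum_rank (Ordinal jn, Tuple sz) : 'I_#|coord_type n|)).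
rewrite !mxE enum_rankK valE /= sumn_s e eqxx Fg word_mon filter_cat.
rewrite (eq_in_filter (a2 := pred0) (s := nseq _ _)); last by move=> k; rewrite mem_nseq => /andP[_ /eqP->].
rewrite filter_pred0 cats0 (all_filterP w_pos) => g0.
by rewrite Fg g0 eqxx in nz.
Qed.

Inductive decomposable n : S -> Prop :=
| Dec0 : decomposable n 0
| DecM i F G H : (0 < i)%N -> (i < n)%N -> homog i F -> homog (n - i) G -> decomposable n H ->
    decomposable n (F * G + H)
| DecX F H : (1 < n)%N -> homog (n - 2) F -> decomposable n H -> decomposable n ('X^2 * F + H).

Lemma dec_lin n c F G : decomposable n F -> decomposable n G -> decomposable n (scal c * F + G).
Proof.
move=> dF dG; elim: dF => {F} [|i F1 F2 H i0 iN h1 h2 _ IH|F H n1 h _ IH].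
- by rewrite mulr0 add0r.
- rewrite mulrDr -addrA mulrA; apply: DecM i0 iN _ h2 IH.
  exact: homogZ.
- by rewrite mulrDr -addrA mulrCA; apply: DecX n1 _ IH; exact: homogZ.
Qed.

Variable R : realType.

Lemma dec_homog n F : decomposable n F -> homog n F.
Proof.
elim=> {F} [|i F1 F2 H i0 iN h1 h2 _ nH|F H n1 h _ nH]; first exact: homog0.
  by apply: homogD => //; have := homogM R h1 h2; rewrite subnKC // ltnW.
apply: homogD => //; have := homogX2 R h; congr homog; lia.
Qed.

(* [x] is a basis of a complement of the decomposables in degree [n], with dual
   functionals [phi]. *)
Definition is_basis n r (x : 'I_r -> S) (phi : 'I_r -> S -> rat) :=
  [/\ forall i, homog n (x i),
      forall i c F G, phi i (scal c * F + G) = c * phi i F + phi i G,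
      forall i (l : 'I_r), phi i (x l) = (i == l)%:R,
      forall i F, decomposable n F -> phi i F = 0 &
      (forall i k F, homog k F -> k != n -> phi i F = 0) /\
      forall F, homog n F -> decomposable n (F - \sum_i scal (phi i F) * x i)].

Lemma basis_exists n :
  {r : nat & {x : 'I_r -> S & {phi : 'I_r -> S -> rat | is_basis n x phi}}}.
Proof.
suff /cid[r /cid[x /cid[phi h]]] : exists r (x : 'I_r -> S) (phi : 'I_r -> S -> rat), is_basis n x phi.
  by exists r, x, phi.
pose E u := exists2 F, homog n F & u = coords n F.
pose D u := exists2 F, decomposable n F & u = coords n F.
have c0 : coords n 0 = 0.
  by have := coords_lin n 1 0 0; rewrite mulr0 addr0 scale1r => /eqP; rewrite -subr_eq0 opprD addNKr oppr_eq0 => /eqP.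
have [|||r [x [phi [xE xphi phiD phiE]]]] := @complement rat _ E D.
- split=> [|a u v [F nF ->] [G nG ->]]; first by exists 0; rewrite ?c0 //; exact: homog0.
  by exists (scal a * F + G); rewrite ?coords_lin //; exact: homog_lin.
- split=> [|a u v [F nF ->] [G nG ->]]; first by exists 0; rewrite ?c0 //; exact: Dec0.
  by exists (scal a * F + G); rewrite ?coords_lin //; exact: dec_lin.
- by move=> u [F dF ->]; exists F => //; exact: dec_homog.
have /choice[y yP] i : exists F, homog n F /\ x i = coords n F.
  by have [F ? ?] := xE i; exists F.
exists r, y, (fun i F => (coords n F *m phi) 0 i).
split.
- by move=> i; have [] := yP i.
- by move=> i c F G; rewrite coords_lin mulmxDl -scalemxAl !mxE.
- by move=> i j; have [_ <-] := yP j; exact: xphi.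
- by move=> i F dF; rewrite (phiD (coords n F)) ?mxE //; exists F.
split=> [i k F kF ne|F nF]; first by rewrite (coords_deg kF ne) mul0mx mxE.
have [G dG e] := phiE (coords n F) (ex_intro2 _ _ F nF erefl).
suff -> : F - \sum_i scal ((coords n F *m phi) 0 i) * y i = G by [].
apply/eqP; rewrite -subr_eq0; apply/eqP; apply: (@coords_inj n).
  have hs : homog n (\sum_i scal ((coords n F *m phi) 0 i) * y i).
    by apply: homog_sum => i _; apply: homogZ; have [] := yP i.
  have := homog_lin (-1) (dec_homog dG) (homog_lin (-1) hs nF).
  by rewrite !rmorphN1 !mulN1r addrC [- _ + F]addrC.
have csum (s : 'I_r -> rat) : coords n (\sum_i scal (s i) * y i) = \sum_i s i *: x i.
  apply: (big_ind2 (fun a b => coords n a = b)) => //.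
    by move=> a1 b1 a2 b2 <- <-; have := coords_lin n 1 a1 a2; rewrite rmorph1 mul1r scale1r.
  move=> i _; have [_ ->] := yP i.
  by have := coords_lin n (s i) (y i) 0; rewrite addr0 c0 addr0.
have := coords_lin n (-1) G (F - \sum_i scal ((coords n F *m phi) 0 i) * y i).
rewrite rmorphN1 mulN1r addrC => ->; rewrite scaleN1r -e.
have := coords_lin n (-1) (\sum_i scal ((coords n F *m phi) 0 i) * y i) F.
by rewrite rmorphN1 mulN1r addrC => ->; rewrite csum scaleN1r addrC [- _ + _]addrC subrr.
Qed.

End Indecomposables.

(** * The derivation attached to a functional *)

Section Derivation.
Local Notation T := (tseries rat).
Local Notation S := {poly tseries rat}.
Implicit Types (F G H : S) (n k j : nat).

Variables (R : realType) (n : nat) (phi : S -> rat).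
Hypothesis n_gt0 : (0 < n)%N.
Hypothesis phi_lin : forall c F G, phi (scal c * F + G) = c * phi F + phi G.
Hypothesis phi_dec : forall F, decomposable n F -> phi F = 0.
Hypothesis phi_deg : forall k F, homog k F -> k != n -> phi F = 0.

Lemma phi0 : phi 0 = 0.
Proof. exact: phi_dec (Dec0 n). Qed.

Lemma phiD F G : phi (F + G) = phi F + phi G.
Proof. by have := phi_lin 1 F G; rewrite rmorph1 !mul1r. Qed.

Lemma phiZ c F : phi (scal c * F) = c * phi F.
Proof. by have := phi_lin c F 0; rewrite addr0 phi0 addr0. Qed.

Definition eps F : rat := tcoef F`_0 1%M.

Lemma homog0_scal F : homog 0 F -> F = scal (eps F).
Proof.
move=> hF; apply/polyP => j; apply: tseriesP => m; rewrite coefC.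
have [->|j0] := eqVneq j 0%N.
  rewrite /=; case: eqP => [->//|m1]; apply/eqP/negPn/negP => /(homog_deg hF).
  rewrite add0n => s0; apply: m1; apply/eqP; rewrite -word_nil -size_eq0.
  by have := size_le_sumn (word_pos m); rewrite s0 leqn0.
rewrite tcoef0; apply/eqP/negPn/negP => /(homog_deg hF) /eqP.
by rewrite addn_eq0 (negPf j0).
Qed.

Lemma eps_deg k F : homog k F -> (0 < k)%N -> eps F = 0.
Proof.
move=> hF k0; apply/eqP/negPn/negP => /(homog_deg hF).
by rewrite word1 => e; rewrite -e in k0.
Qed.

Lemma eps_scal c : eps (scal c) = c.
Proof. by rewrite /eps coefC /= eqxx. Qed.

Lemma epsD F G : eps (F + G) = eps F + eps G.
Proof. by rewrite /eps coefD. Qed.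

Lemma eps0 : eps 0 = 0.
Proof. by rewrite /eps coef0 tcoef0. Qed.

(** A product of two elements of positive degree is decomposable or of the wrong degree; if one
    factor is constant, the formula is linearity, since [phi] kills constants. *)
Lemma phiM F G : graded F -> graded G -> phi (F * G) = phi F * eps G + eps F * phi G.
Proof.
move=> gF gG; elim/graded_ind: gF => [|F1 F2 IH1 IH2|i {}F hF].
- by rewrite mul0r phi0 eps0 !mul0r addr0.
- by rewrite mulrDl !phiD IH1 IH2 epsD !mulrDl addrACA.
elim/graded_ind: gG => [|G1 G2 IH1 IH2|k {}G hG].
- by rewrite mulr0 phi0 eps0 !mulr0 addr0.
- by rewrite mulrDr !phiD IH1 IH2 epsD !mulrDr addrACA.
have [i0|i0] := posnP i.
  rewrite i0 in hF; rewrite (phi_deg hF) 1?eq_sym -?lt0n // mul0r add0r.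
  by rewrite {1}(homog0_scal hF) phiZ.
have [k0|k0] := posnP k.
  rewrite k0 in hG; rewrite (phi_deg hG) 1?eq_sym -?lt0n // mulr0 addr0.
  by rewrite {1}(homog0_scal hG) mulrC phiZ mulrC.
rewrite (eps_deg hF) // (eps_deg hG) // mulr0 mul0r addr0.
have [e|ne] := eqVneq (i + k)%N n; last exact: phi_deg (homogM R hF hG) ne.
rewrite -[F * G]addr0; apply: phi_dec; apply: (@DecM n i) => //; last exact: Dec0.
  by rewrite -e -[X in (X < _)%N]addn0 ltn_add2l.
by rewrite -e addKn.
Qed.

Fixpoint dw (w : seq nat) F : S := if w is k :: w' then dw w' (dS k F) else F.

Lemma graded_dw w F : graded F -> graded (dw w F).
Proof. by elim: w F => //= k w IH F gF; apply: IH; exact: graded_dS. Qed.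

Lemma homog_dw w k F : homog k F -> homog (k - sumn w) (dw w F).
Proof.
elim: w k F => [|l w IH] k F hF /=; first by rewrite subn0.
by rewrite subnDA; apply: IH; exact: homog_dS.
Qed.

Lemma dwD w F G : dw w (F + G) = dw w F + dw w G.
Proof. by elim: w F G => //= k w IH F G; rewrite dS_add IH. Qed.

Lemma dwZ w c F : dw w (scal c * F) = scal c * dw w F.
Proof. by elim: w F => //= k w IH F; rewrite dS_scal IH. Qed.

(* [phi] kills the constants and the decomposables, so that pairing it with the
   right factor of the coproduct dual to concatenation of words is a derivation
   along the restriction to [alpha = 0]. *)
Definition delta F : T := TSeries (fun m => phi (dw (word m) F)).

Lemma dts_delta k F : graded F -> dts k (delta F) = delta (dS k F).
Proof.
move=> gF; apply: tseriesP => m /=; rewrite word_consm.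
by have [->|//] := eqVneq k 0%N; rewrite dS0_graded.
Qed.

Lemma deltaD F G : delta (F + G) = delta F + delta G.
Proof. by apply: tseriesP => m /=; rewrite dwD phiD. Qed.

Lemma deltaZ c F : delta (scal c * F) = tsC c * delta F.
Proof. by apply: tseriesP => m; rewrite tcoefCM /= dwZ phiZ. Qed.

Lemma delta0 : delta 0 = 0.
Proof. by rewrite -[0 in LHS](mulr0 (scal 0)) deltaZ; apply: tseriesP => m; rewrite tcoefCM mul0r tcoef0. Qed.

Lemma delta_sum (I : Type) (r : seq I) (P : pred I) (E : I -> S) :
  delta (\sum_(i <- r | P i) E i) = \sum_(i <- r | P i) delta (E i).
Proof. by apply: (big_morph delta); [exact: deltaD|exact: delta0]. Qed.

(** Induction on the monomial: [dS] and [dts] obey the same product rule, and the constant term is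
    [phiM]. *)
Lemma deltaM F G : graded F -> graded G -> delta (F * G) = delta F * G`_0 + F`_0 * delta G.
Proof.
move=> gF gG; apply: tseriesP => m; elim/consm_ind: m F G gF gG => [|k m IH] F G gF gG.
  by rewrite tcoefD !tcoefM1 /= word1 /= phiM.
rewrite -[LHS]/(tcoef (dts k (delta (F * G))) m).
rewrite -[RHS]/(tcoef (dts k (delta F * G`_0 + F`_0 * delta G)) m).
rewrite dts_delta ?dSM; last exact: gradedM.
rewrite delta_sum dts_add !dtsM -big_split !tcoef_sum; apply: eq_bigr => i _.
rewrite IH; try exact: graded_dS.
by rewrite !dts_delta // !coef_dS.
Qed.

Lemma dS_X2 k F : dS k ('X^2 * F) = 'X^2 * dS k F.
Proof.
by apply/polyP => j; rewrite coef_dS !coefXnM; case: ifP => _; rewrite ?dts0 ?coef_dS.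
Qed.

Lemma phi_X2 F : graded F -> phi ('X^2 * F) = 0.
Proof.
elim/graded_ind => [|F1 F2 IH1 IH2|k {}F hF]; first by rewrite mulr0 phi0.
  by rewrite mulrDr phiD IH1 IH2 addr0.
have [e|ne] := eqVneq k.+2 n; last exact: phi_deg (homogX2 R hF) ne.
rewrite -['X^2 * F]addr0; apply/phi_dec/DecX; [lia| |exact: Dec0].
by rewrite -e !subSS subn0.
Qed.

Lemma delta_X2 F : graded F -> delta ('X^2 * F) = 0.
Proof.
move=> gF; apply: tseriesP => m; rewrite tcoef0 /=.
rewrite (_ : dw _ _ = 'X^2 * dw (word m) F); first exact/phi_X2/graded_dw.
by elim: (word m) (F) => //= k w IH G; rewrite dS_X2 IH.
Qed.

(** A nonempty word lowers the degree below [n], where [phi] vanishes. *)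
Lemma delta_homog k F : homog k F -> (k <= n)%N -> delta F = tsC (phi F).
Proof.
move=> hF kn; apply: tseriesP => m /=; case: eqP => [->|m1]; first by rewrite word1.
apply: (phi_deg (homog_dw (word m) hF)); rewrite neq_ltn; apply/orP; left.
suff : (0 < sumn (word m))%N by lia.
rewrite (leq_trans _ (size_le_sumn (word_pos m))) // lt0n size_eq0 word_nil.
exact/eqP.
Qed.

End Derivation.

(** * Polynomial rings in arbitrarily many variables *)

Section Monomials.
Variable I : choiceType.
Implicit Types (m : {cmonom I}) (i : I).

Lemma divcmK i m : (0 < m i)%N -> (ucm i * divcm m (ucm i))%M = m.
Proof.
move=> mi; apply/eqP/cmP => l; rewrite cmM divcmE cmU.
by case: eqP => [<-|] /=; lia.
Qed.

Lemma divcmMU i m : divcm (ucm i * m)%M (ucm i) = m.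
Proof. by apply/eqP/cmP => l; rewrite divcmE cmM addKn. Qed.

Lemma ucm_ind (P : {cmonom I} -> Prop) :
  P 1%M -> (forall i m, P m -> P (ucm i * m)%M) -> forall m, P m.
Proof.
move=> P1 PU m; have [n] := ubnP (mdeg m); elim: n m => // n IH m mn.
have [->//|/eqP m1] := eqVneq m 1%M.
have [i mi] : exists i, (0 < m i)%N.
  apply/not_existsP => m0; apply: m1; apply/eqP/cmP => i.
  by rewrite cm1; apply/eqP; rewrite -leqn0 leqNgt; apply/negP/m0.
rewrite -(divcmK mi); apply/PU/IH.
by move: mn; rewrite -{1}(divcmK mi) mdegM mdegU.
Qed.

Variables (A : comNzRingType) (x : I -> A).

Definition xmon m : A := \prod_(i <- finsupp m) x i ^+ m i.

Lemma xmonEw (d : {fset I}) m : (finsupp m `<=` d)%fset -> xmon m = \prod_(i <- d) x i ^+ m i.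
Proof.
move=> sd; apply: big_fset_incl => // i _ /fsfun_dflt mi.
by rewrite [m i]mi expr0.
Qed.

Lemma xmon_mmorphism : mmorphism xmon.
Proof.
split=> [m m'|]; last first.
  rewrite /xmon big1_seq // => i _; by rewrite cm1 expr0.
pose d := (finsupp (m * m')%M `|` finsupp m `|` finsupp m')%fset.
rewrite !(@xmonEw d); try by rewrite /d; apply/fsubsetP => i; rewrite !inE => ->; rewrite ?orbT.
by rewrite -big_split /=; apply: eq_bigr => i _; rewrite cmM exprD.
Qed.

HB.instance Definition _ := isMultiplicative.Build {cmonom I} A xmon xmon_mmorphism.

Lemma xmonM m m' : xmon (m * m')%M = xmon m * xmon m'.
Proof. exact: mmorphM. Qed.

Lemma xmon1 : xmon 1%M = 1.
Proof. exact: mmorph1. Qed.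

Lemma xmonU i : xmon (ucm i) = x i.
Proof. by rewrite /xmon mdomU big_seq_fset1 cmUU expr1. Qed.

End Monomials.

Section Quotient.
Variables (I : choiceType) (K : fieldType).
Implicit Types (q : {malg K[{cmonom I}]}) (c : {cmonom I} -> K) (i : I).

(** With [c m = m i] this is the partial derivative in the variable [i]; with [c = 1] it is the
    quotient by that variable of the terms containing it. *)
Definition mquot i c q : {malg K[{cmonom I}]} :=
  \sum_(m <- msupp q | (0 < m i)%N) << q@_m * c m *g divcm m (ucm i) >>.

Lemma mcoeff_mquot i c q m : (mquot i c q)@_m = q@_(ucm i * m)%M * c (ucm i * m)%M.
Proof.
rewrite /mquot raddf_sum /=; set m' := (ucm i * m)%M.
have m'i : (0 < m' i)%N by rewrite cmM cmUU.
have eqm (k : {cmonom I}) : (0 < k i)%N -> (divcm k (ucm i) == m) = (k == m').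
  by move=> ki; apply/eqP/eqP => [e|->]; rewrite /m' -?e ?divcmK ?divcmMU.
under eq_bigr => k ki do rewrite mcoeffU eqm //.
have [m'q|q0] := boolP (m' \in msupp q).
  rewrite big_mkcond (big_fsetD1 m') //= m'i eqxx big1_fset ?addr0 ?mulr1n // => k.
  by rewrite in_fsetD1 => /andP[ne _] _; rewrite (negPf ne) mulr0n if_same.
rewrite mcoeff_outdom // mul0r big1_seq // => k /andP[ki kq].
by case: eqP => [e|_]; [rewrite e (negPf q0) in kq|rewrite mulr0n].
Qed.

End Quotient.

(** * Independence and generation *)

Section Freeness.
Local Notation T := (tseries rat).
Local Notation S := {poly tseries rat}.
Variables (R : realType) (J : choiceType) (d : J -> nat) (x : J -> S) (phi : J -> S -> rat).
Hypothesis d_gt0 : forall j, (0 < d j)%N.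
Hypothesis xP : forall j, homog (d j) (x j).
Hypothesis phi_lin : forall j c F G, phi j (scal c * F + G) = c * phi j F + phi j G.
Hypothesis phi_dec : forall j F, decomposable (d j) F -> phi j F = 0.
Hypothesis phi_deg : forall j k F, homog k F -> k != d j -> phi j F = 0.
Hypothesis phi_x : forall j l, phi j (x l) = (j == l)%:R.
Implicit Types (j l : J) (i : option J) (m : {cmonom (option J)}).
Implicit Types (p q : {malg rat[{cmonom (option J)}]}).

Definition xgen i : S := if i is Some j then x j else 'X^2.

Definition xeval : {malg rat[{cmonom (option J)}]} -> S := mmap scal (xmon xgen).
HB.instance Definition _ := GRing.RMorphism.on xeval.

Lemma xevalM p q : xeval (p * q) = xeval p * xeval q.
Proof. exact: rmorphM. Qed.

Lemma xevalD p q : xeval (p + q) = xeval p + xeval q.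
Proof. exact: raddfD. Qed.

Lemma xevalU c m : xeval << c *g m >> = scal c * xmon xgen m.
Proof. exact: mmapU. Qed.

Lemma xevalE q : xeval q = \sum_(m <- msupp q) scal q@_m * xmon xgen m.
Proof. by rewrite /xeval mmapE. Qed.

Lemma graded_xgen i : graded (xgen i).
Proof. by case: i => [j|] /=; [exact: graded_homog (xP j)|exact: gradedX2]. Qed.

Lemma graded_xmon m : graded (xmon xgen m).
Proof.
elim/ucm_ind: m => [|i m IH]; first by rewrite xmon1; exact: graded1.
by rewrite xmonM xmonU; exact: (gradedM R (graded_xgen i) IH).
Qed.

Lemma graded_xeval q : graded (xeval q).
Proof. by rewrite xevalE; apply: graded_sum => m _; apply/gradedZ/graded_xmon. Qed.

(** On generators of degree at most [d j] the derivation is the constant 1 or 0, so it acts as the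
    partial derivative in [x j] followed by alpha = 0. *)
Lemma delta_xmon j m : m None = 0%N -> (forall l, (0 < m (Some l))%N -> (d l <= d j)%N) ->
  delta (phi j) (xmon xgen m) =
    tsC (m (Some j))%:R * (xmon xgen (divcm m (ucm (Some j))))`_0.
Proof.
have dphi0 : phi j 1 = 0 by apply: phi_deg (homog1 R) _; rewrite eq_sym -lt0n.
have c0 (f : T) : tsC (0 : rat) * f = 0.
  by apply: tseriesP => k; rewrite tcoefCM mul0r tcoef0.
have cD (a b : rat) (f : T) : tsC (a + b) * f = tsC a * f + tsC b * f.
  apply: tseriesP => k; rewrite tcoefD.
  rewrite [LHS]tcoefCM [X in _ = X + _]tcoefCM [X in _ = _ + X]tcoefCM.
  exact: mulrDl.
elim/ucm_ind: m => [_ _|i m IH].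
  rewrite xmon1 cm1 (delta_homog (d_gt0 j) (@phi_deg j) (homog1 R)) //.
  by rewrite dphi0 [RHS]c0.
rewrite cmM cmU; case: i => [i|] //= /eqP; rewrite addn_eq0 => /andP[_ /eqP m0] md.
have di : (d i <= d j)%N by apply: md; rewrite cmM cmUU.
have {}IH := IH m0 (fun l ml => md l (leq_trans ml _)).
rewrite xmonM xmonU (deltaM R (d_gt0 j) (@phi_lin j) (@phi_dec j) (@phi_deg j)); last first.
- exact: graded_xmon.
- exact: graded_xgen.
rewrite IH => [|l]; last by rewrite cmM leq_addl.
rewrite (delta_homog (d_gt0 j) (@phi_deg j) (xP i)) // phi_x.
rewrite (_ : (ucm (Some i) * m)%M (Some j) = ((i == j) + m (Some j))%N); last first.
  by rewrite cmM cmU.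
rewrite [j == i]eq_sym.
case: (eqVneq i j) => [->|ne].
  rewrite divcmMU natrD cD; case: (posnP (m (Some j))) => [->|mj]; first by rewrite !c0 mulr0.
  congr (_ + _); rewrite mulrCA -[(x j)`_0 * _]coef0M -[x j]/(xgen (Some j)).
  by rewrite -(xmonU xgen) -xmonM divcmK.
rewrite c0 add0r add0n; case: (posnP (m (Some j))) => [->|mj]; first by rewrite !c0 mulr0.
rewrite (_ : divcm (ucm (Some i) * m)%M _ = (ucm (Some i) * divcm m (ucm (Some j)))%M).
  by rewrite mulrCA xmonM xmonU coef0M.
apply/eqP/cmP => l; rewrite cmM !divcmE cmM !cmU.
by case: (eqVneq (Some j) l) => [<-|_] /=; [rewrite [Some i == _](negPf ne)|rewrite !subn0].
Qed.

Lemma xeval_mquot i c q :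
  xeval (mquot i c q) = \sum_(m <- msupp q | (0 < m i)%N) scal (q@_m * c m) * xmon xgen (divcm m (ucm i)).
Proof. by rewrite /mquot raddf_sum; apply: eq_bigr => m _; exact: xevalU. Qed.

Definition is_low N q := forall m, q@_m != 0 -> m None = 0%N /\ (mdeg m < N)%N.

Lemma is_low_mquot N j c q : is_low N.+1 q -> is_low N (mquot (Some j) c q).
Proof.
move=> qN m; rewrite mcoeff_mquot mulf_eq0 negb_or => /andP[/qN[]].
by rewrite cmM cmU mdegM mdegU.
Qed.

Lemma delta_xeval N j q : is_low N q ->
  (forall m l, q@_m != 0 -> (0 < m (Some l))%N -> (d l <= d j)%N) ->
  delta (phi j) (xeval q) = (xeval (mquot (Some j) (fun m => (m (Some j))%:R) q))`_0.
Proof.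
move=> low md; rewrite xevalE (delta_sum (@phi_lin j) (@phi_dec j)) xeval_mquot coef_sum.
rewrite [RHS]big_mkcond /= !big_seq; apply: eq_bigr => m; rewrite -mcoeff_neq0 => qm.
rewrite (deltaZ (@phi_lin j) (@phi_dec j)) delta_xmon => [||l]; last 2 first.
- by have [] := low m qm.
- exact: md.
have c0 (c : rat) (f : T) : c = 0 -> tsC c * f = 0.
  by move=> ->; apply: tseriesP => k; rewrite tcoefCM mul0r tcoef0.
case: posnP => [m0|_]; first by rewrite m0 [X in _ * X]c0 ?mulr0.
rewrite coefCM; apply: tseriesP => k; rewrite !tcoefCM.
exact: mulrA.
Qed.

Lemma xeval_low_inj N q : is_low N q -> (xeval q)`_0 = 0 -> q = 0.
Proof.
elim: N q => [|N IH] q low q0.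
  by apply/malgP => m; rewrite mcoeff0; apply/eqP/negPn/negP => /low[].
pose P k := `[< exists m j, [/\ q@_m != 0, (0 < m (Some j))%N & d j = k] >].
pose dd i := if i is Some j then d j else 0%N.
have Pmax k : P k -> (k <= \max_(m <- msupp q) \max_(i <- finsupp m) dd i)%N.
  move=> /asboolP[m [j [qm mj <-]]].
  apply: (@leq_trans (\max_(i <- finsupp m) dd i)%N).
    by apply: (@leq_bigmax_seq _ _ xpredT dd (Some j)) => //; rewrite mem_finsupp -lt0n.
  apply: (@leq_bigmax_seq _ _ xpredT (fun m : {cmonom (option J)} => \max_(i <- finsupp m) dd i)%N m) => //.
  by rewrite -mcoeff_neq0.
(* Either a variable of largest degree occurs, or [q] is a constant. *)
have [P0|noP] := pselect (exists k, P k).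
  case: (ex_maxnP P0 Pmax) => _ /asboolP[m [j [qm mj <-]]] jmax.
  (* Vanishing at alpha = 0 means divisibility by alpha^2 in the algebra, which the derivation
     kills; thus the value of the partial derivative also vanishes at alpha = 0. *)
  have [G gG qG] := graded_ker (graded_xeval q) q0.
  have dq0 : delta (phi j) (xeval q) = 0.
    by rewrite qG; exact: (delta_X2 R (d_gt0 j) (@phi_lin j) (@phi_dec j) (@phi_deg j)).
  have md m' l : q@_m' != 0 -> (0 < m' (Some l))%N -> (d l <= d j)%N.
    by move=> qm' ml; apply/jmax/asboolP; exists m', l.
  rewrite (delta_xeval low md) in dq0.
  have := IH _ (is_low_mquot low) dq0.
  move=> /(congr1 (mcoeff (divcm m (ucm (Some j))))).
  rewrite mcoeff_mquot divcmK // mcoeff0 => /eqP.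
  (* Characteristic zero: the exponent of [x j] in [m] is a nonzero rational. *)
  by rewrite mulf_eq0 (negPf qm) pnatr_eq0 -leqn0 leqNgt mj.
have q1 m : m != 1%M -> q@_m = 0.
  move=> m1; apply/eqP/negPn/negP => qm; have [m0 _] := low m qm.
  case/negP: m1; apply/cmP => -[j|]; rewrite cm1 ?m0 //; apply/eqP.
  case: posnP => // mj; case: noP.
  by exists (d j); apply/asboolP; exists m, j.
have qE : q = << q@_1%M *g 1%M >>.
  apply/malgP => m; rewrite mcoeffU eq_sym.
  by have [->|/q1->] := eqVneq m 1%M; rewrite ?mulr1n.
move: q0; rewrite qE xevalU xmon1 mulr1 => c0.
have : eps (scal q@_1%M) = 0 by rewrite /eps c0 tcoef0.
rewrite eps_scal => ->.
by apply/malgP => m; rewrite mcoeffU mcoeff0 mul0rn.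
Qed.

Lemma X2_reg (F : S) : 'X^2 * F = 0 -> F = 0.
Proof.
move=> F0; apply/polyP => k; move: F0 => /(congr1 (fun G : S => G`_(k + 2))).
by rewrite coefXnM ltnNge leq_addl addnK !coef0.
Qed.

Lemma xeval_inj : injective xeval.
Proof.
apply: raddf_inj => p.
have [N] : exists N, forall m, p@_m != 0 -> (mdeg m < N)%N.
  by exists (mmeasure mdeg p) => m; rewrite mcoeff_neq0; exact: msize_mdeg_lt.
elim: N p => [|N IH] p pN p0.
  by apply/malgP => m; rewrite mcoeff0; apply/eqP/negPn/negP => /pN.
(* The terms without the variable for alpha^2. At alpha = 0 only they remain, so they vanish by
   [xeval_low_inj], and alpha^2 can be cancelled from the rest. *)
pose q := \sum_(m <- msupp p | ~~ (0 < m None)%N) << p@_m *g m >>.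
pose r := mquot None (fun=> 1) p.
have qE m : q@_m = if (0 < m None)%N then 0 else p@_m.
  rewrite /q raddf_sum /=; under eq_bigr => k _ do rewrite mcoeffU.
  have [mp|np] := boolP (m \in msupp p); last first.
    rewrite mcoeff_outdom // if_same big1_seq // => k /andP[_ kp].
    by case: eqP => [e|_]; [rewrite e (negPf np) in kp|rewrite mulr0n].
  rewrite big_mkcond (big_fsetD1 m) //= eqxx big1_fset ?addr0 ?mulr1n => [|k].
    by case: (0 < m None)%N.
  by rewrite in_fsetD1 => /andP[ne _] _; rewrite (negPf ne) mulr0n if_same.
have split : xeval p = 'X^2 * xeval r + xeval q.
  rewrite xevalE (bigID (fun m => 0 < m None)%N) /=; congr (_ + _).
    rewrite xeval_mquot mulr_sumr; apply: eq_bigr => m m0.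
    by rewrite mulr1 -{2}(divcmK m0) xmonM xmonU mulrCA.
  by rewrite /q raddf_sum; apply: eq_bigr => m _; exact/esym/xevalU.
have {}p0 : 'X^2 * xeval r + xeval q = 0 by rewrite -split; exact: p0.
have q0 : q = 0.
  apply: (@xeval_low_inj N.+1) => [m|].
    by rewrite qE; case: posnP => [m0 /pN|]; rewrite ?eqxx.
  move: p0 => /(congr1 (fun F : S => F`_0)).
  by rewrite coefD coefXnM /= add0r coef0.
move: p0; rewrite q0 raddf0 addr0 => /X2_reg r0.
have {}r0 : r = 0.
  apply: IH r0 => m; rewrite mcoeff_mquot mulr1 => /pN.
  by rewrite mdegM mdegU.
apply/malgP => m; rewrite mcoeff0; have [m0|m0] := posnP (m None).
  by move: q0 => /(congr1 (mcoeff m)); rewrite qE m0 mcoeff0.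
move: r0 => /(congr1 (mcoeff (divcm m (ucm None)))).
by rewrite mcoeff_mquot divcmK // mulr1 mcoeff0.
Qed.

Hypothesis span : forall n F, (0 < n)%N -> homog n F -> exists q, decomposable n (F - xeval q).

(** Modulo the basis elements of its degree [F] is decomposable, and the factors of its
    decomposition have smaller degree. *)
Lemma xeval_onto n F : homog n F -> exists q, xeval q = F.
Proof.
elim/ltn_ind: n F => n IH F nF; have [n0|n0] := posnP n.
  rewrite n0 in nF; exists << eps F *g 1%M >>.
  by rewrite xevalU xmon1 mulr1 -homog0_scal.
have [q dq] := span n0 nF.
suff [q' q'E] : exists q', xeval q' = F - xeval q.
  by exists (q' + q); rewrite xevalD q'E subrK.
elim: dq => [|i F1 F2 G i0 iN h1 h2 _ [q3 <-]|G H n1 h _ [q3 <-]].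
- by exists 0; rewrite raddf0.
- have [q1 <-] := IH i iN _ h1; have [|q2 <-] := IH (n - i)%N _ _ h2; first lia.
  by exists (q1 * q2 + q3); rewrite xevalD xevalM.
- have [|q1 <-] := IH (n - 2)%N _ _ h; first lia.
  by exists (<< 1 *g ucm None >> * q1 + q3); rewrite xevalD xevalM xevalU rmorph1 mul1r xmonU.
Qed.

Lemma free_graded : free_polynomial_algebra (@graded : set S).
Proof.
exists (option J), xeval; split; first exact: xeval_inj.
apply/seteqP; split=> [_ [q _ <-]|F]; first exact: graded_xeval.
elim/graded_ind => [|_ _ [p _ <-] [q _ <-]|n {}F /xeval_onto[q <-]].
- by exists 0 => //; rewrite raddf0.
- by exists (p + q) => //; exact: xevalD.
- by exists q.
Qed.

End Freeness.

Theorem theorem4 (R : realType) :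
  free_polynomial_algebra (tensor_rat (@f_image R)).
Proof.
(* The index [n] stands for degree [n + 1], so that all generators have positive degree. *)
pose b n := basis_exists R n.+1.
pose r n := projT1 (b n); pose y n := projT1 (projT2 (b n)); pose f n := sval (projT2 (projT2 (b n))).
have bP n : is_basis n.+1 (y n) (f n) by exact: svalP (projT2 (projT2 (b n))).
pose J : choiceType := {n : nat & 'I_(r n)}%type.
pose gen n (i : 'I_(r n)) : J := existT _ n i.
pose x (j : J) := y (projT1 j) (projT2 j).
pose phi (j : J) := f (projT1 j) (projT2 j).
rewrite tensor_ratE; apply: (@free_graded R J (fun j => (projT1 j).+1) x phi) => //.
- by case=> n i; have [h _ _ _ _] := bP n; exact: h.
- by case=> n i; have [_ h _ _ _] := bP n; exact: h.
- by case=> n i; have [_ _ _ h _] := bP n; exact: h.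
- by case=> n i; have [_ _ _ _ [h _]] := bP n; exact: h.
- case=> [n i] [k l]; have [nk|ne] := eqVneq n k.
    by case: k / nk l => l; have [_ _ h _ _] := bP n; rewrite eq_Tagged; exact: h.
  have [h _ _ _ _] := bP k; have [_ _ _ _ [deg _]] := bP n.
  rewrite /phi (deg i k.+1); [|exact: h|by rewrite eqSS eq_sym].
  by case: eqP => // -[e]; rewrite e eqxx in ne.
- case=> // n F _ nF; have [_ _ _ _ [_ sp]] := bP n.
  exists (\sum_i << f n i F *g ucm (Some (gen n i)) >>).
  have := sp F nF; congr (decomposable _ (_ - _)).
  rewrite raddf_sum; apply: eq_bigr => i _.
  by rewrite [RHS]xevalU xmonU.
Qed.
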